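(* Let $E$ be a compact metric space and let $\{T_t\}_{t\ge0}$ be a conservative Feller semigroup on $E$ (i.e. $T_t\mathbf{1}=\mathbf{1}$) whose transition kernels are of the form $p_{t,x}(dy)=p_t(x,y)\,\mathbf{m}(dy)$ for $t>0$, $x\in E$, for some finite positive measure $\mathbf{m}$ on $E$ with $L^2(E,\mathbf{m})$ infinite-dimensional and some density function $p_t(x,y)$ which is bounded and symmetric on $E\times E$ for each $t>0$. Let $\{T^{(2)}_t\}$ be the extension of $\{T_t\}$ to a strongly continuous semigroup on $L^2(E,\mathbf{m})$. Let $0\le\lambda_1\le\lambda_2\le\dots$ and let $\{\omega_j\}_{j\in\mathbb{N}}$ be an orthonormal basis of $L^2(E,\mathbf{m})$ such that $T_t^{(2)}\omega_j=e^{-\lambda_jt}\omega_j$ for all $t\ge0$ and $j\in\mathbb{N}$. Assume that the operator $T^{(2)}_1$ has simple spectrum (i.e. all the eigenvalues $e^{-\lambda_j}$ have multiplicity $1$). Then the following are equivalent: (i) There exists a Feller-Lévy trivializable convolution (FLTC) for $\{T_t\}_{t\ge0}$; (ii) There exists $a\in E$ such that $|\omega_j(a)|=\|\omega_j\|_\infty$ for all $j\in\mathbb{N}$, and the functions $\varphi_j(x):=\frac{\omega_j(x)}{\omega_j(a)}$ satisfy the positivity condition $$\sum_{j=1}^\infty\frac{1}{\|\varphi_j\|_{2}^2}e^{-\lambda_jt}\varphi_j(x)\,\varphi_j(y)\,\varphi_j(\xi)\ge0\qquad\text{for all }t>0\text{ and }x,y,\xi\in E,$$ where $\|\cdot\|_2$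 is the norm of $L^2(E,\mathbf{m})$.
   Context: Under the stated density assumption, $\{T_t\}$ is strong Feller, it extends to a strongly continuous semigroup $\{T^{(2)}_t\}$ of symmetric operators on $L^2(E,\mathbf{m})$, and pairs $(\lambda_j,\omega_j)$ as in the claim exist. Each $\omega_j$ is identified with its continuous representative. $\|f\|_\infty=\sup_{x\in E}|f(x)|$; $\mathbf{1}$ is the constant function equal to one. $\mathcal{M}_{\mathbb{C}}(E)$ and $\mathcal{P}(E)$ denote the finite complex Borel measures and the Borel probability measures on $E$; $\delta_x$ is the Dirac measure at $x$; the weak topology is the one induced by integration against bounded continuous functions; $\mu(\vartheta):=\int_E\vartheta\,d\mu$. $\mathrm{B}_{\mathrm{b}}(E)$, $\mathrm{C}_{\mathrm{b}}(E)$, $\mathrm{C}_0(E)$ are the spaces of bounded measurable, bounded continuous, and continuous vanishing at infinity functions on $E$. A Feller semigroup on $E$ is a strongly continuous semigroup $\{T_t\}_{t\ge0}$ of positive linear contractions on $\mathrm{C}_0(E)$. Its transition kernel $\{p_{t,x}\}$ is the family of measures with $(T_tf)(x)=\int_Ef\,dp_{t,x}$, and $T_t$ is extended to $\mathrm{B}_{\mathrm{b}}(E)$ by this formula. It is strong Feller if $T_t(\mathrm{B}_{\mathrm{b}}(E))\subset\mathrm{C}_{\mathrm{b}}(E)$ for all $t>0$. Definition (FLTC). Let $\{T_t\}$ be a strong Feller semigroup on a locally compact separable metric space $E$ with transition kernel $\{p_{t,x}\}$. A bilinear operator $\diamond$ on $\mathcal{M}_{\mathbb{C}}(E)$ is an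 FLTC for $\{T_t\}$ if: (I) $(\mathcal{M}_{\mathbb{C}}(E),\diamond)$ is a commutative Banach algebra over $\mathbb{C}$ (with the total variation norm) with identity element $\delta_a$ for some $a\in E$, and $(\mu,\nu)\mapsto\mu\diamond\nu$ is continuous in the weak topology of measures; (II) $\mathcal{P}(E)\diamond\mathcal{P}(E)\subset\mathcal{P}(E)$; (III) there is a family $\Theta\subset\mathrm{B}_{\mathrm{b}}(E)\setminus\{0\}$ such that $\mu=\mu_1\diamond\mu_2$ if and only if $\mu(\vartheta)=\mu_1(\vartheta)\,\mu_2(\vartheta)$ for all $\vartheta\in\Theta$; (IV) $p_{t,x}=\gamma_t\diamond\delta_x$ for all $t\ge0$, $x\in E$, where $\{\gamma_t\}_{t\ge0}\subset\mathcal{P}(E)$ satisfies $\gamma_{t+s}=\gamma_t\diamond\gamma_s$ for all $t,s\ge0$.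
   Formalization: In the definition of FLTC, weak continuity of (μ,ν)↦μ⋄ν is required for weakly convergent sequences of complex measures; joint continuity in the product weak topology on all of M_C(E) would fail, for example for cosine convolution on [0,π], which satisfies (ii). *)

(* Defs.v *)
Set Warnings "-notation-overridden,-notation-incompatible-prefix,-ambiguous-paths".
From HB Require Import structures.
From mathcomp Require Import all_boot all_order all_algebra.
From mathcomp Require Import complex.
From mathcomp Require Import all_classical all_reals all_analysis.

Set Implicit Arguments.
Unset Strict Implicit.
Unset Printing Implicit Defensive.

Import Order.TTheory GRing.Theory Num.Theory.
Import numFieldNormedType.Exports.

Local Open Scope classical_set_scope.
Local Open Scope ring_scope.
Local Open Scope complex_scope.

(* [complex.v] does not give R[i] a topology; we use the one of its modulus. *)
HB.instance Definition _ (R : realType) := NormedModule.copy R[i] R[i]^o.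

(* The real-valued modulus (the norm of R[i] is R[i]-valued). *)
Notation normc := (@ComplexField.Normc.normc _).

Local Notation Re := (@complex.Re _).
Local Notation Im := (@complex.Im _).

(* Metric spaces equipped with their Borel sigma-algebra. [measurableType]s are
   pointed, hence nonempty; the distinguished point plays no role. *)
HB.mixin Record isBorel (d : measure_display) T
    & Measurable d T & Topological T := {
  borel_measurableE : @measurable d T = <<s @open T >> }.

#[short(type="borelMetricType")]
HB.structure Definition BorelMetric (d : measure_display) (K : numDomainType) :=
  { T of Metric K T & Measurable d T & isBorel d T }.

Section complex_limits.
Context {R : realType}.
Implicit Types (z : R[i]) (x : R).

Lemma normr_normc z : `|z| = (normc z)%:C. Proof. by []. Qed.

Lemma ler_Re_normc z : `|Re z| <= normc z.
Proof.
by case: z => a b /=; rewrite -sqrtr_sqr ler_wsqrtr// lerDl; exact: sqr_ge0.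
Qed.

Lemma ler_Im_normc z : `|Im z| <= normc z.
Proof.
by case: z => a b /=; rewrite -sqrtr_sqr ler_wsqrtr// lerDr; exact: sqr_ge0.
Qed.

Lemma cvg_normc_lt (z : R[i]) (e : R) :
  0 < e -> \forall w \near z, normc (z - w) < e.
Proof.
move=> e0; near=> w; rewrite -ltcR -normr_normc; near: w.
by apply: (@cvgr_dist_lt _ _ _ (nbhs z)); [exact: cvg_id|rewrite ltcR].
Unshelve. all: by end_near. Qed.

Lemma continuous_Re : continuous (@complex.Re R : R[i] -> R).
Proof.
move=> z; apply: (iffRL (@cvgrPdist_lt R R R[i] (nbhs z) _ _ _)) => e e0.
near=> w; apply: (@le_lt_trans _ _ (normc (z - w))); last first.
  by near: w; exact: cvg_normc_lt.
by rewrite -(raddfB (@complex.Re R : Rcomplex R -> R)) ler_Re_normc.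
Unshelve. all: by end_near. Qed.

Lemma continuous_Im : continuous (@complex.Im R : R[i] -> R).
Proof.
move=> z; apply: (iffRL (@cvgrPdist_lt R R R[i] (nbhs z) _ _ _)) => e e0.
near=> w; apply: (@le_lt_trans _ _ (normc (z - w))); last first.
  by near: w; exact: cvg_normc_lt.
by rewrite -(raddfB (@complex.Im R : Rcomplex R -> R)) ler_Im_normc.
Unshelve. all: by end_near. Qed.

Lemma continuous_real_complex : continuous (fun x : R => x%:C : R[i]).
Proof.
move=> x; apply: (iffRL (@cvgrPdist_lt R[i] R[i] R (nbhs x) _ _ _)) => e e0.
have eE : e = (Re e)%:C by case: e e0 => a b /andP[/eqP/= -> _].
rewrite eE ltcR in e0; near=> y.
rewrite -rmorphB/= normr_normc/= expr0n/= addr0 sqrtr_sqr eE ltcR.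
by near: y; apply: (@cvgr_dist_lt _ _ _ (nbhs x)); [exact: cvg_id|].
Unshelve. all: by end_near. Qed.

End complex_limits.

Section complex_measures.
Context {d : measure_display} (T : measurableType d) (R : realType).

(* A complex measure is defined on measurable sets only; it is extended by 0
   so that Leibniz equality is the equality of measures. *)
Record cmeasure := CMeasure {
  cmeasure_fun :> set T -> R[i] ;
  cmeasure_sigma_additive : forall F : (set T)^nat,
    (forall n, measurable (F n)) -> trivIset setT F ->
    (fun n => \sum_(0 <= i < n) cmeasure_fun (F i)) @ \oo
      --> cmeasure_fun (\bigcup_n F n) ;
  cmeasure_nonmeasurable : forall A, ~ measurable A -> cmeasure_fun A = 0 }.

Lemma cmeasureP (mu nu : cmeasure) :
  (forall A, measurable A -> mu A = nu A) -> mu = nu.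
Proof.
case: mu nu => [f fs f0] [g gs g0] /= fg.
have {fg}fg : f = g.
  apply/funext => A; have [mA|mA] := pselect (measurable A); first exact: fg.
  by rewrite f0// g0.
by subst g; congr CMeasure; exact: Prop_irrelevance.
Qed.

HB.instance Definition _ := gen_eqMixin cmeasure.
HB.instance Definition _ := gen_choiceMixin cmeasure.

Program Definition cmeasure_zero := @CMeasure (fun=> 0) _ _.
Next Obligation.
by move=> F mF tF; under eq_fun do rewrite big1//; exact: cvg_cst.
Qed.
Next Obligation. by []. Qed.

Program Definition cmeasure_opp (mu : cmeasure) :=
  @CMeasure (fun A => - mu A) _ _.
Next Obligation.
move=> mu F mF tF; under eq_fun do rewrite sumrN.
by apply: cvgN; exact: cmeasure_sigma_additive.
Qed.
Next Obligation. by move=> mu A mA /=; rewrite cmeasure_nonmeasurable// oppr0. Qed.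

Program Definition cmeasure_add (mu nu : cmeasure) :=
  @CMeasure (fun A => mu A + nu A) _ _.
Next Obligation.
move=> mu nu F mF tF; under eq_fun do rewrite big_split/=.
by apply: cvgD; exact: cmeasure_sigma_additive.
Qed.
Next Obligation.
by move=> mu nu A mA /=; rewrite !cmeasure_nonmeasurable// addr0.
Qed.

Program Definition cmeasure_scale (c : R[i]) (mu : cmeasure) :=
  @CMeasure (fun A => c * mu A) _ _.
Next Obligation.
move=> c mu F mF tF; under eq_fun do rewrite -mulr_sumr.
by apply: cvgMr; exact: cmeasure_sigma_additive.
Qed.
Next Obligation.
by move=> c mu A mA /=; rewrite cmeasure_nonmeasurable// mulr0.
Qed.

Fact cmeasure_addA : associative cmeasure_add.
Proof. by move=> *; apply: cmeasureP => A _ /=; rewrite addrA. Qed.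
Fact cmeasure_addC : commutative cmeasure_add.
Proof. by move=> *; apply: cmeasureP => A _ /=; rewrite addrC. Qed.
Fact cmeasure_add0 : left_id cmeasure_zero cmeasure_add.
Proof. by move=> *; apply: cmeasureP => A _ /=; rewrite add0r. Qed.
Fact cmeasure_addN : left_inverse cmeasure_zero cmeasure_opp cmeasure_add.
Proof. by move=> *; apply: cmeasureP => A _ /=; rewrite addNr. Qed.

HB.instance Definition _ := GRing.isZmodule.Build cmeasure
  cmeasure_addA cmeasure_addC cmeasure_add0 cmeasure_addN.

Fact cmeasure_scaleA (a b : R[i]) mu :
  cmeasure_scale a (cmeasure_scale b mu) = cmeasure_scale (a * b) mu.
Proof. by apply: cmeasureP => A _ /=; rewrite mulrA. Qed.
Fact cmeasure_scale1 : left_id 1 cmeasure_scale.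
Proof. by move=> *; apply: cmeasureP => A _ /=; rewrite mul1r. Qed.
Fact cmeasure_scaleDr : right_distributive cmeasure_scale +%R.
Proof. by move=> *; apply: cmeasureP => A _ /=; rewrite mulrDr. Qed.
Fact cmeasure_scaleDl mu :
  {morph cmeasure_scale^~ mu : a b / a + b}.
Proof. by move=> *; apply: cmeasureP => A _ /=; rewrite mulrDl. Qed.

HB.instance Definition _ := GRing.Zmodule_isLmodule.Build R[i] cmeasure
  cmeasure_scaleA cmeasure_scale1 cmeasure_scaleDr cmeasure_scaleDl.

Definition tvnorm (mu : cmeasure) : \bar R :=
  ereal_sup [set s | exists n (F : 'I_n -> set T),
    [/\ forall i, measurable (F i), trivIset setT F,
        \bigcup_i F i = setT & s = (\sum_(i < n) normc (mu (F i)))%:E]].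

End complex_measures.

Section integration.
Context {d : measure_display} {T : measurableType d} {R : realType}.

Lemma cmeasure0 (mu : cmeasure T R) : mu set0 = 0.
Proof.
have tF0 : trivIset setT (fun _ : nat => set0 : set T).
  by apply/trivIsetP => i j _ _ _; rewrite setI0.
have := @cmeasure_sigma_additive _ _ _ mu _ (fun=> measurable0) tF0.
rewrite bigcup0//; set S := (fun n : nat => _) => S0.
have S1 : (fun n => S n.+1) @ \oo --> mu set0 by rewrite cvg_shiftS.
have : (fun n => S n.+1 - S n) @ \oo --> mu set0 - mu set0 by exact: cvgB.
rewrite subrr (_ : (fun n => _) = cst (mu set0)) => [S10|].
  have SC : cst (mu set0) @ \oo --> mu set0 by exact: cvg_cst.
  exact: (@cvg_unique _ (@norm_hausdorff R[i] R[i]) _ _ _ _ SC S10).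
by apply/funext => n /=; rewrite /S big_nat_recr//= addrAC subrr add0r.
Qed.

Definition re_charge (mu : cmeasure T R) (A : set T) : \bar R := (Re (mu A))%:E.
Definition im_charge (mu : cmeasure T R) (A : set T) : \bar R := (Im (mu A))%:E.

Section charges.
Variable mu : cmeasure T R.

Let re0 : re_charge mu set0 = 0%E.
Proof. by rewrite /re_charge cmeasure0. Qed.
Let re_fin A : measurable A -> re_charge mu A \is a fin_num.
Proof. by []. Qed.
Let re_sigma : semi_sigma_additive (re_charge mu).
Proof.
move=> F mF tF _; rewrite /re_charge.
under eq_fun do rewrite sumEFin -raddf_sum/=.
apply: cvg_EFin; first by near=> n.
apply: (cvg_comp _ _ (cmeasure_sigma_additive mF tF)).
exact: continuous_Re.
Unshelve. all: by end_near. Qed.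
HB.instance Definition _ :=
  isCharge.Build _ _ _ (re_charge mu) re0 re_fin re_sigma.

Let im0 : im_charge mu set0 = 0%E.
Proof. by rewrite /im_charge cmeasure0. Qed.
Let im_fin A : measurable A -> im_charge mu A \is a fin_num.
Proof. by []. Qed.
Let im_sigma : semi_sigma_additive (im_charge mu).
Proof.
move=> F mF tF _; rewrite /im_charge.
under eq_fun do rewrite sumEFin -raddf_sum/=.
apply: cvg_EFin; first by near=> n.
apply: (cvg_comp _ _ (cmeasure_sigma_additive mF tF)).
exact: continuous_Im.
Unshelve. all: by end_near. Qed.
HB.instance Definition _ :=
  isCharge.Build _ _ _ (im_charge mu) im0 im_fin im_sigma.

End charges.

(* Integral against a signed measure, by its Jordan decomposition (which does
   not depend on the chosen Hahn decomposition). *)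
Definition charge_integral (nu : {charge set T -> \bar R}) (f : T -> R) : R :=
  let nuPN := projT2 (cid (projT2 (cid (Hahn_decomposition nu)))) in
  \int[jordan_pos nuPN]_x f x - \int[jordan_neg nuPN]_x f x.

Definition cmeasure_integral (mu : cmeasure T R) (f : T -> R[i]) : R[i] :=
  (charge_integral (re_charge mu) (Re \o f)
     - charge_integral (im_charge mu) (Im \o f))
  +i* (charge_integral (re_charge mu) (Im \o f)
     + charge_integral (im_charge mu) (Re \o f)).

Definition cintegral (mu : {measure set T -> \bar R}) (f : T -> R[i]) : R[i] :=
  (\int[mu]_x Re (f x)) +i* (\int[mu]_x Im (f x)).

Program Definition cmeasure_of (mu : {finite_measure set T -> \bar R}) :=
  @CMeasure _ T R
    (fun A => if A \in measurable then (fine (mu A))%:C else 0) _ _.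
Next Obligation.
move=> mu F mF tF; have mUF : measurable (\bigcup_n F n) by exact: bigcupT_measurable.
rewrite mem_set//.
rewrite (_ : (fun n => _) =
    (fun x : R => x%:C) \o (fun n => fine (\sum_(0 <= i < n) mu (F i))%E)).
  apply: continuous_cvg; first exact: continuous_real_complex.
  apply: fine_cvg; rewrite fineK ?fin_num_measure//.
  exact: measure_semi_sigma_additive.
apply/funext => n /=; rewrite -sum_fine => [|i _]; last exact: fin_num_measure.
by rewrite raddf_sum/=; apply: eq_bigr => i _; rewrite mem_set.
Qed.
Next Obligation. by move=> mu A mA /=; rewrite memNset. Qed.

Definition cmeasure_dirac (x : T) : cmeasure T R := cmeasure_of \d_x.

Definition cmeasure_probability (mu : cmeasure T R) :=
  (forall A, measurable A -> 0 <= mu A) /\ mu setT = 1.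

Definition cmeasurable (f : T -> R[i]) :=
  measurable_fun setT (Re \o f) /\ measurable_fun setT (Im \o f).

Definition cbounded (f : T -> R[i]) := exists M, forall x, normc (f x) <= M.

Definition bounded_measurable (f : T -> R[i]) := cmeasurable f /\ cbounded f.

Definition supnorm (f : T -> R[i]) : R := sup (range (normc \o f)).

End integration.

Section L2_space.
Context {d : measure_display} {T : measurableType d} {R : realType}.
Variable m : {measure set T -> \bar R}.

(* L2 functions are represented by genuine functions, compared up to m-almost
   everywhere equality. *)
Definition L2 (f : T -> R[i]) :=
  cmeasurable f /\ (\int[m]_x ((normc (f x)) ^+ 2)%:E < +oo)%E.

Definition L2norm (f : T -> R[i]) : R :=
  Num.sqrt (\int[m]_x (normc (f x)) ^+ 2).

Definition L2dot (f g : T -> R[i]) : R[i] := cintegral m (fun x => f x * (g x)^*).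

Definition ae_eqc (f g : T -> R[i]) := {ae m, forall x, f x = g x}.

Definition L2_infinite_dimensional := forall n, exists2 f : 'I_n -> T -> R[i],
  forall i, L2 (f i) &
  forall c : 'I_n -> R[i],
    ae_eqc (fun x => \sum_(i < n) c i * f i x) (fun=> 0) -> forall i, c i = 0.

Definition L2_orthonormal_basis (w : nat -> T -> R[i]) := [/\
  forall j, L2 (w j),
  forall i j, L2dot (w i) (w j) = (i == j)%:R &
  forall f, L2 f ->
    (fun n => L2norm (fun x => f x - \sum_(0 <= j < n) L2dot f (w j) * w j x))
      @ \oo --> (0 : R)].

Record L2_semigroup (S : R -> (T -> R[i]) -> T -> R[i]) : Prop := {
  L2_semigroup_stable : forall t f, 0 <= t -> L2 f -> L2 (S t f) ;
  L2_semigroup_ae : forall t f g, 0 <= t -> L2 f -> L2 g ->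
    ae_eqc f g -> ae_eqc (S t f) (S t g) ;
  L2_semigroup_linear : forall t c f g, 0 <= t -> L2 f -> L2 g ->
    ae_eqc (S t (fun x => c * f x + g x)) (fun x => c * S t f x + S t g x) ;
  L2_semigroup_bounded : forall t, 0 <= t ->
    exists M, forall f, L2 f -> L2norm (S t f) <= M * L2norm f ;
  L2_semigroup0 : forall f, L2 f -> ae_eqc (S 0 f) f ;
  L2_semigroupD : forall t s f, 0 <= t -> 0 <= s -> L2 f ->
    ae_eqc (S (t + s) f) (S t (S s f)) ;
  L2_semigroup_continuous : forall f, L2 f ->
    (fun t => L2norm (fun x => S t f x - f x)) @ 0^'+ --> (0 : R) }.

Definition L2_eigenvector (A : (T -> R[i]) -> T -> R[i]) (z : R[i])
    (f : T -> R[i]) :=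
  L2 f /\ ae_eqc (A f) (fun x => z * f x).

Definition multiplicity_one (A : (T -> R[i]) -> T -> R[i]) (z : R[i]) :=
  exists f, [/\ L2_eigenvector A z f, ~ ae_eqc f (fun=> 0) &
    forall g, L2_eigenvector A z g -> exists c, ae_eqc g (fun x => c * f x)].

End L2_space.

Section feller.
Context {d : measure_display} {R : realType} {E : borelMetricType d R}.

Definition Cb (f : E -> R[i]) := continuous f /\ cbounded f.

Definition C0 (f : E -> R[i]) := continuous f /\
  forall e : R, 0 < e ->
    exists2 K : set E, compact K & forall x, ~ K x -> normc (f x) < e.

Record feller_semigroup (S : R -> (E -> R[i]) -> E -> R[i]) : Prop := {
  feller_stable : forall t f, 0 <= t -> C0 f -> C0 (S t f) ;
  feller_linear : forall t c f g, 0 <= t -> C0 f -> C0 g ->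
    S t (fun x => c * f x + g x) = (fun x => c * S t f x + S t g x) ;
  feller_positive : forall t f, 0 <= t -> C0 f ->
    (forall x, 0 <= f x) -> forall x, 0 <= S t f x ;
  feller_contraction : forall t f, 0 <= t -> C0 f ->
    supnorm (S t f) <= supnorm f ;
  feller0 : forall f, C0 f -> S 0 f = f ;
  fellerD : forall t s f, 0 <= t -> 0 <= s -> C0 f ->
    S (t + s) f = S t (S s f) ;
  feller_continuous : forall f, C0 f ->
    (fun t => supnorm (fun x => S t f x - f x)) @ 0^'+ --> (0 : R) }.

(* [1] belongs to [C0] only when [E] is compact. *)
Definition conservative (S : R -> (E -> R[i]) -> E -> R[i]) :=
  forall t, 0 <= t -> S t (fun=> 1) = (fun=> 1).

Implicit Type p : R -> E -> {finite_measure set E -> \bar R}.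

Definition transition_kernel (S : R -> (E -> R[i]) -> E -> R[i]) p :=
  forall t x f, 0 <= t -> C0 f -> S t f x = cintegral (p t x) f.

Definition strong_feller p := forall t f, 0 < t -> bounded_measurable f ->
  Cb (fun x => cintegral (p t x) f).

(* Joint measurability of the density is part of its being a density function
   on [E * E]. *)
Definition kernel_density (m : {measure set E -> \bar R}) p
    (q : R -> E -> E -> R) := forall t, 0 < t -> [/\
  measurable_fun setT (fun xy : E * E => q t xy.1 xy.2),
  exists M, forall x y, `|q t x y| <= M,
  forall x y, q t x y = q t y x &
  forall x A, measurable A -> p t x A = (\int[m]_(y in A) (q t x y)%:E)%E].

Definition weak_cvg (u : nat -> cmeasure E R) (mu : cmeasure E R) :=
  forall f, Cb f ->
    (fun n => cmeasure_integral (u n) f) @ \oo --> cmeasure_integral mu f.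

(* Joint continuity with respect to weak convergence of sequences. Continuity
   for the product topology on the non-metrizable space of all complex measures
   would be too strong: a bilinear map continuous in that sense has finite-rank
   coordinates, which excludes even the convolution of measures on the circle.
   On probability measures over a compact metric space, where the weak topology
   is metrizable, both notions agree. *)
Definition weakly_continuous (op : cmeasure E R -> cmeasure E R -> cmeasure E R)
  := forall u v mu nu, weak_cvg u mu -> weak_cvg v nu ->
       weak_cvg (fun n => op (u n) (v n)) (op mu nu).

Record commutative_banach_algebra
    (op : cmeasure E R -> cmeasure E R -> cmeasure E R) (one : cmeasure E R)
    : Prop := {
  cba_linearl : forall nu, linear (op^~ nu) ;
  cba_linearr : forall mu, linear (op mu) ;
  cba_assoc : associative op ;
  cba_comm : commutative op ;
  cba_id : left_id one op ;
  cba_norm : forall mu nu, (tvnorm (op mu nu) <=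
    tvnorm mu * tvnorm nu)%E ;
  cba_complete : forall u : nat -> cmeasure E R,
    (forall e : R, 0 < e -> exists N, forall i j, (N <= i)%N -> (N <= j)%N ->
       (tvnorm (u i - u j)%R < e%:E)%E) ->
    exists mu : cmeasure E R, (fun n => tvnorm (u n - mu)) @ \oo --> 0%E }.

(* Feller-Levy trivializable convolutions for a semigroup with kernel [p]. *)
Record FLTC p (op : cmeasure E R -> cmeasure E R -> cmeasure E R) : Prop := {
  FLTC_strong_feller : strong_feller p ;
  FLTC_algebra : exists a, commutative_banach_algebra op (cmeasure_dirac a) ;
  FLTC_continuous : weakly_continuous op ;
  FLTC_probability : forall mu nu, cmeasure_probability mu ->
    cmeasure_probability nu -> cmeasure_probability (op mu nu) ;
  FLTC_trivializable : exists2 Theta : set (E -> R[i]),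
    forall h, Theta h -> bounded_measurable h /\ h <> (fun=> 0) &
    forall mu mu1 mu2, mu = op mu1 mu2 <->
      forall h, Theta h -> cmeasure_integral mu h =
        cmeasure_integral mu1 h * cmeasure_integral mu2 h ;
  FLTC_semigroup : exists gamma : R -> cmeasure E R, [/\
    forall t, 0 <= t -> cmeasure_probability (gamma t),
    forall t s, 0 <= t -> 0 <= s -> gamma (t + s) = op (gamma t) (gamma s) &
    forall t x, 0 <= t ->
      cmeasure_of (p t x) = op (gamma t) (cmeasure_dirac x)] }.

End feller.

(* Main.v *)
Require Import Defs.
From HB Require Import structures.
From mathcomp Require Import all_boot all_order all_algebra.
From mathcomp Require Import complex.
From mathcomp Require Import all_classical all_reals all_analysis.
From mathcomp Require Import measurable_realfun.
From mathcomp Require Import ring lra zify.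

Import Order.TTheory GRing.Theory Num.Theory.
Import numFieldNormedType.Exports.

Local Open Scope classical_set_scope.
Local Open Scope ring_scope.
Local Open Scope complex_scope.

(** Simplicity of the spectrum makes each [omega j] a unimodular multiple of a real
    continuous function [e j] ([real_eigenbasis]), so that the argument takes place
    over real orthonormal eigenfunctions with distinct eigenvalues. As the density is
    bounded, the semigroup maps the square-integrable functions into the bounded
    ones at positive times, hence the eigenfunction expansion of [f] becomes
    uniformly convergent once the semigroup is applied ([uniform_expansion]). Three
    consequences are used throughout: the semigroup is strong Feller, the series
    [\sum_j expR (- lambda j * t) * e j x ^+ 2] is bounded in [x]
    ([eigen_sum_bounded]), and finite combinations of eigenfunctions are dense in
    the continuous functions ([eigen_dense]), so that they determine complex
    measures ([cmeasure_eigen_eq]).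

    From the positivity condition to the convolution ([convolution_exists]). Write
    [phi j x = e j x / e j a]. A product on measures trivialized by the [phi j] is
    determined by [(mu * nu) (phi j) = mu (phi j) * nu (phi j)], and with uniqueness
    at hand all algebraic axioms reduce to identities between numbers. What has to be
    shown is existence, the norm inequality and weak continuity. The nonnegative
    series of the hypothesis are densities of probability measures with integrals
    [expR (- lambda j * t) * phi j x * phi j y]; as [t] tends to [0] they converge on
    all continuous functions, and the limit is represented by a measure, the product
    of the Dirac measures at [x] and [y]. This rests on the Riesz representation
    theorem ([riesz_representation]), proved by Daniell's method. Products of
    positive measures come by integration and products of complex measures by
    bilinearity. The product of Dirac measures being a probability measure, a product
    is bounded, as a functional on continuous functions, by the product of the
    bounds of the factors. This gives the norm inequality, because the total
    variation is the dual norm ([tvnorm_le_dual]), and weak continuity, because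
    weakly convergent sequences are bounded ([weak_cvg_bounded]).

    From the convolution to the positivity condition ([convolution_necessary]). The
    trivializing functions are eigenfunctions of the semigroup, and since they
    separate measures every [e j] occurs among them. The identity element of the
    algebra normalises them to [phi j], and [|phi j| <= 1] because products of
    probability measures are probability measures. The sum in the positivity
    condition is the integral of the nonnegative heat kernel at [xi] against the
    product of the Dirac measures at [x] and [y]. *)

Set Implicit Arguments.
Unset Strict Implicit.
Unset Printing Implicit Defensive.

(** * Bounded measurable real functions *)

Section bounded_measurable_real.
Context {d : measure_display} {T : measurableType d} {R : realType}.
Implicit Types (f g : T -> R) (mu : {finite_measure set T -> \bar R}).

Definition bmeas f := measurable_fun setT f /\ exists M, forall x, `|f x| <= M.

Lemma bmeas_cst (c : R) : bmeas (cst c).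
Proof. by split; [exact: measurable_cst|exists `|c|]. Qed.

Lemma bmeasD f g : bmeas f -> bmeas g -> bmeas (fun x => f x + g x).
Proof.
move=> [mf [M fM]] [mg [N gN]]; split; first exact: measurable_funD.
by exists (M + N) => x; rewrite (le_trans (ler_normD _ _))// lerD.
Qed.

Lemma bmeasM f g : bmeas f -> bmeas g -> bmeas (fun x => f x * g x).
Proof.
move=> [mf [M fM]] [mg [N gN]]; split; first exact: measurable_funM.
by exists (M * N) => x; rewrite normrM ler_pM.
Qed.

Lemma bmeasZ (c : R) f : bmeas f -> bmeas (fun x => c * f x).
Proof. by apply: bmeasM; exact: bmeas_cst. Qed.

Lemma bmeasN f : bmeas f -> bmeas (fun x => - f x).
Proof.
by move=> /(bmeasZ (-1)) h; under eq_fun do rewrite -mulN1r.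
Qed.

Lemma bmeasB f g : bmeas f -> bmeas g -> bmeas (fun x => f x - g x).
Proof. by move=> bf /bmeasN; exact: bmeasD. Qed.

Lemma bmeas_norm f : bmeas f -> bmeas (fun x => `|f x|).
Proof.
move=> [mf [M fM]]; split; first exact: measurableT_comp.
by exists M => x; rewrite normr_id.
Qed.

Lemma bmeas_sum (I : Type) (s : seq I) (F : I -> T -> R) :
  (forall i, bmeas (F i)) -> bmeas (fun x => \sum_(i <- s) F i x).
Proof.
move=> bF; elim: s => [|i s IH].
  by under eq_fun do rewrite big_nil; exact: bmeas_cst.
by under eq_fun do rewrite big_cons; exact: bmeasD.
Qed.

Lemma bmeas_indic (A : set T) : measurable A -> bmeas (\1_A : T -> R).
Proof.
move=> mA; split; first exact: measurable_indic.
by exists 1 => x; rewrite indicE; case: (_ \in _); rewrite ?normr1// normr0.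
Qed.

Lemma bmeas_max f g : bmeas f -> bmeas g -> bmeas (fun x => Num.max (f x) (g x)).
Proof.
move=> [mf [M fM]] [mg [N gN]]; split; first exact: measurable_maxr.
exists (Num.max M N) => x; rewrite maxEle.
by case: ifPn => _; rewrite le_max (fM, gN) ?orbT.
Qed.

Lemma bmeas_integrable mu f : bmeas f -> mu.-integrable setT (EFin \o f).
Proof.
move=> [mf [M fM]]; apply: measurable_bounded_integrable => //.
  exact: fin_num_fun_lty.
exists M; split; first exact: num_real.
by move=> x Mx y _ /=; rewrite (le_trans (fM y))// ltW.
Qed.

Lemma bmeas_intD mu f g : bmeas f -> bmeas g ->
  \int[mu]_x (f x + g x) = \int[mu]_x f x + \int[mu]_x g x.
Proof. by move=> bf bg; rewrite RintegralD//; exact: bmeas_integrable. Qed.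

Lemma bmeas_intB mu f g : bmeas f -> bmeas g ->
  \int[mu]_x (f x - g x) = \int[mu]_x f x - \int[mu]_x g x.
Proof. by move=> bf bg; rewrite RintegralB//; exact: bmeas_integrable. Qed.

Lemma bmeas_intZ mu (c : R) f : bmeas f ->
  \int[mu]_x (c * f x) = c * \int[mu]_x f x.
Proof. by move=> bf; rewrite RintegralZl//; exact: bmeas_integrable. Qed.

Lemma bmeas_intN mu f : bmeas f -> \int[mu]_x (- f x) = - \int[mu]_x f x.
Proof.
by move=> bf; under eq_Rintegral do rewrite -mulN1r; rewrite bmeas_intZ// mulN1r.
Qed.

Lemma bmeas_int_sum mu (I : Type) (s : seq I) (F : I -> T -> R) :
  (forall i, bmeas (F i)) ->
  \int[mu]_x (\sum_(i <- s) F i x) = \sum_(i <- s) \int[mu]_x F i x.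
Proof.
move=> bF; elim: s => [|i s IH].
  rewrite big_nil; under eq_Rintegral do rewrite big_nil.
  by rewrite Rintegral_cst// mul0r.
rewrite big_cons -IH -bmeas_intD//; last exact: bmeas_sum.
by apply: eq_Rintegral => x _; rewrite big_cons.
Qed.

Lemma bmeas_int_le mu f g : bmeas f -> bmeas g -> (forall x, f x <= g x) ->
  \int[mu]_x f x <= \int[mu]_x g x.
Proof. by move=> bf bg fg; apply: le_Rintegral => //; exact: bmeas_integrable. Qed.

Lemma bmeas_int_abs mu f (M : R) : measurable_fun setT f ->
  (forall x, `|f x| <= M) -> `|\int[mu]_x f x| <= M * fine (mu setT).
Proof.
move=> mf fM; have bf : bmeas f by split => //; exists M.
rewrite (le_trans (le_normr_Rintegral _ (bmeas_integrable _ bf)))//.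
by rewrite -Rintegral_cst//; apply: bmeas_int_le; [exact: bmeas_norm|exact: bmeas_cst|].
Qed.

Lemma Rint_indic mu (A : set T) : measurable A ->
  \int[mu]_x \1_A x = fine (mu A).
Proof. by move=> mA; rewrite /Rintegral integral_indic// setIT. Qed.

Lemma bounded_convergence mu (f_ : nat -> T -> R) f (M : R) :
  (forall n, measurable_fun setT (f_ n)) -> (forall n x, `|f_ n x| <= M) ->
  (forall x, f_ ^~ x @ \oo --> f x) ->
  bmeas f /\ (fun n => \int[mu]_x f_ n x) @ \oo --> \int[mu]_x f x.
Proof.
move=> mf_ f_M f_f.
have mf : measurable_fun setT f by apply: (measurable_fun_cvg mf_) => x _.
have fM x : `|f x| <= M.
  apply: (cvgr_to_le (cvg_norm (f_f x))); exact: nearW.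
have bf : bmeas f by split => //; exists M.
split => //.
have [] := @dominated_convergence _ _ _ mu setT measurableT
    (fun n => EFin \o f_ n) (EFin \o f) (EFin \o cst M).
- by move=> n; exact/measurable_EFinP.
- exact/measurable_EFinP.
- by apply: aeW => x _; apply: cvg_EFin; [exact: nearW|exact: f_f].
- exact/bmeas_integrable/bmeas_cst.
- by apply: aeW => x n _ /=; rewrite lee_fin.
move=> _ _ h; apply: fine_cvg; rewrite fineK//.
exact: (integrable_fin_num _ (bmeas_integrable mu bf)).
Qed.

End bounded_measurable_real.

(** * Continuous functions on a metric space *)

Section continuous_functions.
Context {d : measure_display} {R : realType} {E : borelMetricType d R}.
Implicit Types f g : E -> R.

Lemma contD f g : continuous f -> continuous g -> continuous (fun x => f x + g x).
Proof. by move=> cf cg x; apply: cvgD; [exact: cf|exact: cg]. Qed.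

Lemma contM f g : continuous f -> continuous g -> continuous (fun x => f x * g x).
Proof. by move=> cf cg x; apply: cvgM; [exact: cf|exact: cg]. Qed.

Lemma cont_cst (c : R) : continuous (fun _ : E => c).
Proof. by move=> x; exact: cvg_cst. Qed.

Lemma contZ (c : R) f : continuous f -> continuous (fun x => c * f x).
Proof. exact/contM/cont_cst. Qed.

Lemma contN f : continuous f -> continuous (fun x => - f x).
Proof. by move=> cf x; apply: cvgN; exact: cf. Qed.

Lemma contB f g : continuous f -> continuous g -> continuous (fun x => f x - g x).
Proof. by move=> cf /contN; exact: contD. Qed.

Lemma cont_norm f : continuous f -> continuous (fun x => `|f x|).
Proof. by move=> cf x; apply: cvg_norm; exact: cf. Qed.

Lemma cont_max f g : continuous f -> continuous g ->
  continuous (fun x => Num.max (f x) (g x)).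
Proof. by move=> cf cg x; apply: continuous_max; [exact: cf|exact: cg]. Qed.

Lemma cont_min f g : continuous f -> continuous g ->
  continuous (fun x => Num.min (f x) (g x)).
Proof. by move=> cf cg x; apply: continuous_min; [exact: cf|exact: cg]. Qed.

Lemma cont_sum (I : Type) (s : seq I) (F : I -> E -> R) :
  (forall i, continuous (F i)) -> continuous (fun x => \sum_(i <- s) F i x).
Proof.
move=> cF; elim: s => [|i s IH].
  by under eq_fun do rewrite big_nil; exact: cont_cst.
by under eq_fun do rewrite big_cons; exact: contD.
Qed.

Lemma continuous_measurable f : continuous f -> measurable_fun setT f.
Proof.
move=> cf; apply: (measurability _ (RGenOpens.measurableE R)).
move=> _ [_ [a [b ->] <-]]; rewrite setTI borel_measurableE.
apply: sub_sigma_algebra; move/continuousP : cf; apply; exact: interval_open.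
Qed.

Lemma open_borel (U : set E) : open U -> measurable U.
Proof. by move=> oU; rewrite borel_measurableE; exact: sub_sigma_algebra. Qed.

Section compact.
Hypothesis E_compact : compact [set: E].

Lemma continuous_max_attained f : continuous f -> exists c, forall x, f x <= f c.
Proof.
move=> cf; have [||c _ fc] := @compact_EVT_max _ _ f setT _ E_compact.
- by exists point.
- exact: continuous_subspaceT.
- by exists c => x; apply: fc; rewrite inE.
Qed.

Lemma continuous_bounded f : continuous f -> exists2 M, 0 <= M & forall x, `|f x| <= M.
Proof.
move=> cf; have [c fc] := continuous_max_attained (cont_norm cf).
by exists `|f c|.
Qed.

Lemma continuous_bmeas f : continuous f -> bmeas f.
Proof.
move=> cf; split; first exact: continuous_measurable.
by have [M _ fM] := continuous_bounded cf; exists M.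
Qed.

(** The step of Dini's theorem where compactness enters: the conditions below
    will be strict inequalities [r < g n x] for an increasing sequence [g]. *)
Lemma dini (U : nat -> set E) : (forall n, open (U n)) ->
  (forall n x, U n x -> U n.+1 x) -> (forall x, exists n, U n x) ->
  exists n, forall x, U n x.
Proof.
move=> oU ndU exU.
have ndU' n k x : U n x -> U (n + k)%N x.
  by elim: k => [|k IH]; rewrite ?addn0// addnS => /IH; exact: ndU.
have := E_compact; rewrite compact_cover => /(_ nat setT U).
case=> [n _ //|x _|D _ Dcov]; first by have [n Un] := exU x; exists n.
exists (\sum_(i <- finmap.enum_fset D) i)%N => x.
have [n /= nD Un] := Dcov x I; rewrite (big_rem n)//=; exact: ndU'.
Qed.

End compact.

(** The functions are the truncations at [1] of the multiples of the distance to
    the complement. *)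
Lemma open_exhaustion (U : set E) : open U -> exists h : nat -> E -> R, [/\
  forall n, continuous (h n), forall n x, 0 <= h n x <= 1,
  forall n x, h n x <= h n.+1 x, forall n x, ~ U x -> h n x = 0 &
  forall x, U x -> \forall n \near \oo, h n x = 1].
Proof.
move=> oU.
suff [g [cg g0 gU gnU]] : exists g : E -> R, [/\ continuous g,
    forall x, 0 <= g x, forall x, U x -> 0 < g x & forall x, ~ U x -> g x = 0].
  exists (fun n x => Num.min 1 (n%:R * g x)); split.
  - by move=> n; apply: cont_min; [exact: cont_cst|exact: contZ].
  - by move=> n x; rewrite le_min ler01 ge_min lexx mulr_ge0.
  - move=> n x; rewrite le_min ge_min lexx/= ge_min; apply/orP; right.
    by rewrite ler_wpM2r// ler_nat.
  - by move=> n x nUx; rewrite gnU// mulr0; apply/min_idPr.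
  - move=> x /gU gx; near=> n; apply/min_idPl.
    rewrite -ler_pdivrMr//.
    by near: n; exact: nbhs_infty_ger.
have [U1|nU1] := pselect (forall x, U x).
  by exists (cst 1); split => // x; exact: cvg_cst.
have [z nUz] : exists z, ~ U z by apply/existsNP.
pose D x := [set mdist x y | y in ~` U].
have D0 x : has_inf (D x).
  by split; [exists (mdist x z), z|exists 0 => _ [y _ <-]; exact: mdist_ge0].
have Dle x w : inf (D x) <= mdist x w + inf (D w).
  rewrite -lerBlDl; apply: lb_le_inf; first by have [] := D0 w.
  move=> _ [y nUy <-]; rewrite lerBlDl (le_trans _ (metric_triangle x w y))//.
  by apply: ge_inf; [have [] := D0 x|exists y].
exists (fun x => inf (D x)); split.
- move=> x; apply: (iffRL (cvgrPdist_lt _ _)) => e e0; near=> y.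
  have xy : mdist x y < e.
    suff : ball x e y by rewrite ballEmdist.
    by near: y; exact: nbhsx_ballx.
  rewrite ltr_norml ltrBlDr ltrBrDr (le_lt_trans (Dle x y))// ?ltrD2r// andbT.
  by rewrite addrC ltrBlDr (le_lt_trans (Dle y x))// addrC ltrD2l metric_sym.
- move=> x; apply: lb_le_inf; first by have [] := D0 x.
  by move=> _ [y _ <-]; exact: mdist_ge0.
- move=> x Ux; have /nbhs_ballP[e /= e0 xeU] : nbhs x U by exact: open_nbhs_nbhs.
  apply: (lt_le_trans e0); apply: lb_le_inf; first by have [] := D0 x.
  move=> _ [y nUy <-]; rewrite leNgt; apply/negP => xy; apply: nUy.
  by apply: xeU; rewrite ballEmdist.
- move=> x nUx; apply/eqP; rewrite eq_le; apply/andP; split.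
    by rewrite -(mdistxx x); apply: ge_inf; [have [] := D0 x|exists x].
  apply: lb_le_inf; first by have [] := D0 x.
  by move=> _ [y _ <-]; exact: mdist_ge0.
Unshelve. all: by end_near. Qed.

End continuous_functions.

(** * The Riesz representation theorem on a compact metric space *)

Section riesz.
Context {d : measure_display} {R : realType} {E : borelMetricType d R}.
Hypothesis E_compact : compact [set: E].
Variable L : (E -> R) -> R.
Hypothesis LD : forall f g : E -> R, continuous f -> continuous g ->
  L (fun x => f x + g x) = L f + L g.
Hypothesis LZ : forall (c : R) (f : E -> R), continuous f -> L (fun x => c * f x) = c * L f.
Hypothesis L_ge0 : forall f : E -> R, continuous f -> (forall x, 0 <= f x) -> 0 <= L f.
Implicit Types (f g : E -> R) (A : set E).

Let LB f g : continuous f -> continuous g ->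
  L (fun x => f x - g x) = L f - L g.
Proof.
move=> cf cg; rewrite -[- L g]mulN1r -LZ// -LD//; last exact: contZ.
by congr L; apply/funext => x; rewrite mulN1r.
Qed.

Let L_le f g : continuous f -> continuous g -> (forall x, f x <= g x) -> L f <= L g.
Proof.
move=> cf cg fg; rewrite -subr_ge0 -LB//; apply: L_ge0; first exact: contB.
by move=> x; rewrite subr_ge0.
Qed.

Let L1 := L (fun=> 1).
Let L_cst c : L (fun=> c) = c * L1.
Proof.
rewrite /L1 -LZ//; last exact: cont_cst.
by congr L; apply/funext => x; rewrite mulr1.
Qed.

(** Covers by one increasing sequence, instead of by a series of functions as
    in Daniell's construction, make countable subadditivity free of double
    series. *)
Definition riesz_cover A (c : R) := exists g : nat -> E -> R,
  [/\ forall n, continuous (g n), forall n x, 0 <= g n x,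
      forall n x, g n x <= g n.+1 x, forall n, L (g n) <= c &
      forall x, A x -> forall r, r < 1 -> exists n, r < g n x].

Definition riesz_outer A : \bar R := (inf [set c | riesz_cover A c])%:E.

Let cover_ge0 A c : riesz_cover A c -> 0 <= c.
Proof. by move=> [g [cg g0 _ gc _]]; apply: le_trans (gc 0%N); exact: L_ge0. Qed.

Let cover_fun A f : continuous f -> (forall x, 0 <= f x) ->
  (forall x, A x -> 1 <= f x) -> riesz_cover A (L f).
Proof.
move=> cf f0 Af; exists (fun=> f); split => // x /Af fx r r1; exists 0%N.
exact: lt_le_trans fx.
Qed.

Let cover_inf A : has_inf [set c | riesz_cover A c].
Proof.
split; last by exists 0 => c /cover_ge0.
by exists L1; apply: cover_fun => //; exact: cont_cst.
Qed.

Let outer_le A c : riesz_cover A c -> (riesz_outer A <= c%:E)%E.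
Proof. by move=> Ac; rewrite lee_fin; apply: ge_inf => //; case: (cover_inf A). Qed.

Let outer_lt A e : 0 < e -> exists2 c, riesz_cover A c & (c%:E < riesz_outer A + e%:E)%E.
Proof.
move=> e0; have [c Ac ce] := inf_adherent e0 (cover_inf A).
by exists c => //; rewrite -EFinD lte_fin.
Qed.

Let outer0 : riesz_outer set0 = 0%E.
Proof.
congr EFin; apply/eqP; rewrite eq_le; apply/andP; split.
  apply: ge_inf; first by case: (cover_inf set0).
  have <- : L (fun=> 0) = 0 by rewrite L_cst mul0r.
  by apply: cover_fun => //; exact: cont_cst.
by apply: lb_le_inf => [|c /cover_ge0//]; case: (cover_inf set0).
Qed.

Let outer_ge0 A : (0 <= riesz_outer A)%E.
Proof.
by rewrite lee_fin; apply: lb_le_inf => [|c /cover_ge0//]; case: (cover_inf A).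
Qed.

Let le_outer : {homo riesz_outer : A B / A `<=` B >-> (A <= B)%E}.
Proof.
move=> A B AB; rewrite lee_fin; apply: lb_le_inf; first by case: (cover_inf B).
move=> c [g [? ? ? ? gB]]; apply: ge_inf; first by case: (cover_inf A).
by exists g; split => // x /AB; exact: gB.
Qed.

Let outer_sigma : sigma_subadditive riesz_outer.
Proof.
move=> F; apply/lee_addgt0Pr => e e0.
have eV n : 0 < e / (2 ^ n.+1)%:R by rewrite divr_gt0// ltr0n expn_gt0.
apply: le_trans (epsilon_trick xpredT (fun n => outer_ge0 (F n)) (ltW e0)).
have ser0 n : (0 <= riesz_outer (F n) + (e / (2 ^ n.+1)%:R)%:E)%E.
  by rewrite adde_ge0// lee_fin ltW.
set S := (X in (_ <= X)%E).
have S0 : (0 <= S)%E by apply: nneseries_ge0.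
have [SE|Sfin] := eqVneq S +oo%E; first by rewrite SE leey.
have {}Sfin : S \is a fin_num by rewrite ge0_fin_numE// lt_neqAle Sfin leey.
have /choice[c cP] n : exists c, riesz_cover (F n) c /\
    (c%:E < riesz_outer (F n) + (e / (2 ^ n.+1)%:R)%:E)%E.
  by have [c] := outer_lt (F n) (eV n); exists c.
have /choice[g gP] n : exists g : nat -> E -> R,
  [/\ forall k, continuous (g k), forall k x, 0 <= g k x,
      forall k x, g k x <= g k.+1 x, forall k, L (g k) <= c n &
      forall x, F n x -> forall r, r < 1 -> exists k, r < g k x].
  by have [[g ?] _] := cP n; exists g.
rewrite -(fineK Sfin); apply: outer_le.
exists (fun n x => \sum_(k < n) g k n x); split.
- by move=> n; apply: cont_sum => k; have [] := gP k.
- by move=> n x; apply: sumr_ge0 => k _; have [] := gP k.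
- move=> n x; rewrite big_ord_recr/= -[leLHS]addr0 lerD//.
    by apply: ler_sum => k _; have [] := gP k.
  by have [] := gP n.
- move=> n; rewrite -lee_fin fineK//.
  have -> : forall j, L (fun x => \sum_(k < j) g k n x) = \sum_(k < j) L (g k n).
    elim=> [|k IH].
      by under eq_fun do rewrite big_ord0; rewrite L_cst mul0r big_ord0.
    under eq_fun do rewrite big_ord_recr/=.
    rewrite LD; [by rewrite big_ord_recr/= IH| |by have [] := gP k].
    by apply: cont_sum => i; have [] := gP i.
  apply: (@le_trans _ _ (\sum_(0 <= k < n) (c k)%:E)%E).
    rewrite big_mkord sumEFin lee_fin; apply: ler_sum => k _.
    by have [] := gP k.
  apply: le_trans (nneseries_lim_ge n (fun k _ _ => ser0 k)).
  by apply: lee_sum => k _; apply: ltW; have [] := cP k.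
- move=> x [n _ Fnx] r r1; have [_ g0 gnd _ /(_ _ Fnx _ r1)[k rk]] := gP n.
  have gnd' j : g n k x <= g n (k + j)%N x.
    by elim: j => [|j IH]; rewrite ?addn0// addnS (le_trans IH).
  exists (k + n.+1)%N; apply: (lt_le_trans rk).
  have nk : (n < k + n.+1)%N by rewrite addnS ltnS leq_addl.
  rewrite (bigD1 (Ordinal nk))//= -[leLHS]addr0 lerD// sumr_ge0// => i _.
  by have [] := gP i.
Qed.

HB.instance Definition _ := isOuterMeasure.Build R E riesz_outer
  outer0 outer_ge0 le_outer outer_sigma.

(** For a cover [g] of [X] and functions [h] increasing to the indicator of [U],
    the products [g n * h n] cover the part of [X] inside [U], and for each [k]
    the products [g n * (1 - h k)] cover the part outside. *)
Let open_caratheodory (U : set E) : open U -> riesz_outer.-caratheodory U.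
Proof.
move=> oU; apply: le_caratheodory_measurable => X.
have [h [ch h01 hnd hU0 hU1]] := open_exhaustion oU.
have hle k n x : h k x <= h (n + k)%N x.
  by elim: n => [|n IH]; rewrite ?add0n// addSn (le_trans IH).
apply/lee_addgt0Pr => e e0.
have e20 : 0 < e / 2 by rewrite divr_gt0.
have [c Xc ce] := outer_lt X e20.
have [g [cg g0 gnd gc gX]] := Xc.
have gle k n x : g k x <= g (n + k)%N x.
  by elim: n => [|n IH]; rewrite ?add0n// addSn (le_trans IH).
pose gh n x := g n x * h n x.
have cgh n : continuous (gh n) by exact: contM.
pose c1 := sup (range (fun n => L (gh n))).
have hs1 : has_sup (range (fun n => L (gh n))).
  split; first by exists (L (gh 0%N)), 0%N.
  exists c => _ [n _ <-]; apply: le_trans (gc n); apply: L_le => // x.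
  by rewrite ler_piMr//; have /andP[] := h01 n x.
have XU : riesz_cover (X `&` U) c1.
  exists gh; split => //.
  - by move=> n x; rewrite mulr_ge0//; have /andP[] := h01 n x.
  - move=> n x; apply: ler_pM => //; by have /andP[] := h01 n x.
  - by move=> n; apply: ub_le_sup; [case: hs1|exists n].
  - move=> x [Xx Ux] r r1; have [n rn] := gX x Xx r r1.
    have [k _ hk] := hU1 x Ux; exists (n + k)%N.
    rewrite /gh hk/=; last exact: leq_addl.
    by rewrite mulr1 addnC; exact: lt_le_trans (gle n k x).
have [_ [k _ <-] ck] := sup_adherent e20 hs1.
have XnU : riesz_cover (X `&` ~` U) (c - c1 + e / 2).
  exists (fun n x => g (n + k)%N x * (1 - h k x)).
  have ck1 : continuous (fun x => 1 - h k x) by apply: contB => //; exact: cont_cst.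
  have h1 x : 0 <= 1 - h k x by rewrite subr_ge0; have /andP[] := h01 k x.
  split.
  - by move=> n; exact: contM.
  - by move=> n x; rewrite mulr_ge0.
  - by move=> n x; rewrite ler_wpM2r// addSn.
  - move=> n; under eq_fun do rewrite mulrBr mulr1.
    rewrite LB//; last exact: contM.
    rewrite -addrA; apply: lerD => //; rewrite lerNl opprD opprK -/c1.
    apply: (le_trans (ltW ck)); apply: L_le => //; first exact: contM.
    by move=> x; rewrite ler_wpM2r//; have /andP[] := h01 k x.
  - move=> x [Xx nUx] r r1; have [n rn] := gX x Xx r r1.
    by exists n; rewrite hU0// subr0 mulr1 addnC (lt_le_trans rn).
apply: (le_trans (leeD (outer_le XU) (outer_le XnU))).
rewrite -EFinD addrA [c1 + _]addrC subrK [e in leRHS]splitr EFinD.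
by rewrite (EFinD (e / 2)) addeA; apply: leeD => //; exact: ltW.
Qed.

Let borel_caratheodory A : measurable A -> riesz_outer.-caratheodory A.
Proof.
rewrite borel_measurableE; move: A; apply: smallest_sub; last first.
  exact: open_caratheodory.
split.
- exact: caratheodory_measurable_set0.
- by move=> A mA; rewrite setTD; exact: caratheodory_measurable_setC.
- by move=> F mF; exact: caratheodory_measurable_bigcup.
Qed.

Let riesz_measure A : \bar R := riesz_outer A.

Let riesz_sigma_additive : semi_sigma_additive riesz_measure.
Proof.
move=> F mF tF mUF; apply: caratheodory_measure_sigma_additive => //.
- by move=> n; exact: borel_caratheodory.
- exact: borel_caratheodory.
Qed.

HB.instance Definition _ := isMeasure.Build _ E R riesz_measure
  outer0 outer_ge0 riesz_sigma_additive.

Let riesz_fin : fin_num_fun riesz_measure. Proof. by []. Qed.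

HB.instance Definition _ := @Measure_isFinite.Build _ E R riesz_measure riesz_fin.

Let rho : {finite_measure set E -> \bar R} := riesz_measure.

Let rho_le A f : continuous f -> (forall x, 0 <= f x) ->
  (forall x, A x -> 1 <= f x) -> fine (rho A) <= L f.
Proof. by move=> cf f0 Af; rewrite -lee_fin; apply: outer_le; exact: cover_fun. Qed.

Let rhoT : fine (rho setT) = L1.
Proof.
apply/eqP; rewrite eq_le; apply/andP; split.
  by apply: rho_le => //; exact: cont_cst.
apply: lb_le_inf; first by case: (cover_inf setT).
move=> c [g [cg g0 gnd gc gT]].
apply/ler_addgt0Pr => e e0.
have L10 : 0 <= L1 by apply: L_ge0 => //; exact: cont_cst.
pose r := 1 - e / (1 + L1).
have r1 : r < 1 by rewrite ltrBlDr ltrDl divr_gt0// ltr_wpDr.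
have [||x|n rn] := dini E_compact (U := fun n => [set x | r < g n x]).
- move=> n; apply: (@open_comp _ _ (g n) [set y | r < y]) => [x _|]; first exact: cg.
  exact: open_gt.
- by move=> n x /= /lt_le_trans; apply.
- by have [n rn] := gT x I r r1; exists n.
rewrite -lerBlDr (le_trans _ (gc n))//.
apply: (@le_trans _ _ (L (fun=> r))); last first.
  by apply: L_le => //; [exact: cont_cst|move=> x; exact/ltW/rn].
rewrite L_cst mulrBl mul1r lerD2l lerN2 -mulrA ler_piMr ?ltW//.
by rewrite mulrC ltr_pdivrMr ?mul1r ?ltrDr// ltr_wpDr.
Qed.

(** Induction on the number of layers of height [del]: the lowest layer
    [Num.min f del] dominates [del] times the indicator of [f > del]. *)
Let layers (del : R) n f : 0 < del -> continuous f -> (forall x, 0 <= f x) ->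
  (forall x, f x <= del *+ n) -> \int[rho]_x Num.max (f x - del) 0 <= L f.
Proof.
move=> del0; elim: n f => [|n IH] f cf f0 fn.
  rewrite (_ : (fun x => _) = fun=> 0) ?Rintegral_cst// ?mul0r; first exact: L_ge0.
  apply/funext => x; apply/max_idPr; rewrite subr_le0.
  by rewrite (le_trans (fn x))// mulr0n ltW.
pose g x := Num.max (f x - del) 0.
pose f1 x := Num.min (f x) del.
have cg : continuous g.
  by apply: cont_max; [apply: contB => //; exact: cont_cst|exact: cont_cst].
have cf1 : continuous f1 by apply: cont_min => //; exact: cont_cst.
have g0 x : 0 <= g x by rewrite le_max lexx orbT.
have f10 x : 0 <= f1 x by rewrite le_min f0 ltW.
have gn x : g x <= del *+ n.
  by rewrite ge_max lerBlDr -mulrSr fn mulrn_wge0// ltW.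
have fE : f = fun x => f1 x + g x.
  apply/funext => x; rewrite /f1 /g /Num.min /Num.max subr_lt0.
  by case: ltP => _; rewrite ?addr0// addrC subrK.
rewrite {2}fE LD//.
pose g1 x := Num.max (g x - del) 0.
have cg1 : continuous g1.
  by apply: cont_max; [apply: contB => //; exact: cont_cst|exact: cont_cst].
pose A := [set x | del < f x].
have mA : measurable A.
  apply: open_borel; apply: (@open_comp _ _ f [set y | del < y]) => [x _|].
    exact: cf.
  exact: open_gt.
apply: (@le_trans _ _ (\int[rho]_x (del * \1_A x + g1 x))).
  apply: bmeas_int_le.
  - exact: continuous_bmeas.
  - by apply: bmeasD; [exact/bmeasZ/bmeas_indic|exact: continuous_bmeas].
  - move=> x; rewrite -/(g x) /g1 indicE; have [Ax|nAx] := pselect (A x).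
      by rewrite mem_set// mulr1 -lerBlDl le_max lexx.
    rewrite memNset// mulr0 add0r le_max; apply/orP; right.
    by rewrite /g (max_idPr _)// subr_le0 leNgt; apply/negP.
rewrite bmeas_intD; [|exact/bmeasZ/bmeas_indic|exact: continuous_bmeas].
rewrite bmeas_intZ; last exact: bmeas_indic.
rewrite Rint_indic// lerD//; last exact: IH.
rewrite -ler_pdivlMl// -LZ//; apply: rho_le.
- exact: contZ.
- by move=> x; rewrite mulr_ge0// invr_ge0 ltW.
- by move=> x Ax; rewrite /f1 min_r ?mulVf ?gt_eqF//; exact: ltW.
Qed.

Let int_le_L f : continuous f -> (forall x, 0 <= f x) -> \int[rho]_x f x <= L f.
Proof.
move=> cf f0; apply/ler_addgt0Pr => e e0.
have L10 : 0 <= L1 by apply: L_ge0 => //; exact: cont_cst.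
pose del := e / (1 + L1).
have del0 : 0 < del by rewrite divr_gt0// ltr_wpDr.
have [M M0 fM] := continuous_bounded E_compact cf.
have cg : continuous (fun x => Num.max (f x - del) 0).
  by apply: cont_max; [apply: contB => //; exact: cont_cst|exact: cont_cst].
apply: (@le_trans _ _ (\int[rho]_x (Num.max (f x - del) 0 + del))).
  apply: bmeas_int_le.
  - exact: continuous_bmeas.
  - apply: bmeasD; first exact: continuous_bmeas.
    exact: bmeas_cst.
  - by move=> x; rewrite -lerBlDr le_max lexx.
rewrite bmeas_intD; [|exact: continuous_bmeas|exact: bmeas_cst].
rewrite Rintegral_cst// rhoT lerD//.
  apply: (@layers _ (Num.truncn (M / del)).+1) => // x.
  rewrite -mulr_natl (le_trans (le_trans (ler_norm _) (fM x)))//.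
  by rewrite -ler_pdivrMr// ltW// truncnS_gt.
rewrite -mulrA ler_piMr ?ltW//.
by rewrite mulrC ltr_pdivrMr ?mul1r ?ltrDr// ltr_wpDr.
Qed.

(** The measure of an open set exceeds no [L f] with [f >= 1] on it, which gives
    one inequality for nonnegative [f]; applying it to [f + M] and [M - f] gives
    equality, since the total mass is [L 1]. *)
Theorem riesz_representation : exists rho : {finite_measure set E -> \bar R},
  forall f, continuous f -> \int[rho]_x f x = L f.
Proof.
exists rho => f cf; have [M M0 fM] := continuous_bounded E_compact cf.
have bf := continuous_bmeas E_compact cf.
apply/eqP; rewrite eq_le; apply/andP; split.
- have /int_le_L : continuous (fun x => f x + M) by apply: contD => //; exact: cont_cst.
  rewrite bmeas_intD//; last exact: bmeas_cst.
  rewrite LD//; last exact: cont_cst.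
  rewrite Rintegral_cst// L_cst rhoT lerD2r; apply => x.
  by rewrite -lerBlDr sub0r; have := fM x; rewrite ler_norml => /andP[].
- have /int_le_L : continuous (fun x => M - f x) by apply: contB => //; exact: cont_cst.
  rewrite bmeas_intB//; last exact: bmeas_cst.
  rewrite LB//; last exact: cont_cst.
  rewrite Rintegral_cst// L_cst rhoT lerD2l lerN2; apply => x.
  by rewrite subr_ge0; have := fM x; rewrite ler_norml => /andP[].
Qed.

End riesz.

(** * Complex numbers and their modulus *)

Local Notation Re := (@complex.Re _).
Local Notation Im := (@complex.Im _).

Section modulus.
Context {R : realType}.
Implicit Types (z w : R[i]) (x : R).

Lemma cReD z w : Re (z + w) = Re z + Re w. Proof. by case: z; case: w. Qed.
Lemma cImD z w : Im (z + w) = Im z + Im w. Proof. by case: z; case: w. Qed.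
Lemma cReM z w : Re (z * w) = Re z * Re w - Im z * Im w.
Proof. by case: z; case: w. Qed.
Lemma cImM z w : Im (z * w) = Re z * Im w + Im z * Re w.
Proof. by case: z; case: w. Qed.
Lemma cReN z : Re (- z) = - Re z. Proof. by case: z. Qed.
Lemma cImN z : Im (- z) = - Im z. Proof. by case: z. Qed.

Lemma eqc z w : Re z = Re w -> Im z = Im w -> z = w.
Proof. by case: z => a b; case: w => a' b' /= -> ->. Qed.

Lemma normcM z w : normc (z * w) = normc z * normc w.
Proof. exact: ComplexField.Normc.normcM. Qed.

Lemma normcD z w : normc (z + w) <= normc z + normc w.
Proof. by rewrite -lecR rmorphD/=; exact: (@ler_normD _ R[i]). Qed.

Lemma normc_ge0 z : 0 <= normc z.
Proof. by case: z => a b; exact: sqrtr_ge0. Qed.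

Lemma normcN z : normc (- z) = normc z.
Proof. by case: z => a b /=; rewrite !sqrrN. Qed.

Lemma normcB z w : normc (z - w) = normc (w - z).
Proof. by rewrite -normcN opprB. Qed.

Lemma normcR x : normc x%:C = `|x|.
Proof. by rewrite /= expr0n/= addr0 sqrtr_sqr. Qed.

Lemma normc0 : normc (0 : R[i]) = 0.
Proof. by have := normcR 0; rewrite normr0. Qed.

Lemma normc_eq0 z : normc z = 0 -> z = 0.
Proof. exact: ComplexField.Normc.eq0_normc. Qed.

Lemma normcV z : normc z^-1 = (normc z)^-1.
Proof. exact: ComplexField.Normc.normcV. Qed.

Lemma normc_le_ReIm z : normc z <= `|Re z| + `|Im z|.
Proof.
case: z => a b /=; rewrite -[leRHS]ger0_norm ?addr_ge0// -sqrtr_sqr ler_wsqrtr//.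
rewrite sqrrD !real_normK ?num_real// -addrA lerD2l lerDr.
by rewrite mulrn_wge0// mulr_ge0.
Qed.

Lemma normc_sum (I : Type) (s : seq I) (F : I -> R[i]) :
  normc (\sum_(i <- s) F i) <= \sum_(i <- s) normc (F i).
Proof.
elim: s => [|i s IH]; first by rewrite !big_nil normc0.
by rewrite !big_cons (le_trans (normcD _ _))// lerD2l.
Qed.

Lemma normc_phase z : exists w, normc w <= 1 /\ w * z = (normc z)%:C.
Proof.
have [->|z0] := eqVneq z 0; first by exists 0; rewrite !normc0 mul0r ler01.
have nz0 : normc z != 0 by apply: contra z0 => /eqP/normc_eq0 ->.
exists ((normc z)%:C * z^-1).
rewrite normcM normcR normcV ger0_norm ?normc_ge0// divff// lexx; split => //.
by rewrite mulrVK// unitfE.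
Qed.

Lemma cvg_normc (u : nat -> R[i]) z :
  u @ \oo --> z <-> forall e : R, 0 < e -> \forall n \near \oo, normc (z - u n) < e.
Proof.
split=> [uz e e0|h].
  have e0' : 0 < e%:C by rewrite ltcR.
  by move/cvgrPdist_lt : uz => /(_ _ e0'); apply: filterS => n; rewrite normr_normc ltcR.
apply/cvgrPdist_lt => e e0.
have eE : e = (Re e)%:C by case: e e0 => a b /andP[/eqP/= -> _].
rewrite eE ltcR in e0; have := h _ e0; apply: filterS => n.
by rewrite normr_normc eE ltcR.
Qed.

Lemma cvg_complex (u : nat -> R) x :
  u @ \oo --> x -> (fun n => (u n)%:C) @ \oo --> x%:C.
Proof. by move=> ux; apply: continuous_cvg => //; exact: continuous_real_complex. Qed.

Lemma cvg_Re (u : nat -> R[i]) z : u @ \oo --> z -> Re \o u @ \oo --> Re z.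
Proof. by move=> uz; apply: continuous_cvg => //; exact: continuous_Re. Qed.

End modulus.

(** * Bounded measurable complex functions *)

Section bounded_measurable_complex.
Context {d : measure_display} {T : measurableType d} {R : realType}.
Implicit Types (f g : T -> R[i]).
Local Notation bm := (@bounded_measurable _ T R).

Lemma bm_bmeas f : bm f <-> bmeas (Re \o f) /\ bmeas (Im \o f).
Proof.
split=> [[[mr mi] [M fM]]|[[mr [M rM]] [mi [N iN]]]].
  split; split => //; exists M => x.
    exact: le_trans (ler_Re_normc _) (fM x).
  exact: le_trans (ler_Im_normc _) (fM x).
split => //; exists (M + N) => x.
by rewrite (le_trans (normc_le_ReIm _))// lerD// ?rM ?iN.
Qed.

Lemma bm_real (f : T -> R) : bmeas f -> bm (fun x => (f x)%:C).
Proof. by move=> bf; apply/bm_bmeas; split => //; exact: bmeas_cst. Qed.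

Lemma bm_cst (c : R[i]) : bm (fun=> c).
Proof. by apply/bm_bmeas; split; exact: bmeas_cst. Qed.

Lemma bmD f g : bm f -> bm g -> bm (fun x => f x + g x).
Proof.
move=> /bm_bmeas[rf jf] /bm_bmeas[rg jg]; apply/bm_bmeas; split.
  by under [_ \o _]eq_fun do rewrite /= cReD; exact: bmeasD.
by under [_ \o _]eq_fun do rewrite /= cImD; exact: bmeasD.
Qed.

Lemma bmM f g : bm f -> bm g -> bm (fun x => f x * g x).
Proof.
move=> /bm_bmeas[rf jf] /bm_bmeas[rg jg]; apply/bm_bmeas; split.
  by under [_ \o _]eq_fun do rewrite /= cReM; apply: bmeasB; exact: bmeasM.
by under [_ \o _]eq_fun do rewrite /= cImM; apply: bmeasD; exact: bmeasM.
Qed.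

Lemma bmZ (c : R[i]) f : bm f -> bm (fun x => c * f x).
Proof. exact/bmM/bm_cst. Qed.

Lemma bmB f g : bm f -> bm g -> bm (fun x => f x - g x).
Proof.
move=> bf bg; under eq_fun do rewrite -mulN1r.
by apply: bmD => //; exact: bmZ.
Qed.

Lemma bm_sum (I : Type) (s : seq I) (F : I -> T -> R[i]) :
  (forall i, bm (F i)) -> bm (fun x => \sum_(i <- s) F i x).
Proof.
move=> bF; elim: s => [|i s IH].
  by under eq_fun do rewrite big_nil; exact: bm_cst.
by under eq_fun do rewrite big_cons; exact: bmD.
Qed.

Lemma bm_indic (A : set T) : measurable A -> bm (fun x => (\1_A x)%:C).
Proof. by move=> mA; apply: bm_real; exact: bmeas_indic. Qed.

(** Values are sampled from [f] itself, so that the step function is bounded by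
    any bound of [f]. *)
Lemma simple_approximation f (e : R) : bm f -> 0 < e ->
  exists n (F : 'I_n -> set T) (c : 'I_n -> T),
  [/\ forall i, measurable (F i), trivIset setT F, \bigcup_i F i = setT &
      forall x, normc (f x - \sum_(i < n) f (c i) * (\1_(F i) x)%:C) <= e].
Proof.
move=> /bm_bmeas[[mr [M rM]] [mi [N iN]]] e0.
pose K := Num.max M N; pose del := e / 2.
have del0 : 0 < del by rewrite divr_gt0.
pose level (g : T -> R) x := Num.truncn ((g x + K) / del).
pose m := (Num.truncn ((K + K) / del)).+1.
have levelP (g : T -> R) x : (forall y, `|g y| <= K) ->
    ((level g x)%:R * del <= g x + K < (level g x).+1%:R * del) /\ (level g x < m)%N.
  move=> gK; have /andP[lK uK] : - K <= g x <= K by rewrite -ler_norml.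
  have gK0 : 0 <= (g x + K) / del.
    by rewrite divr_ge0 ?(ltW del0)// -lerBlDr sub0r.
  split; first by rewrite -ler_pdivlMr// -ltr_pdivrMr// truncn_itv.
  by rewrite ltnS le_truncn// ler_pM2r ?invr_gt0// lerD2r.
have rK y : `|(Re \o f) y| <= K by rewrite (le_trans (rM y))// le_max lexx.
have iK y : `|(Im \o f) y| <= K by rewrite (le_trans (iN y))// le_max lexx orbT.
have mlevel (g : T -> R) k : measurable_fun setT g -> (forall y, `|g y| <= K) ->
    measurable [set x | level g x = k].
  move=> mg gK; rewrite (_ : [set x | _] =
      [set: T] `&` g @^-1` [set` `[k%:R * del - K, k.+1%:R * del - K[ ]).
    exact: mg.
  apply/seteqP; split => x /=.
    move=> <-; rewrite in_itv/= lerBlDr ltrBrDr.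
    by have [] := levelP g x gK.
  move=> [_]; rewrite in_itv/= lerBlDr ltrBrDr -ler_pdivlMr// -ltr_pdivrMr// => h.
  exact: truncn_def.
pose cell x : 'I_m * 'I_m := (Ordinal (levelP _ x rK).2, Ordinal (levelP _ x iK).2).
pose F (i : 'I_#|{: 'I_m * 'I_m}|) := [set x | cell x = enum_val i].
have /choice[c cP] (i : 'I_#|{: 'I_m * 'I_m}|) : exists c, forall x, F i x -> F i c.
  by have [[x Fx]|nF] := pselect (exists x, F i x); [exists x|exists point => x Fx];
    last by case: nF; exists x.
exists _, F, c; split.
- move=> i; rewrite (_ : F i = [set x | level (Re \o f) x = (enum_val i).1] `&`
      [set x | level (Im \o f) x = (enum_val i).2]).
    by apply: measurableI; exact: mlevel.
  rewrite /F; case: (enum_val i) => k l; apply/seteqP; split => x.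
    by rewrite /cell => -[<- <-].
  move=> [/= kE lE]; rewrite /cell; congr pair; exact: val_inj.
- by move=> i j _ _ [x [/= xi xj]]; apply: enum_val_inj; rewrite -xi.
- apply/seteqP; split => // x _; exists (enum_rank (cell x)) => //.
  by rewrite /F/= enum_rankK.
- move=> x; set i := enum_rank (cell x).
  have Fi : F i x by rewrite /F/= enum_rankK.
  rewrite (bigD1 i)//= indicE mem_set// mulr1 big1 ?addr0; last first.
    move=> j ji; rewrite indicE memNset ?mulr0// => Fj.
    by move/eqP : ji; apply; apply: enum_val_inj; rewrite -Fj -Fi.
  have Fc := cP i x Fi.
  have cellE : cell x = cell (c i) by rewrite Fi Fc.
  have near (g : T -> R) : (forall y, `|g y| <= K) -> level g x = level g (c i) ->
      `|g x - g (c i)| <= del.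
    move=> gK lE; have [/andP[x1 x2] _] := levelP g x gK.
    have [] := levelP g (c i) gK; rewrite -lE => /andP[y1 y2] _.
    have dE : (level g x).+1%:R * del = (level g x)%:R * del + del.
      by rewrite -natr1 mulrDl mul1r.
    rewrite dE in x2 y2; rewrite ler_norml; apply/andP; split.
      rewrite lerBrDl; lra.
    rewrite lerBlDl; lra.
  rewrite (le_trans (normc_le_ReIm _))// cReD cReN cImD cImN [e in leRHS]splitr.
  by case: cellE => lr li; rewrite lerD// (near (Re \o f), near (Im \o f)).
Qed.

(** Integrals against measures, signed measures and densities are compared by
    viewing each of them as a functional of this kind: two of them agree as soon
    as they agree on indicator functions, by uniform approximation. *)
Record bounded_functional (I : (T -> R[i]) -> R[i]) : Prop := {
  bfunD : forall f g, bm f -> bm g -> I (fun x => f x + g x) = I f + I g ;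
  bfunZ : forall (c : R[i]) f, bm f -> I (fun x => c * f x) = c * I f ;
  bfun_bound : exists2 C, 0 <= C & forall f M, bm f -> (forall x, normc (f x) <= M) ->
    normc (I f) <= C * M }.

Lemma bfunB I : bounded_functional I ->
  forall f g, bm f -> bm g -> I (fun x => f x - g x) = I f - I g.
Proof.
move=> bI f g bf bg; under eq_fun do rewrite -mulN1r.
by rewrite (bfunD bI)//; [rewrite (bfunZ bI)// mulN1r|exact: bmZ].
Qed.

Lemma bfun_sum I : bounded_functional I ->
  forall (J : Type) (s : seq J) (F : J -> T -> R[i]), (forall i, bm (F i)) ->
  I (fun x => \sum_(i <- s) F i x) = \sum_(i <- s) I (F i).
Proof.
move=> bI J s F bF; elim: s => [|i s IH].
  rewrite big_nil; under eq_fun do rewrite big_nil -(mul0r 0).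
  by rewrite (bfunZ bI) ?mul0r//; exact: bm_cst.
under eq_fun do rewrite big_cons.
by rewrite (bfunD bI)// ?IH ?big_cons//; exact: bm_sum.
Qed.

Lemma bfun_ext I1 I2 : bounded_functional I1 -> bounded_functional I2 ->
  (forall A, measurable A -> I1 (fun x => (\1_A x)%:C) = I2 (fun x => (\1_A x)%:C)) ->
  forall f, bm f -> I1 f = I2 f.
Proof.
move=> b1 b2 I12 f bf; apply/eqP; rewrite -subr_eq0; apply/eqP/normc_eq0/eqP.
have [C1 C10 h1] := bfun_bound b1; have [C2 C20 h2] := bfun_bound b2.
rewrite eq_le normc_ge0 andbT; apply/ler_addgt0Pl => e e0; rewrite addr0.
have C12 : 0 < 1 + C1 + C2 by rewrite ltr_wpDr// ltr_wpDr.
have del0 : 0 < e / (1 + C1 + C2) by rewrite divr_gt0.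
have [n [F [c [mF tF FT fF]]]] := simple_approximation bf del0.
set s := fun x => \sum_(i < n) f (c i) * (\1_(F i) x)%:C in fF.
have bFi i : bm (fun x => f (c i) * (\1_(F i) x)%:C) by apply: bmZ; exact: bm_indic.
have bs : bm s by exact: bm_sum.
have sE : I1 s = I2 s.
  rewrite /s (bfun_sum b1)// (bfun_sum b2)//; apply: eq_bigr => i _.
  rewrite (bfunZ b1) ?(bfunZ b2) ?I12//; exact: bm_indic.
have -> : I1 f - I2 f = I1 (fun x => f x - s x) - I2 (fun x => f x - s x).
  by rewrite (bfunB b1)// (bfunB b2)// sE opprB addrA subrK.
rewrite (le_trans (normcD _ _))// normcN.
apply: (le_trans (lerD (h1 _ _ (bmB bf bs) fF) (h2 _ _ (bmB bf bs) fF))).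
rewrite -mulrDl mulrCA ler_piMr ?ltW// ltr_pdivrMr// mul1r.
by rewrite -addrA ltrDr.
Qed.

End bounded_measurable_complex.

(** * Integration against complex measures *)

Section complex_measure_integral.
Context {d : measure_display} {T : measurableType d} {R : realType}.
Implicit Types (mu nu : cmeasure T R) (f g : T -> R[i]).
Implicit Types (rho : {finite_measure set T -> \bar R}).
Local Notation bm := (@bounded_measurable _ T R).

Lemma bfun_cintegral rho : bounded_functional (cintegral rho).
Proof.
split.
- move=> f g /bm_bmeas[rf jf] /bm_bmeas[rg jg]; apply: eqc => /=.
    by rewrite -bmeas_intD//; apply: eq_Rintegral => x _; exact: cReD.
  by rewrite -bmeas_intD//; apply: eq_Rintegral => x _; exact: cImD.
- move=> c f /bm_bmeas[rf jf]; apply: eqc; rewrite ?cReM ?cImM/=.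
    rewrite -!bmeas_intZ// -bmeas_intB; [|exact: bmeasZ|exact: bmeasZ].
    by apply: eq_Rintegral => x _; exact: cReM.
  rewrite -!bmeas_intZ// -bmeas_intD; [|exact: bmeasZ|exact: bmeasZ].
  by apply: eq_Rintegral => x _; exact: cImM.
- have r0 : 0 <= fine (rho setT) by exact: fine_ge0.
  exists (fine (rho setT) *+ 2); first by rewrite mulrn_wge0.
  move=> f M /bm_bmeas[[rf _] [jf _]] fM.
  rewrite (le_trans (normc_le_ReIm _))//= mulrnAl mulr2n mulrC.
  by apply: lerD; apply: bmeas_int_abs => // x; apply: le_trans (fM x);
    [exact: ler_Re_normc|exact: ler_Im_normc].
Qed.

Lemma cintegral_indic rho (A : set T) : measurable A ->
  cintegral rho (fun x => (\1_A x)%:C) = (fine (rho A))%:C.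
Proof.
by move=> mA; apply: eqc; rewrite /= ?Rint_indic// Rintegral_cst// mul0r.
Qed.

Lemma cintegral_real rho (f : T -> R) :
  cintegral rho (fun x => (f x)%:C) = (\int[rho]_x f x)%:C.
Proof. by apply: eqc => //=; rewrite Rintegral_cst// mul0r. Qed.

(** The four measures are the Jordan components of the real and imaginary parts;
    the second clause is how the integral is defined, up to regrouping. *)
Lemma cmeasure_decomposition mu :
  exists a1 a2 a3 a4 : {finite_measure set T -> \bar R},
  (forall A, measurable A ->
    mu A = (fine (a1 A) - fine (a2 A)) +i* (fine (a3 A) - fine (a4 A))) /\
  (forall f, bm f -> cmeasure_integral mu f =
    cintegral a1 f - cintegral a2 f + 'i * (cintegral a3 f - cintegral a4 f)).
Proof.
rewrite /cmeasure_integral /charge_integral.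
set PN := (projT2 (cid (projT2 (cid (Hahn_decomposition (re_charge mu)))))).
set PN' := (projT2 (cid (projT2 (cid (Hahn_decomposition (im_charge mu)))))).
exists (jordan_pos PN), (jordan_neg PN), (jordan_pos PN'), (jordan_neg PN').
split; last first.
  move=> f bf; apply: eqc; rewrite /= ?cReD ?cImD ?cReM ?cImM ?cReD ?cImD ?cReN ?cImN/=; ring.
have fE (nu : {charge set T -> \bar R}) P N (nuPN : hahn_decomposition nu P N) A :
    measurable A ->
    fine (nu A) = fine (jordan_pos nuPN A) - fine (jordan_neg nuPN A).
  move=> mA; rewrite (jordan_decomp nuPN mA) /cadd/= cscaleN1.
  by rewrite fineD ?fineN// ?fin_numN; exact: fin_num_measure.
move=> A mA; apply: eqc => /=.
  by rewrite -(fE _ _ _ PN A mA).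
by rewrite -(fE _ _ _ PN' A mA).
Qed.

Lemma bfun_lincomb I1 I2 (c : R[i]) : bounded_functional I1 ->
  bounded_functional I2 -> @bounded_functional _ T R (fun f => c * I1 f + I2 f).
Proof.
move=> b1 b2; split.
- by move=> f g bf bg; rewrite (bfunD b1)// (bfunD b2)//; ring.
- by move=> k f bf; rewrite (bfunZ b1)// (bfunZ b2)//; ring.
- have [C1 C10 h1] := bfun_bound b1; have [C2 C20 h2] := bfun_bound b2.
  exists (normc c * C1 + C2); first by rewrite addr_ge0// mulr_ge0// normc_ge0.
  move=> f M bf fM; rewrite (le_trans (normcD _ _))// mulrDl lerD ?h2//.
  by rewrite normcM -mulrA ler_wpM2l ?normc_ge0// h1.
Qed.

Lemma bfun_zero : @bounded_functional _ T R (fun=> 0).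
Proof.
split=> [f g _ _|c f _|]; [by rewrite addr0|by rewrite mulr0|].
by exists 0 => // f M _ _; rewrite normc0 mul0r.
Qed.

Lemma eq_bfun (I1 I2 : (T -> R[i]) -> R[i]) : bounded_functional I1 ->
  (forall f, bm f -> I2 f = I1 f) -> bounded_functional I2.
Proof.
move=> b1 I12; split.
- by move=> f g bf bg; rewrite !I12 ?(bfunD b1)//; exact: bmD.
- by move=> c f bf; rewrite !I12 ?(bfunZ b1)//; exact: bmZ.
- have [C C0 h] := bfun_bound b1.
  by exists C => // f M bf fM; rewrite I12// h.
Qed.

Lemma bfun_cmeasure mu : bounded_functional (cmeasure_integral mu).
Proof.
have [a1 [a2 [a3 [a4 [_ intE]]]]] := cmeasure_decomposition mu.
have b i := bfun_cintegral i.
apply: (eq_bfun (I1 := fun f => 'i * ((-1) * cintegral a4 f + cintegral a3 f) +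
    ((-1) * cintegral a2 f + cintegral a1 f))).
  by apply: bfun_lincomb; exact: bfun_lincomb.
by move=> f bf; rewrite intE//; ring.
Qed.

Lemma cmeasure_integral_indic mu (A : set T) : measurable A ->
  cmeasure_integral mu (fun x => (\1_A x)%:C) = mu A.
Proof.
have [a1 [a2 [a3 [a4 [muE intE]]]]] := cmeasure_decomposition mu.
move=> mA; rewrite intE; last exact: bm_indic.
rewrite !cintegral_indic// muE//.
by apply: eqc; rewrite /= ?cReD ?cImD ?cReM ?cImM/=; ring.
Qed.

(** The Jordan components of a sum are not the sums of the components, so that
    linearity in the measure is obtained by comparison on indicators. *)
Lemma cmeasure_integralD mu nu f : bm f ->
  cmeasure_integral (mu + nu) f = cmeasure_integral mu f + cmeasure_integral nu f.
Proof.
move=> bf; rewrite -[X in _ = X + _]mul1r.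
apply: (bfun_ext (bfun_cmeasure _)
  (bfun_lincomb 1 (bfun_cmeasure mu) (bfun_cmeasure nu))) => // A mA.
by rewrite !cmeasure_integral_indic// mul1r.
Qed.

Lemma cmeasure_integralZ (c : R[i]) mu f : bm f ->
  cmeasure_integral (c *: mu) f = c * cmeasure_integral mu f.
Proof.
move=> bf; rewrite -[RHS]addr0.
apply: (bfun_ext (bfun_cmeasure _)
  (bfun_lincomb c (bfun_cmeasure mu) bfun_zero)) => // A mA.
by rewrite !cmeasure_integral_indic// addr0.
Qed.

Lemma cmeasure_integral_of rho f : bm f ->
  cmeasure_integral (cmeasure_of rho) f = cintegral rho f.
Proof.
apply: (bfun_ext (bfun_cmeasure _) (bfun_cintegral rho)) => // A mA.
by rewrite cmeasure_integral_indic// cintegral_indic//= mem_set.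
Qed.

Lemma cmeasure_integral_dirac (x : T) f : bm f ->
  cmeasure_integral (cmeasure_dirac x) f = f x.
Proof.
apply: (bfun_ext (I2 := fun f => f x) (bfun_cmeasure _)).
  split => //; exists 1 => // g M bg gM; rewrite mul1r; exact: gM.
by move=> A mA; rewrite cmeasure_integral_indic//= mem_set// diracE indicE.
Qed.

Lemma cmeasure_lincomb mu : exists a1 a2 a3 a4 : {finite_measure set T -> \bar R},
  mu = cmeasure_of a1 - cmeasure_of a2 + 'i *: (cmeasure_of a3 - cmeasure_of a4).
Proof.
have [a1 [a2 [a3 [a4 [muE _]]]]] := cmeasure_decomposition mu.
exists a1, a2, a3, a4; apply: cmeasureP => A mA; rewrite muE//=.
rewrite !mem_set//; apply: eqc; rewrite /= ?cReD ?cImD ?cReM ?cImM/=; ring.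
Qed.

(** * The total variation norm *)

Lemma sum_measure_partition rho n (F : 'I_n -> set T) :
  (forall i, measurable (F i)) -> trivIset setT F -> \bigcup_i F i = setT ->
  \sum_(i < n) fine (rho (F i)) = fine (rho setT).
Proof.
move=> mF tF FT; rewrite -FT.
have -> : \bigcup_i F i = \big[setU/set0]_(i < n) F i.
  rewrite -big_enum -bigcup_seq; apply: eq_bigcupl; split => // i _ /=.
  by rewrite mem_enum.
rewrite measure_semi_additive_ord//; last exact: bigsetU_measurable.
by rewrite sum_fine// => i _; exact: fin_num_measure.
Qed.

Lemma tvnorm_ge_sum mu n (F : 'I_n -> set T) :
  (forall i, measurable (F i)) -> trivIset setT F -> \bigcup_i F i = setT ->
  ((\sum_(i < n) normc (mu (F i)))%:E <= tvnorm mu)%E.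
Proof. by move=> mF tF FT; apply: ereal_sup_ubound; exists n, F. Qed.

Lemma tvnorm_fin mu : exists2 V, 0 <= V & tvnorm mu = V%:E.
Proof.
suff [C C0 muC] : exists2 C, 0 <= C & (tvnorm mu <= C%:E)%E.
  have mu0 : (0 <= tvnorm mu)%E.
    apply: le_trans (@tvnorm_ge_sum mu 1 (fun=> setT) _ _ _) => //.
    - by rewrite lee_fin sumr_ge0// => i _; exact: normc_ge0.
    - by move=> i j _ _ _; rewrite (ord1 i) (ord1 j).
    - by apply/seteqP; split => // x _; exists ord0.
  have muf : tvnorm mu \is a fin_num by rewrite ge0_fin_numE// (le_lt_trans muC)// ltry.
  by exists (fine (tvnorm mu)); [exact: fine_ge0|rewrite fineK].
have [a1 [a2 [a3 [a4 [muE _]]]]] := cmeasure_decomposition mu.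
have a_ge0 (a : {finite_measure set T -> \bar R}) A : 0 <= fine (a A) by exact: fine_ge0.
exists (fine (a1 setT) + fine (a2 setT) + (fine (a3 setT) + fine (a4 setT))).
  by rewrite !addr_ge0.
apply: ge_ereal_sup => _ [n [F [mF tF FT ->]]]; rewrite lee_fin.
have sumE a := sum_measure_partition a mF tF FT.
rewrite -!sumE -!big_split/=; apply: ler_sum => i _.
rewrite muE// (le_trans (normc_le_ReIm _))//= lerD//;
by rewrite (le_trans (ler_normB _ _))// !ger0_norm.
Qed.

Lemma normc_integral_le mu f (M V : R) : bm f -> (forall x, normc (f x) <= M) ->
  (tvnorm mu <= V%:E)%E -> normc (cmeasure_integral mu f) <= M * V.
Proof.
move=> bf fM muV; apply/ler_addgt0Pr => e e0.
have [C C0 hC] := bfun_bound (bfun_cmeasure mu).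
have C1 : 0 < 1 + C by rewrite ltr_wpDr.
have del0 : 0 < e / (1 + C) by rewrite divr_gt0.
have [n [F [c [mF tF FT fF]]]] := simple_approximation bf del0.
set s := fun x => \sum_(i < n) f (c i) * (\1_(F i) x)%:C in fF.
have bFi i : bm (fun x => f (c i) * (\1_(F i) x)%:C) by apply: bmZ; exact: bm_indic.
have bs : bm s by exact: bm_sum.
have -> : cmeasure_integral mu f =
    cmeasure_integral mu s + cmeasure_integral mu (fun x => f x - s x).
  by rewrite (bfunB (bfun_cmeasure mu))// addrC subrK.
rewrite (le_trans (normcD _ _))// lerD//; last first.
  rewrite (le_trans (hC _ _ (bmB bf bs) fF))// mulrCA ler_piMr ?ltW//.
  by rewrite ltr_pdivrMr// mul1r ltrDr.
rewrite /s (bfun_sum (bfun_cmeasure mu))// (le_trans (normc_sum _ _))//.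
have M0 : 0 <= M by apply: le_trans (fM point); exact: normc_ge0.
apply: (@le_trans _ _ (\sum_(i < n) M * normc (mu (F i)))).
  apply: ler_sum => i _; rewrite (bfunZ (bfun_cmeasure mu)); last exact: bm_indic.
  by rewrite cmeasure_integral_indic// normcM ler_wpM2r ?normc_ge0.
rewrite -mulr_sumr ler_wpM2l// -lee_fin; apply: le_trans muV.
exact: tvnorm_ge_sum.
Qed.

Lemma normc_measure_le mu A (V : R) : (tvnorm mu <= V%:E)%E -> normc (mu A) <= V.
Proof.
move=> muV; have [mA|nmA] := pselect (measurable A); last first.
  rewrite cmeasure_nonmeasurable// normc0 -lee_fin (le_trans _ muV)//.
  by have [W W0 ->] := tvnorm_fin mu; rewrite lee_fin.
rewrite -cmeasure_integral_indic// -[V]mul1r.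
apply: normc_integral_le => //; first exact: bm_indic.
by move=> x; rewrite normcR indicE; case: (_ \in _); rewrite ?normr1// normr0.
Qed.

End complex_measure_integral.

(** * Duality between complex measures and continuous functions *)

Section limits.
Context {R : realType}.

Lemma cauchy_seq_cvg (u : nat -> R) :
  (forall e, 0 < e -> exists N, forall n k, (N <= n)%N -> (N <= k)%N -> `|u n - u k| <= e) ->
  cvgn u.
Proof.
move=> h; apply/cauchy_cvgP/cauchy_exP => e e0.
have e20 : 0 < e / 2 by rewrite divr_gt0.
have [N hN] := h _ e20; exists (u N); exists N => // n /= Nn.
by rewrite /ball/= (le_lt_trans (hN N n _ _))// ltr_pdivrMr// ltr_pMr// ltr1n.
Qed.

Lemma ler_gt0Pl (x : R) : (forall e, 0 < e -> x <= e) -> x <= 0.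
Proof. by move=> h; apply/ler_addgt0Pl => e e0; rewrite addr0 h. Qed.

Lemma cvg_finite_sum (I : Type) (s : seq I) (F : nat -> I -> R) (l : I -> R) :
  (forall i, F ^~ i @ \oo --> l i) ->
  (fun n => \sum_(i <- s) F n i) @ \oo --> \sum_(i <- s) l i.
Proof.
move=> Fl; elim: s => [|i s IH].
  by under eq_fun do rewrite big_nil; rewrite big_nil; exact: cvg_cst.
under eq_fun do rewrite big_cons.
by rewrite big_cons; apply: cvgD; [exact: Fl|exact: IH].
Qed.

Context {d : measure_display} {E : borelMetricType d R}.

Lemma uniform_approx_continuous (f : E -> R) :
  (forall e, 0 < e -> exists2 g : E -> R, continuous g & forall x, `|f x - g x| <= e) ->
  continuous f.
Proof.
move=> h x; apply: (iffRL (cvgrPdist_lt _ _)) => e e0.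
have e40 : 0 < e / 4 by rewrite divr_gt0.
have [g cg fg] := h _ e40; near=> y.
have gxy : `|g x - g y| < e / 4.
  by near: y; apply: cvgr_dist_lt => //; exact: cg.
have -> : f x - f y = (f x - g x) + (g x - g y) - (f y - g y) by ring.
rewrite (le_lt_trans (ler_normB _ _))//.
have := ler_normD (f x - g x) (g x - g y).
have := fg x; have := fg y; lra.
Unshelve. all: by end_near. Qed.

Lemma ccont_ReIm (f : E -> R[i]) :
  continuous f <-> continuous (Re \o f) /\ continuous (Im \o f).
Proof.
split=> [cf|[cr ci]].
  split=> x; apply: continuous_comp; try exact: cf.
    exact: continuous_Re.
  exact: continuous_Im.
have -> : f = fun x => (Re (f x))%:C + 'i * (Im (f x))%:C.
  by apply/funext => x; exact: complexE.
move=> x; apply: cvgD.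
  apply: (@continuous_comp _ _ _ (Re \o f) (fun x : R => x%:C)); first exact: cr.
  exact: continuous_real_complex.
apply: cvgM; first exact: cvg_cst.
apply: (@continuous_comp _ _ _ (Im \o f) (fun x : R => x%:C)); first exact: ci.
exact: continuous_real_complex.
Qed.

Lemma ccont_real (f : E -> R) : continuous f -> continuous (fun x => (f x)%:C).
Proof. by move=> cf; apply/ccont_ReIm; split => //; exact: cont_cst. Qed.

Lemma ccontM (f g : E -> R[i]) : continuous f -> continuous g ->
  continuous (fun x => f x * g x).
Proof. by move=> cf cg x; apply: cvgM; [exact: cf|exact: cg]. Qed.

Lemma ccontZ (c : R[i]) (f : E -> R[i]) : continuous f ->
  continuous (fun x => c * f x).
Proof. by move=> cf x; apply: cvgMr; exact: cf. Qed.

Lemma ccont_sum (I : Type) (s : seq I) (F : I -> E -> R[i]) :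
  (forall i, continuous (F i)) -> continuous (fun x => \sum_(i <- s) F i x).
Proof.
move=> cF; elim: s => [|i s IH].
  by under eq_fun do rewrite big_nil; move=> x; exact: cvg_cst.
under eq_fun do rewrite big_cons.
by move=> x; apply: cvgD; [exact: cF|exact: IH].
Qed.

Lemma cont_normc (f : E -> R[i]) : continuous f -> continuous (normc \o f).
Proof.
move=> cf; rewrite (_ : _ \o _ = fun x => Re `|f x|)//.
move=> x; apply: (@continuous_comp _ _ _ (fun x => `|f x|) (@complex.Re R)).
  by apply: cvg_norm; exact: cf.
exact: continuous_Re.
Qed.

Lemma ccont_bm (f : E -> R[i]) : compact [set: E] -> continuous f ->
  bounded_measurable f.
Proof.
by move=> cE /ccont_ReIm[cr ci]; apply/bm_bmeas; split; exact: continuous_bmeas.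
Qed.

Lemma ccont_Cb (f : E -> R[i]) : compact [set: E] -> continuous f -> Cb f.
Proof. by move=> cE cf; split => //; have [] := ccont_bm cE cf. Qed.

Lemma bm_cont (f : E -> R) : compact [set: E] -> continuous f ->
  bounded_measurable (fun x => (f x)%:C).
Proof. by move=> cE cf; apply: ccont_bm => //; exact: ccont_real. Qed.

End limits.

Section density.
Context {d : measure_display} {R : realType} {E : borelMetricType d R}.
Hypothesis E_compact : compact [set: E].
Context {n : nat} (a : 'I_n -> {finite_measure set E -> \bar R}).

Let N (f : E -> R) := \sum_i \int[a i]_x `|f x|.

Let N_le (f g h : E -> R) : bmeas f -> bmeas g -> bmeas h ->
  (forall x, `|f x| <= `|g x| + `|h x|) -> N f <= N g + N h.
Proof.
move=> bf bg bh fgh; rewrite -big_split/=; apply: ler_sum => i _.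
rewrite -bmeas_intD; [|exact: bmeas_norm|exact: bmeas_norm].
by apply: bmeas_int_le => //; [|apply: bmeasD]; exact: bmeas_norm.
Qed.

(** The sets that can be approximated form a sigma-algebra containing the open
    sets. *)
Lemma L1_density (A : set E) (e : R) : measurable A -> 0 < e ->
  exists2 g : E -> R, continuous g &
    \sum_i \int[a i]_x `|g x - \1_A x| <= e.
Proof.
pose G A := measurable A /\ forall e, 0 < e ->
  exists2 g : E -> R, continuous g & N (fun x => g x - \1_A x) <= e.
suff GA : measurable `<=` G by move=> /GA[_]; exact.
have bi B : measurable B -> bmeas (\1_B : E -> R) by exact: bmeas_indic.
have Ncvg (B : set E) (g : nat -> E -> R) (M : R) : measurable B ->
    (forall k, bmeas (g k)) -> (forall k x, `|g k x| <= M) ->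
    (forall x, g ^~ x @ \oo --> (\1_B x : R)) ->
    forall e, 0 < e -> exists k, N (fun x => g k x - \1_B x) <= e.
  move=> mB bg gM gB e0 e00.
  have : (fun k => N (fun x => g k x - \1_B x)) @ \oo --> (0 : R).
    rewrite (_ : 0 = \sum_(i < n) \int[a i]_x 0); last first.
      by rewrite big1// => i _; rewrite Rintegral_cst// mul0r.
    apply: cvg_finite_sum => i.
    have [|||_] := @bounded_convergence _ _ _ (a i)
      (fun k x => `|g k x - \1_B x|) (fun=> 0) (M + 1).
    - by move=> k; have [] := bmeas_norm (bmeasB (bg k) (bi _ mB)).
    - move=> k x; rewrite normr_id (le_trans (ler_normB _ _))// lerD//.
      by rewrite indicE; case: (_ \in _); rewrite ?normr1// normr0.
    - move=> x; rewrite -(normr0 R) -(subrr (\1_B x)); apply: cvg_norm.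
      by apply: cvgB => //; exact: cvg_cst.
    - exact.
  move=> /cvgrPdist_le/(_ _ e00)[k _ /(_ k (leqnn k))].
  by rewrite sub0r normrN => h; exists k; rewrite (le_trans (ler_norm _)).
rewrite borel_measurableE; apply: smallest_sub.
  split.
  - split => // e0 e00; exists (fun=> 0); first exact: cont_cst.
    rewrite /N big1 ?ltW// => i _.
    rewrite (_ : (fun x => _) = fun=> 0) ?Rintegral_cst ?mul0r//.
    by apply/funext => x; rewrite indic0 subrr normr0.
  - move=> B [mB GB]; rewrite setTD; split; first exact: measurableC.
    move=> e0 /GB[g cg gB]; exists (fun x => 1 - g x).
      by apply: contB => //; exact: cont_cst.
    apply: le_trans gB; rewrite le_eqVlt; apply/orP; left; apply/eqP.
    apply: eq_bigr => i _; apply: eq_Rintegral => x _.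
    rewrite -normrN; congr (`|_|); rewrite indicC/= indicE.
    by case: (x \in B) => /=; ring.
  - have GU B C : G B -> G C -> G (B `|` C).
      move=> [mB GB] [mC GC]; split; first exact: measurableU.
      move=> e0 e00; have e20 : 0 < e0 / 2 by rewrite divr_gt0.
      have [g cg gB] := GB _ e20; have [h ch hC] := GC _ e20.
      exists (fun x => Num.max (g x) (h x)); first exact: cont_max.
      rewrite [e0]splitr; apply: le_trans (lerD gB hC).
      have [bg bh] := (continuous_bmeas E_compact cg, continuous_bmeas E_compact ch).
      apply: N_le; try by apply: bmeasB => //; exact: bi.
        apply: bmeasB; last exact/bi/measurableU.
        exact: bmeas_max.
      move=> x; set u := g x; set v := h x.
      have -> : \1_(B `|` C) x = Num.max (\1_B x) (\1_C x) :> R.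
        rewrite !indicE in_setU /Num.max.
        by do 2 case: (x \in _) => /=; rewrite ?ltxx ?ltr01// ltNge ler01.
      set b := \1_B x; set c := \1_C x.
      rewrite /Num.max; do 2 case: ltP => ?; rewrite ler_norml; apply/andP; split;
        have := ler_norm (u - b); have := ler_norm (v - c);
        have := lerNnormlW (lexx `|u - b|); have := lerNnormlW (lexx `|v - c|); lra.
    move=> F GF; have mF k : measurable (F k) by have [] := GF k.
    have GUn k : G (\big[setU/set0]_(j < k) F j).
      elim: k => [|k IH]; last by rewrite big_ord_recr; exact: GU.
      rewrite big_ord0; split => // e0 e00; exists (fun=> 0); first exact: cont_cst.
      rewrite /N big1 ?ltW// => i _.
      rewrite (_ : (fun x => _) = fun=> 0) ?Rintegral_cst ?mul0r//.
      by apply/funext => x; rewrite indic0 subrr normr0.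
    have mU : measurable (\bigcup_k F k) by exact: bigcupT_measurable.
    split => // e0 e00; have e20 : 0 < e0 / 2 by rewrite divr_gt0.
    have [|||k kU] := Ncvg (\bigcup_k F k)
      (fun k => \1_(\big[setU/set0]_(j < k) F j)) 1 mU _ _ _ _ e20.
    + by move=> k; apply: bi; have [] := GUn k.
    + by move=> k x; rewrite indicE; case: (_ \in _); rewrite ?normr1// normr0.
    + move=> x; have [[k _ Fkx]|nFx] := pselect ((\bigcup_k F k) x).
        rewrite indicE mem_set; last by exists k.
        apply: cvg_near_cst; exists k.+1 => // j /= kj; rewrite indicE mem_set//.
        by rewrite -bigcup_mkord; exists k.
      rewrite indicE memNset//; apply: cvg_near_cst; near=> j.
      rewrite indicE memNset// -bigcup_mkord => -[k _ Fkx]; apply: nFx.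
      by exists k.
    have [mk /(_ _ e20)[g cg gk]] := GUn k.
    exists g => //; rewrite [e0]splitr; apply: le_trans (lerD gk kU).
    have bg := continuous_bmeas E_compact cg.
    apply: N_le; try by apply: bmeasB => //; exact: bi.
    move=> x; apply: le_trans (ler_normD _ _); rewrite le_eqVlt; apply/orP; left.
    by apply/eqP; congr (`|_|); rewrite addrA subrK.
move=> U oU; split; first exact: open_borel.
move=> e0 e00; have [h [ch h01 _ hU0 hU1]] := open_exhaustion oU.
have [|||k kU] := Ncvg U h 1 (open_borel oU) _ _ _ _ e00.
- by move=> k; exact: continuous_bmeas.
- by move=> k x; have /andP[h0 h1] := h01 k x; rewrite ger0_norm.
- move=> x; have [Ux|nUx] := pselect (U x).
    rewrite indicE mem_set//; apply: cvg_near_cst; exact: hU1.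
  by rewrite indicE memNset//; apply: cvg_near_cst; apply: nearW => k; exact: hU0.
by exists (h k).
Unshelve. all: by end_near. Qed.

End density.

Lemma bm_normc {d : measure_display} {T : measurableType d} {R : realType}
  (f : T -> R[i]) : bounded_measurable f -> bmeas (fun x => normc (f x)).
Proof.
move=> [[mr mi] [M fM]]; split.
  rewrite (_ : (fun x => _) = fun x => Num.sqrt (Re (f x) ^+ 2 + Im (f x) ^+ 2)).
    apply: measurableT_comp.
      by apply: continuous_measurable_fun; apply: sqrt_continuous.
    by apply: measurable_realfun.measurable_funD; exact: measurable_funX.
  by apply/funext => x /=; case: (f x).
by exists M => x; rewrite ger0_norm ?normc_ge0.
Qed.

Section duality.
Context {d : measure_display} {R : realType} {E : borelMetricType d R}.
Hypothesis E_compact : compact [set: E].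
Implicit Types mu nu : cmeasure E R.

Lemma cmeasure_dominated mu : exists a : 'I_4 -> {finite_measure set E -> \bar R},
  forall f, bounded_measurable f ->
    normc (cmeasure_integral mu f) <= 2 * \sum_i \int[a i]_x normc (f x).
Proof.
have [a1 [a2 [a3 [a4 [_ muE]]]]] := cmeasure_decomposition mu.
exists (fun i => nth a1 [:: a1; a2; a3; a4] i) => f bf.
have /bm_bmeas[rf jf] := bf.
have nf := bm_normc bf.
have ca (a : {finite_measure set E -> \bar R}) :
    normc (cintegral a f) <= 2 * \int[a]_x normc (f x).
  rewrite (le_trans (normc_le_ReIm _))//= mulr2n mulrDl mul1r.
  apply: lerD; rewrite (le_trans (le_normr_Rintegral _ (bmeas_integrable _ _)))//;
    (apply: bmeas_int_le => //; first exact: bmeas_norm) => x.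
    exact: ler_Re_normc.
  exact: ler_Im_normc.
rewrite (_ : \sum_i _ = \int[a1]_x normc (f x) + (\int[a2]_x normc (f x) +
    (\int[a3]_x normc (f x) + \int[a4]_x normc (f x)))); last first.
  by rewrite !big_ord_recl big_ord0/= addr0.
rewrite muE// (le_trans (normcD _ _))//.
have ni : normc ('i : R[i]) = 1 by rewrite /= expr0n expr1n add0r sqrtr1.
rewrite normcM ni mul1r.
have := normcD (cintegral a1 f) (- cintegral a2 f).
have := normcD (cintegral a3 f) (- cintegral a4 f).
rewrite !normcN => h1 h2.
have := ca a1; have := ca a2; have := ca a3; have := ca a4; lra.
Qed.

(** The norm of a measure is attained on continuous functions: a step function
    with unimodular values is approximated in [L^1] by continuous functions, and
    these are then retracted onto the unit disk. *)
Lemma tvnorm_le_dual mu (C : R) :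
  (forall f, continuous f -> (forall x, normc (f x) <= 1) ->
    normc (cmeasure_integral mu f) <= C) -> (tvnorm mu <= C%:E)%E.
Proof.
move=> muC; apply: ge_ereal_sup => _ [n [F [mF tF FT ->]]]; rewrite lee_fin.
have /choice[w wP] (i : 'I_n) := normc_phase (mu (F i)).
pose h x := \sum_(i < n) w i * (\1_(F i) x)%:C.
have bmu := bfun_cmeasure mu.
have bFi i : bounded_measurable (fun x => w i * (\1_(F i) x)%:C).
  by apply: bmZ; exact: bm_indic.
have bh : bounded_measurable h by exact: bm_sum.
have h1 x : normc (h x) <= 1.
  have [i _ Fi] : (\bigcup_i F i) x by rewrite FT.
  rewrite /h (bigD1 i)//= indicE mem_set// mulr1 big1 ?addr0; first by have [] := wP i.
  move=> j ji; rewrite indicE memNset ?mulr0// => Fj.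
  move/eqP : ji; apply; apply: tF => //; by exists x.
have muh : cmeasure_integral mu h = (\sum_(i < n) normc (mu (F i)))%:C.
  rewrite /h (bfun_sum bmu)// raddf_sum; apply: eq_bigr => i _.
  rewrite (bfunZ bmu); last exact: bm_indic.
  by rewrite cmeasure_integral_indic//; have [] := wP i.
have [a ha] := cmeasure_dominated mu.
apply/ler_addgt0Pr => e e0.
have n40 : 0 < (n * 4).+1%:R :> R by rewrite ltr0n.
have del0 : 0 < e / (n * 4).+1%:R by rewrite divr_gt0.
have /choice[g gP] (i : 'I_n) : exists g : E -> R, continuous g /\
    \sum_i0 \int[a i0]_x `|g x - \1_(F i) x| <= e / (n * 4).+1%:R.
  by have [g cg ga] := L1_density E_compact a (mF i) del0; exists g.
pose G x := \sum_(i < n) w i * (g i x)%:C.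
have cG : continuous G.
  apply: ccont_sum => i; apply: ccontZ; apply: ccont_real; by have [] := gP i.
pose k x := (Num.max 1 (normc (G x)))^-1.
have m1 x : 1 <= Num.max 1 (normc (G x)) by rewrite le_max lexx.
have m0 x : 0 < Num.max 1 (normc (G x)) by rewrite (lt_le_trans ltr01).
have ck : continuous k.
  move=> x; apply: cvgV; first by rewrite gt_eqF.
  by apply: cont_max; [exact: cont_cst|exact: cont_normc].
pose PG x := G x * (k x)%:C.
have cPG : continuous PG := ccontM cG (ccont_real ck).
have PG1 x : normc (PG x) <= 1.
  have k0 : 0 <= k x by rewrite invr_ge0 ltW.
  rewrite normcM normcR ger0_norm// ler_pdivrMr// mul1r.
  by rewrite le_max lexx orbT.
have PGh x : normc (PG x - h x) <= 2 * normc (G x - h x).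
  have -> : PG x - h x = (PG x - G x) + (G x - h x) by ring.
  rewrite (le_trans (normcD _ _))// mulr2n mulrDl mul1r lerD2r.
  have -> : PG x - G x = G x * (k x - 1)%:C.
    by rewrite /PG rmorphB/= mulrBr mulr1.
  have k1 : k x <= 1 by rewrite invf_le1.
  rewrite normcM normcR distrC ger0_norm ?subr_ge0// mulrBr mulr1.
  have := normcD (G x - h x) (h x); rewrite subrK => Gh.
  have [G1|G1] := leP (normc (G x)) 1.
    by rewrite /k (max_idPl G1) invr1 mulr1 subrr normc_ge0.
  rewrite /k (max_idPr (ltW G1)) divff ?gt_eqF ?(lt_trans ltr01)//.
  by have := h1 x; lra.
have bPGh : bounded_measurable (fun x => PG x - h x).
  by apply: bmB => //; exact: ccont_bm.
have -> : \sum_(i < n) normc (mu (F i)) = normc (cmeasure_integral mu h).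
  by rewrite muh normcR ger0_norm// sumr_ge0// => i _; exact: normc_ge0.
have -> : cmeasure_integral mu h = cmeasure_integral mu PG -
    cmeasure_integral mu (fun x => PG x - h x).
  by rewrite (bfunB bmu)//; [ring|exact: ccont_bm].
rewrite (le_trans (normcD _ _))// normcN lerD ?muC//.
rewrite (le_trans (ha _ bPGh))//.
have Gh x : normc (G x - h x) <= \sum_(i < n) `|g i x - \1_(F i) x|.
  rewrite /G /h -sumrB (le_trans (normc_sum _ _))//; apply: ler_sum => i _.
  rewrite -mulrBr -rmorphB/= normcM normcR ler_piMl//; by have [] := wP i.
have bgF i : bmeas (fun x => `|g i x - \1_(F i) x|).
  apply: bmeas_norm; apply: bmeasB; last exact: bmeas_indic.
  by apply: continuous_bmeas => //; have [] := gP i.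
apply: (@le_trans _ _ (2 * \sum_(j < 4) \int[a j]_x
    (2 * \sum_(i < n) `|g i x - \1_(F i) x|))).
  rewrite ler_wpM2l//; apply: ler_sum => j _.
  have bs : bmeas (fun x => 2 * \sum_(i < n) `|g i x - \1_(F i) x|).
    by apply: bmeasZ; exact: bmeas_sum.
  apply: le_Rintegral => //; last first.
    by move=> x _; rewrite (le_trans (PGh x))// ler_wpM2l.
    exact/bmeas_integrable.
  exact/bmeas_integrable/bm_normc.
rewrite (eq_bigr (fun j => 2 * \sum_(i < n) \int[a j]_x `|g i x - \1_(F i) x|)); last first.
  move=> j _; rewrite bmeas_intZ; last exact: bmeas_sum.
  by rewrite bmeas_int_sum.
rewrite -mulr_sumr exchange_big/= mulrA.
apply: (@le_trans _ _ (2 * 2 * \sum_(i < n) e / (n * 4).+1%:R)).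
  by rewrite ler_wpM2l//; apply: ler_sum => i _; have [] := gP i.
rewrite sumr_const card_ord -[_ *+ n]mulr_natl mulrA mulrCA ler_piMr ?ltW//.
rewrite ltr_pdivrMr// mul1r -2!natrM ltr_nat; lia.
Qed.

Lemma cmeasure_eqP mu nu :
  (forall f : E -> R, continuous f -> cmeasure_integral mu (fun x => (f x)%:C) =
    cmeasure_integral nu (fun x => (f x)%:C)) -> mu = nu.
Proof.
move=> munu; have nuE f : bounded_measurable f ->
    cmeasure_integral (mu - nu) f = cmeasure_integral mu f - cmeasure_integral nu f.
  by move=> bf; rewrite cmeasure_integralD// -scaleN1r cmeasure_integralZ// mulN1r.
have tv0 : (tvnorm (mu - nu)%R <= 0%:E)%E.
  apply: tvnorm_le_dual => f cf _; rewrite nuE; last exact: ccont_bm.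
  have /ccont_ReIm[cr ci] := cf.
  have [br bi] := (bm_cont E_compact cr, bm_cont E_compact ci).
  have fE (k : cmeasure E R) : cmeasure_integral k f =
      cmeasure_integral k (fun x => (Re (f x))%:C) +
      'i * cmeasure_integral k (fun x => (Im (f x))%:C).
    rewrite -(bfunZ (bfun_cmeasure k))// -(bfunD (bfun_cmeasure k))//; last exact: bmZ.
    by congr cmeasure_integral; apply/funext => x; exact: complexE.
  by rewrite !fE munu// (munu (fun x => Im (f x)))// subrr normc0.
apply/eqP; rewrite -subr_eq0; apply/eqP; apply: cmeasureP => A mA.
apply/normc_eq0/eqP; rewrite eq_le normc_ge0 andbT.
exact: normc_measure_le.
Qed.

End duality.

(** * Completeness of the total variation norm *)

Lemma sum_indic_disjoint {T : Type} {R : realType} (F : nat -> set T) k x :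
  trivIset setT F ->
  \sum_(0 <= i < k) (\1_(F i) x : R) = \1_(\big[setU/set0]_(i < k) F i) x.
Proof.
move=> tF; elim: k => [|k IH]; first by rewrite big_nil big_ord0 indic0.
rewrite big_nat_recr//= IH big_ord_recr/= !indicE in_setU.
have [Fk|nFk] := boolP (x \in F k); last by rewrite orbF addr0.
rewrite memNset ?orbT ?add0r//= -bigcup_mkord => -[i /= ik Fi].
have : i = k by apply: tF => //; exists x; split => //; exact: set_mem.
by move/eqP; rewrite ltn_eqF.
Qed.

Section completeness.
Context {d : measure_display} {T : measurableType d} {R : realType}.
Implicit Types mu nu : cmeasure T R.

Lemma normc_sum_disjoint mu (F : nat -> set T) (k : nat) (V : R) :
  (forall i, measurable (F i)) -> trivIset setT F -> (tvnorm mu <= V%:E)%E ->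
  normc (\sum_(0 <= i < k) mu (F i)) <= V.
Proof.
move=> mF tF muV.
have bF i : bounded_measurable (fun x : T => (\1_(F i) x)%:C : R[i]) by exact: bm_indic.
have -> : \sum_(0 <= i < k) mu (F i) =
    cmeasure_integral mu (fun x => \sum_(0 <= i < k) (\1_(F i) x)%:C).
  rewrite (bfun_sum (bfun_cmeasure mu))//; apply: eq_bigr => i _.
  by rewrite cmeasure_integral_indic.
rewrite -[V]mul1r; apply: normc_integral_le => //; first exact: bm_sum.
move=> x; rewrite -(raddf_sum (real_complex R)) sum_indic_disjoint// normcR indicE.
by case: (_ \in _); rewrite ?normr1// normr0.
Qed.

Lemma cauchy_cseq_cvg (z : nat -> R[i]) :
  (forall e, 0 < e -> exists N, forall n k, (N <= n)%N -> (N <= k)%N ->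
     normc (z n - z k) <= e) ->
  exists l : R[i], z @ \oo --> l.
Proof.
move=> h.
have cRe : cvgn (Re \o z).
  apply: cauchy_seq_cvg => e /h[N hN]; exists N => n k Nn Nk.
  by rewrite (le_trans _ (hN n k Nn Nk))//= -cReN -cReD ler_Re_normc.
have cIm : cvgn (Im \o z).
  apply: cauchy_seq_cvg => e /h[N hN]; exists N => n k Nn Nk.
  by rewrite (le_trans _ (hN n k Nn Nk))//= -cImN -cImD ler_Im_normc.
move: cRe cIm => /cvg_ex[a za] /cvg_ex[b zb]; exists (a%:C + 'i * b%:C).
rewrite (_ : z = fun n => (Re (z n))%:C + 'i * (Im (z n))%:C); last first.
  by apply/funext => n; exact: complexE.
apply: cvgD; first exact: (cvg_complex za).
by apply: cvgMr; exact: (cvg_complex zb).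
Qed.

Lemma cvg_normc_le (z : nat -> R[i]) (l : R[i]) (M : R) : z @ \oo --> l ->
  (\forall n \near \oo, normc (z n) <= M) -> normc l <= M.
Proof.
move=> /cvg_normc zl zM; apply/ler_addgt0Pr => e /zl[N _ hN].
have [K _ hK] := zM.
have := hN (maxn N K) (leq_maxl _ _); have := hK (maxn N K) (leq_maxr _ _) => /= h1 h2.
rewrite -(subrK (z (maxn N K)) l) (le_trans (normcD _ _))//.
by rewrite addrC lerD// ltW.
Qed.

Lemma cvg_finite_csum (I : Type) (s : seq I) (F : nat -> I -> R[i]) (l : I -> R[i]) :
  (forall i, F ^~ i @ \oo --> l i) ->
  (fun n => \sum_(i <- s) F n i) @ \oo --> \sum_(i <- s) l i.
Proof.
move=> Fl; elim: s => [|i s IH].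
  by under eq_fun do rewrite big_nil; rewrite big_nil; exact: cvg_cst.
under eq_fun do rewrite big_cons.
by rewrite big_cons; apply: cvgD; [exact: Fl|exact: IH].
Qed.

(** The limit is taken set by set. It is sigma-additive because the convergence is
    uniform over all disjoint families of sets. *)
Theorem tvnorm_complete (u : nat -> cmeasure T R) :
  (forall e : R, 0 < e -> exists N, forall i j, (N <= i)%N -> (N <= j)%N ->
     (tvnorm (u i - u j)%R < e%:E)%E) ->
  exists mu : cmeasure T R, (fun n => tvnorm (u n - mu)) @ \oo --> 0%E.
Proof.
move=> cu.
have uA i j A : (u i - u j) A = u i A - u j A by [].
have /choice[mu muP] A : exists l : R[i], (fun n => u n A) @ \oo --> l.
  apply: cauchy_cseq_cvg => e /cu[N hN]; exists N => n k Nn Nk.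
  by rewrite -uA; apply: normc_measure_le; apply: ltW; exact: hN.
have sumP (F : nat -> set T) k : (fun n => \sum_(0 <= i < k) u n (F i)) @ \oo -->
    \sum_(0 <= i < k) mu (F i) by exact: cvg_finite_csum.
have munm A : ~ measurable A -> mu A = 0.
  move=> mA; apply/normc_eq0/eqP; rewrite eq_le normc_ge0 andbT.
  apply: (cvg_normc_le (muP A)); apply: nearW => n.
  by rewrite cmeasure_nonmeasurable// normc0.
have musa (F : (set T)^nat) : (forall n, measurable (F n)) -> trivIset setT F ->
    (fun n => \sum_(0 <= i < n) mu (F i)) @ \oo --> mu (\bigcup_n F n).
  move=> mF tF; apply/cvg_normc => e e0.
  have e40 : 0 < e / 4 by rewrite divr_gt0.
  have [N hN] := cu _ e40.
  have hU : normc (mu (\bigcup_n F n) - u N (\bigcup_n F n)) <= e / 4.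
    apply: (@cvg_normc_le (fun k => u k (\bigcup_n F n) - u N (\bigcup_n F n))).
      by apply: cvgB => //; exact: cvg_cst.
    exists N => // k /= Nk; rewrite -uA; apply: normc_measure_le.
    by apply: ltW; apply: hN.
  have hF n : normc (\sum_(0 <= i < n) mu (F i) - \sum_(0 <= i < n) u N (F i)) <= e / 4.
    apply: (@cvg_normc_le (fun k => \sum_(0 <= i < n) u k (F i) - \sum_(0 <= i < n) u N (F i))).
      by apply: cvgB => //; exact: cvg_cst.
    exists N => // k /= Nk; rewrite -sumrB; under eq_bigr do rewrite -uA.
    by apply: normc_sum_disjoint => //; apply: ltW; apply: hN.
  have /cvg_normc/(_ _ e40) := @cmeasure_sigma_additive _ _ _ (u N) F mF tF.
  apply: filterS => n hn.
  have -> : mu (\bigcup_n F n) - \sum_(0 <= i < n) mu (F i) =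
    (mu (\bigcup_n F n) - u N (\bigcup_n F n)) +
    ((u N (\bigcup_n F n) - \sum_(0 <= i < n) u N (F i)) +
    (\sum_(0 <= i < n) u N (F i) - \sum_(0 <= i < n) mu (F i))) by ring.
  rewrite (le_lt_trans (normcD _ _))//.
  have := normcD (u N (\bigcup_n F n) - \sum_(0 <= i < n) u N (F i))
    (\sum_(0 <= i < n) u N (F i) - \sum_(0 <= i < n) mu (F i)).
  have : normc (\sum_(0 <= i < n) u N (F i) - \sum_(0 <= i < n) mu (F i)) <= e / 4.
    by rewrite normcB.
  move: hn hU => /=; lra.
pose nu := CMeasure musa munm.
exists nu.
have /choice[V VP] n : exists V, 0 <= V /\ tvnorm (u n - nu) = V%:E.
  by have [V V0 ->] := tvnorm_fin (u n - nu); exists V.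
rewrite (_ : (fun n => _) = EFin \o V); last first.
  by apply/funext => n /=; have [] := VP n.
apply: cvg_EFin; first exact: nearW.
apply/cvgrPdist_le => e e0; have [N hN] := cu _ e0.
exists N => // n /= Nn; rewrite sub0r normrN ger0_norm; last by have [] := VP n.
have [_ VE] := VP n; rewrite -lee_fin -VE.
apply: ge_ereal_sup => _ [k [F [mF tF FT ->]]]; rewrite lee_fin.
apply: (@cvgr_to_le nat \oo _ R (fun j => \sum_(i < k) normc ((u n - u j) (F i)))).
  apply: (@cvg_finite_sum _ _ _ (fun j i => normc ((u n - u j) (F i)))
    (fun i => normc ((u n - nu) (F i)))) => i.
  have h : (fun j => u n (F i) - u j (F i)) @ \oo --> u n (F i) - mu (F i).
    by apply: cvgB; [exact: cvg_cst|exact: muP].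
  exact: (cvg_Re (cvg_norm h)).
exists N => // j /= Nj; rewrite -lee_fin; apply: le_trans (ltW (hN n j Nn Nj)).
exact: tvnorm_ge_sum.
Qed.

End completeness.

(** * Uniform boundedness of weakly convergent sequences *)

Section uniform_boundedness.
Context {d : measure_display} {R : realType} {E : borelMetricType d R}.
Hypothesis E_compact : compact [set: E].

Lemma geometric_uniform_limit (f : nat -> E -> R) :
  (forall k, continuous (f k)) -> (forall k x, `|f k.+1 x - f k x| <= 3^-1 ^+ k) ->
  exists2 g : E -> R, continuous g & forall k x, `|g x - f k x| <= 3 / 2 * 3^-1 ^+ k.
Proof.
move=> cf df.
have r0 k : 0 < (3^-1 : R) ^+ k by rewrite exprn_gt0.
have tail k j x : `|f (k + j)%N x - f k x| <= 3 / 2 * 3^-1 ^+ k * (1 - 3^-1 ^+ j).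
  elim: j => [|j IH]; first by rewrite addn0 subrr normr0 expr0 subrr mulr0.
  rewrite addnS -(subrK (f (k + j)%N x) (f _.+1 x)) -addrA.
  rewrite (le_trans (ler_normD _ _))//.
  have := df (k + j)%N x; rewrite exprD exprS.
  have := IH; set a := 3^-1 ^+ k; set b := 3^-1 ^+ j; nra.
have tail' k j x : (k <= j)%N -> `|f j x - f k x| <= 3 / 2 * 3^-1 ^+ k.
  move=> kj; rewrite -(subnKC kj) (le_trans (tail _ _ _))//.
  by rewrite ler_piMr ?mulr_ge0 ?ltW// ltrBlDr ltrDl.
have rcvg (e : R) : 0 < e -> exists k, 3 / 2 * 3^-1 ^+ k <= e.
  move=> e0; have : (fun k => 3 / 2 * 3^-1 ^+ k) @ \oo --> (3 / 2 * 0 : R).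
    by apply: cvgMr; apply: cvg_expr; rewrite ger0_norm ?invr_ge0// invf_lt1// ltr1n.
  rewrite mulr0 => /cvgrPdist_le/(_ _ e0)[k _ /(_ k (leqnn k))].
  rewrite sub0r normrN => h; exists k; exact: le_trans (ler_norm _) h.
have /choice[g gP] x : exists l : R, f ^~ x @ \oo --> l.
  apply/cvg_ex; apply: cauchy_seq_cvg => e e0.
  have e20 : 0 < e / 2 by rewrite divr_gt0.
  have [N hN] := rcvg _ e20; exists N => n k Nn Nk.
  have -> : f n x - f k x = (f n x - f N x) - (f k x - f N x) by ring.
  rewrite (le_trans (ler_normB _ _))// [e]splitr lerD// (le_trans _ hN)// tail'//.
have gf k x : `|g x - f k x| <= 3 / 2 * 3^-1 ^+ k.
  have h : (fun j => f j x - f k x) @ \oo --> g x - f k x.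
    by apply: cvgB; [exact: gP|exact: cvg_cst].
  have h' : (fun j => `|f j x - f k x|) @ \oo --> `|g x - f k x| by exact: cvg_norm.
  by apply: (cvgr_to_le h'); exists k => // j /= kj; exact: tail'.
exists g; last exact: gf.
apply: uniform_approx_continuous => e e0.
by have [k hk] := rcvg e e0; exists (f k) => // x; exact: le_trans hk.
Qed.

(** The uniform boundedness principle, by Sokal's elementary argument: a linear
    functional maps [f - r h] or [f + r h] to a value at least as large as that of
    [r h]. If the norms of the functionals were unbounded, a rapidly convergent
    sequence of such corrections would produce a function on which the functionals
    are not bounded. *)
Lemma weak_cvg_bounded (u : nat -> cmeasure E R) (mu : cmeasure E R) :
  weak_cvg u mu -> exists2 C, 0 <= C & forall n (f : E -> R), continuous f ->
    (forall x, `|f x| <= 1) -> normc (cmeasure_integral (u n) (fun x => (f x)%:C)) <= C.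
Proof.
move=> umu; pose L n (f : E -> R) := cmeasure_integral (u n) (fun x => (f x)%:C).
have LB n f g : continuous f -> continuous g ->
    L n (fun x => f x - g x) = L n f - L n g.
  move=> cf cg; rewrite /L -(bfunB (bfun_cmeasure (u n))); [|exact: bm_cont|exact: bm_cont].
  by congr cmeasure_integral; apply/funext => x; rewrite rmorphB.
have LZ n (c : R) f : continuous f -> L n (fun x => c * f x) = c%:C * L n f.
  move=> cf; rewrite /L -(bfunZ (bfun_cmeasure (u n))); last exact: bm_cont.
  by congr cmeasure_integral; apply/funext => x; rewrite rmorphM.
have Lpt f : continuous f -> exists B, forall n, normc (L n f) <= B.
  move=> cf; have /cvg_normc/(_ 1 ltr01)[N _ hN] := umu _ (ccont_Cb E_compact (ccont_real cf)).
  pose l := cmeasure_integral mu (fun x => (f x)%:C).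
  exists (\sum_(i < N) normc (L i f) + (normc l + 1)) => n.
  have s0 : 0 <= \sum_(i < N) normc (L i f) by apply: sumr_ge0 => i _; exact: normc_ge0.
  have l0 := normc_ge0 l; have [Nn|nN] := leqP N n.
    have h : normc (L n f - l) < 1 by rewrite normcB; exact: hN.
    have := normcD (L n f - l) l; rewrite subrK; lra.
  rewrite (bigD1 (Ordinal nN) isT) -!addrA lerDl !addr_ge0//.
  by apply: sumr_ge0 => i _; exact: normc_ge0.
pose unit_ball n := [set s | exists2 f : E -> R,
  continuous f /\ (forall x, `|f x| <= 1) & s = normc (L n f)].
pose K n := sup (unit_ball n).
have Ksup n : has_sup (unit_ball n).
  split; first by exists (normc (L n (fun=> 0))), (fun=> 0) => //; split;
    [exact: cont_cst|move=> x; rewrite normr0].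
  have [V V0 VE] := tvnorm_fin (u n).
  exists V => _ [f [cf f1] ->]; rewrite -[V]mul1r; apply: normc_integral_le.
  - exact: bm_cont.
  - by move=> x; rewrite normcR.
  - by rewrite VE.
have LK n f : continuous f -> (forall x, `|f x| <= 1) -> normc (L n f) <= K n.
  by move=> cf f1; apply: ub_le_sup; [have [] := Ksup n|exists f].
have LKM n f (M : R) : 0 < M -> continuous f -> (forall x, `|f x| <= M) ->
    normc (L n f) <= M * K n.
  move=> M0 cf fM; rewrite -ler_pdivrMl//.
  have -> : M^-1 * normc (L n f) = normc (L n (fun x => M^-1 * f x)).
    by rewrite LZ// normcM normcR ger0_norm// invr_ge0 ltW.
  apply: LK; first exact: contZ.
  by move=> x; rewrite normrM ger0_norm ?invr_ge0 ?(ltW M0)// ler_pdivrMl// mulr1.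
have K0 n : 0 <= K n.
  apply: le_trans (LK n (fun=> 0) _ _); first exact: normc_ge0.
    exact: cont_cst.
  by move=> x; rewrite normr0.
have [[C KC]|nKC] := pselect (exists C, forall n, K n <= C).
  exists C; first by apply: le_trans (KC 0%N).
  by move=> n f cf f1; apply: le_trans (LK n f cf f1) (KC n).
exfalso.
have {}nKC C : exists n, C < K n.
  apply/not_existsP => h; apply: nKC; exists C => n; rewrite leNgt; apply/negP.
  exact: h.
(* The tail of the corrections after step k is at most r k / 2, less than the
   proportion 3 / 4 of r k that step k secures. *)
pose r k : R := 3^-1 ^+ k.
have r0 k : 0 < r k by rewrite exprn_gt0.
have /choice[S SP] (kf : nat * (E -> R)) : exists g : E -> R, continuous kf.2 ->
    [/\ continuous g, forall x, `|g x - kf.2 x| <= r kf.1 &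
    exists2 n, kf.1%:R / r kf.1 < K n & 3 / 4 * r kf.1 * K n <= normc (L n g)].
  case: kf => k f; rewrite (_ : (k, f).1 = k)// (_ : (k, f).2 = f)//; have [cf|ncf] := pselect (continuous f); last by exists f.
  have [n nK] := nKC (k%:R / r k).
  have Kn0 : 0 < K n by apply: le_lt_trans nK; rewrite divr_ge0// ltW.
  have Kn4 : 0 < K n / 4 by rewrite divr_gt0.
  have [_ [h [ch h1] ->] hK] := sup_adherent Kn4 (Ksup n).
  rewrite -/(K n) in hK.
  pose g1 x := f x - r k * h x; pose g2 x := f x - (- r k) * h x.
  have cg1 : continuous g1 by apply: contB => //; exact: contZ.
  have cg2 : continuous g2 by apply: contB => //; exact: contZ.
  have : 2 * (3 / 4 * r k * K n) <= normc (L n g1) + normc (L n g2).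
    have -> : L n g1 = L n f - (r k)%:C * L n h by rewrite LB ?LZ//; exact: contZ.
    have -> : L n g2 = L n f - (- r k)%:C * L n h by rewrite LB ?LZ//; exact: contZ.
    rewrite -[normc (_ - (- r k)%:C * _)]normcN.
    have := normcD (L n f - (r k)%:C * L n h) (- (L n f - (- r k)%:C * L n h)).
    rewrite (_ : L n f - _ - (_ - _) = (- (2 * r k))%:C * L n h); last first.
      by rewrite mulr2n mulrDl mul1r !rmorphN rmorphD; ring.
    rewrite normcM normcR normrN ger0_norm ?mulr_ge0 ?(ltW (r0 k))//.
    have := r0 k; nra.
  have /orP[g1L|g1L] := le_total (3 / 4 * r k * K n) (normc (L n g1)).
    exists g1 => _; split => //; last by exists n.
    move=> x; rewrite /g1 addrAC subrr add0r normrN normrM (gtr0_norm (r0 k)).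
    by rewrite ler_piMr ?(ltW (r0 k)).
  move=> g12; exists g2 => _; split => //; last by exists n => //; lra.
  move=> x; rewrite /g2 addrAC subrr add0r normrN normrM normrN (gtr0_norm (r0 k)).
  by rewrite ler_piMr ?(ltW (r0 k)).
pose F := fix F k := if k is j.+1 then S (j, F j) else fun=> 0.
have cF k : continuous (F k).
  by elim: k => [|k IH]; [exact: cont_cst|have [] := SP (k, F k) IH].
have dF k x : `|F k.+1 x - F k x| <= 3^-1 ^+ k.
  by have [_ h _] := SP (k, F k) (cF k); exact: h.
have [g cg gF] := geometric_uniform_limit cF dF.
have [B hB] := Lpt g cg.
pose k := (Num.truncn (4 * B)).+1.
have [_ _ [n nK Ln]] := SP (k, F k) (cF k).
have {}nK : k%:R / r k < K n := nK.
have {}Ln : 3 / 4 * r k * K n <= normc (L n (F k.+1)) := Ln.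
have : normc (L n (fun x => F k.+1 x - g x)) <= 1 / 2 * r k * K n.
  apply: LKM; [by rewrite mulr_gt0|exact: contB|].
  move=> x; rewrite distrC (le_trans (gF k.+1 x))// exprS -/(r k).
  by have := r0 k; lra.
rewrite LB// => h.
have := normcD (L n (F k.+1) - L n g) (L n g); rewrite subrK.
have := hB n; have kB : 4 * B < k%:R by exact: truncnS_gt.
have : k%:R < K n * r k by rewrite -ltr_pdivrMr.
lra.
Qed.

End uniform_boundedness.

(** * Eigenfunction expansions *)

Section kernel_density.
Context {d : measure_display} {R : realType} {E : borelMetricType d R}.
Variable m : {finite_measure set E -> \bar R}.
Variable p : R -> E -> {finite_measure set E -> \bar R}.
Variable q : R -> E -> E -> R.
Hypothesis dens : kernel_density m p q.

Lemma density_bmeas t x : 0 < t -> bmeas (q t x).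
Proof.
move=> t0; have [mq [M qM] _ _] := dens t0.
split; last by exists M => y; exact: qM.
have := @measurableT_comp _ _ _ _ _ _ _ _ (pair x) mq.
by apply; exact: measurable_pair1.
Qed.

Lemma kernel_integral t x f : 0 < t -> bmeas f ->
  \int[p t x]_y f y = \int[m]_y (f y * q t x y).
Proof.
move=> t0 bf; have bq := density_bmeas x t0.
pose J (g : E -> R[i]) := cintegral m (fun y => g y * (q t x y)%:C).
have bqC : bounded_measurable (fun y => (q t x y)%:C : R[i]) by exact: bm_real.
have bJ : bounded_functional J.
  have bI := bfun_cintegral m; split.
  - move=> g h bg bh; rewrite /J -(bfunD bI); [|exact: bmM|exact: bmM].
    by congr cintegral; apply/funext => y; rewrite mulrDl.
  - move=> c g bg; rewrite /J -(bfunZ bI); last exact: bmM.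
    by congr cintegral; apply/funext => y; rewrite mulrA.
  - have [C C0 hC] := bfun_bound bI; have [_ [M qM]] := bq.
    have M0 : 0 <= M by rewrite (le_trans _ (qM point)).
    exists (C * M); first by rewrite mulr_ge0.
    move=> g N bg gN; rewrite -mulrA (hC _ (M * N))//; first exact: bmM.
    move=> y; rewrite normcM normcR mulrC ler_pM//; exact: normc_ge0.
have : cintegral (p t x) (fun y => (f y)%:C) = J (fun y => (f y)%:C).
  apply: (bfun_ext (bfun_cintegral _) bJ); last exact: bm_real.
  move=> A mA; rewrite cintegral_indic// /J.
  rewrite (_ : (fun y => _) = fun y => (\1_A y * q t x y)%:C); last first.
    by apply/funext => y; rewrite rmorphM.
  rewrite cintegral_real; congr (_%:C).
  have [_ _ _ ->//] := dens t0.
  rewrite -/(Rintegral m A (fun y => q t x y)) Rintegral_mkcond.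
  apply: eq_Rintegral => y _; rewrite patchE indicE.
  by case: (y \in A); rewrite ?mul1r ?mul0r.
rewrite cintegral_real /J (_ : (fun y => _) = fun y => (f y * q t x y)%:C); last first.
  by apply/funext => y; rewrite rmorphM.
by rewrite cintegral_real => -[].
Qed.

End kernel_density.

Section spectral_data.
Context {d : measure_display} {R : realType} {E : borelMetricType d R}.
Hypothesis E_compact : compact [set: E].
Variable m : {finite_measure set E -> \bar R}.
Variable p : R -> E -> {finite_measure set E -> \bar R}.
Variable q : R -> E -> E -> R.
Variables (lam : nat -> R) (e : nat -> E -> R).

(** The eigenfunctions are taken real and the eigenvalues distinct, which is what
    simplicity of the spectrum provides. *)
Record spectral_data : Prop := {
  sd_density : kernel_density m p q ;
  sd_cont : forall j, continuous (e j) ;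
  sd_ortho : forall i j, \int[m]_x (e i x * e j x) = (i == j)%:R ;
  sd_complete : forall f, bmeas f -> (fun n => \int[m]_x (f x -
    \sum_(0 <= j < n) (\int[m]_y (f y * e j y)) * e j x) ^+ 2) @ \oo --> (0 : R) ;
  sd_eigen : forall t j x, 0 <= t ->
    \int[p t x]_y e j y = expR (- lam j * t) * e j x ;
  sd_inj : injective lam ;
  sd_ge0 : forall j, 0 <= lam j ;
  sd_mono : forall j, lam j <= lam j.+1 ;
  sd_mass : forall t x, 0 <= t -> p t x setT = 1%E ;
  sd_feller : forall (f : E -> R) (eps : R), continuous f -> 0 < eps ->
    exists2 t : R, 0 < t & forall x, `|f x - \int[p t x]_y f y| <= eps }.

Hypothesis sd : spectral_data.

Let be j : bmeas (e j). Proof. exact/continuous_bmeas/sd_cont. Qed.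

Let coef (f : E -> R) j := \int[m]_y (f y * e j y).
Let partial (f : E -> R) n x := \sum_(0 <= j < n) coef f j * e j x.

Let bpartial f n : bmeas (partial f n).
Proof. by apply: bmeas_sum => j; exact: bmeasZ. Qed.

Lemma density_coef t x j : 0 < t ->
  \int[m]_y (q t x y * e j y) = expR (- lam j * t) * e j x.
Proof.
move=> t0; rewrite -(sd_eigen sd) ?ltW// (kernel_integral (sd_density sd))//.
by apply: eq_Rintegral => y _; rewrite mulrC.
Qed.

Lemma residual_norm f n : bmeas f ->
  \int[m]_x (f x - partial f n x) ^+ 2 =
  \int[m]_x f x ^+ 2 - \sum_(0 <= j < n) coef f j ^+ 2.
Proof.
move=> bf; elim: n => [|n IH].
  rewrite big_geq// subr0; apply: eq_Rintegral => x _.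
  by rewrite /partial big_geq// subr0.
rewrite big_nat_recr//= opprD addrA -IH.
pose h x := f x - partial f n x.
have bh : bmeas h by exact: bmeasB.
have he : \int[m]_x (h x * e n x) = coef f n.
  rewrite (_ : (fun x => _) = fun x => f x * e n x -
      \sum_(0 <= j < n) coef f j * (e j x * e n x)); last first.
    apply/funext => x; rewrite mulrBl; congr (_ - _).
    by rewrite mulr_suml; apply: eq_bigr => j _; rewrite mulrA.
  have bee j : bmeas (fun x => coef f j * (e j x * e n x)).
    by apply: bmeasZ; exact: bmeasM.
  rewrite bmeas_intB; [|exact: bmeasM|exact: bmeas_sum].
  rewrite bmeas_int_sum// big_nat_cond big1 ?subr0// => j /andP[/andP[_ jn] _].
  by rewrite bmeas_intZ ?sd_ortho ?(ltn_eqF jn) ?mulr0//; exact: bmeasM.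
have -> : (fun x => (f x - partial f n.+1 x) ^+ 2) = fun x =>
    h x ^+ 2 + (- (2 * coef f n) * (h x * e n x) + coef f n ^+ 2 * (e n x * e n x)).
  by apply/funext => x; rewrite /h /partial big_nat_recr//=; ring.
have bhe : bmeas (fun x => h x * e n x) by exact: bmeasM.
have bee : bmeas (fun x => e n x * e n x) by exact: bmeasM.
have bh2 : bmeas (fun x => h x ^+ 2) by exact: bmeasM.
rewrite bmeas_intD//; last by apply: bmeasD; exact: bmeasZ.
rewrite bmeas_intD; [|exact: bmeasZ|exact: bmeasZ].
rewrite !bmeas_intZ// he (sd_ortho sd) eqxx mulr1 /h; ring.
Qed.

Lemma bessel f n : bmeas f -> \sum_(0 <= j < n) coef f j ^+ 2 <= \int[m]_x f x ^+ 2.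
Proof.
move=> bf; rewrite -subr_ge0 -residual_norm//.
by apply: Rintegral_ge0 => x _; exact: sqr_ge0.
Qed.

(** Bessel's inequality for [q (t / 2) x], whose coefficients are
    [expR (- lam j * t / 2) * e j x]. *)
Lemma eigen_sum_bounded t : 0 < t -> exists2 B, 0 <= B &
  forall x n, \sum_(0 <= j < n) expR (- lam j * t) * e j x ^+ 2 <= B.
Proof.
move=> t0; have t20 : 0 < t / 2 by rewrite divr_gt0.
have [_ [M qM] _ _] := sd_density sd t20.
exists (M ^+ 2 * fine (m setT)); first by rewrite mulr_ge0 ?sqr_ge0 ?fine_ge0.
move=> x n; have bq := density_bmeas (sd_density sd) x t20.
apply: (le_trans _ (le_trans (bessel n bq) _)).
  apply: ler_sum => j _; rewrite /coef density_coef// exprMn -expRM_natl.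
  by rewrite mulr_natl (_ : _ *+ 2 = - lam j * t)// -mulrnAr -mulr_natr divfK.
rewrite (le_trans (ler_norm _))//; apply: bmeas_int_abs.
  by have [mq _] := bq; exact: measurable_funX.
by move=> y; rewrite normrX lerXn2r// ?nnegrE// (le_trans _ (qM x y)).
Qed.

(** The kernel maps [L^2] to bounded functions, so that the [L^2] expansion of
    [f] becomes uniform. *)
Lemma uniform_expansion t f (eps : R) : 0 < t -> bmeas f -> 0 < eps ->
  exists N, forall n x, (N <= n)%N ->
  `|\int[p t x]_y f y - \sum_(0 <= j < n) expR (- lam j * t) * coef f j * e j x| <= eps.
Proof.
move=> t0 bf eps0.
have [_ [M qM] _ _] := sd_density sd t0.
have M0 : 0 <= M by rewrite (le_trans _ (qM point point)).
set V := fine (m setT); have V0 : 0 <= V by exact: fine_ge0.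
have [del del0 delE] : exists2 del, 0 < del & del * (M * V) <= eps.
  have MV0 : 0 < 1 + M * V by rewrite ltr_wpDr// mulr_ge0.
  exists (eps / (1 + M * V)); first by rewrite divr_gt0.
  by rewrite mulrAC ler_pdivrMr// ler_wpM2l ?ltW// ltrDr.
have M1 : 0 < 1 + M by rewrite ltr_wpDr.
have eta0 : 0 < del * eps / (1 + M) by apply: divr_gt0 => //; exact: mulr_gt0.
have /cvgrPdist_le/(_ _ eta0)[N _ hN] := sd_complete sd bf.
exists N => n x Nn; pose h y := f y - partial f n y.
have bh : bmeas h by exact: bmeasB.
have bh2 : bmeas (fun y => h y ^+ 2) by exact: bmeasM.
have hn : \int[m]_y h y ^+ 2 <= del * eps / (1 + M).
  have := hN n Nn; rewrite /= sub0r normrN; exact: le_trans (ler_norm _).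
have -> : \int[p t x]_y f y - \sum_(0 <= j < n) expR (- lam j * t) * coef f j * e j x =
    \int[m]_y (h y * q t x y).
  rewrite -(kernel_integral (sd_density sd))// bmeas_intB//; congr (_ - _).
  rewrite bmeas_int_sum => [|j]; last exact: bmeasZ.
  apply: eq_bigr => j _; rewrite bmeas_intZ// (sd_eigen sd) ?ltW//; ring.
have bq := density_bmeas (sd_density sd) x t0.
rewrite (le_trans (le_normr_Rintegral _ (bmeas_integrable _ (bmeasM bh bq))))//.
have : \int[m]_y `|h y * q t x y| <=
    \int[m]_y (M * del / 2 + M / (2 * del) * h y ^+ 2).
  apply: bmeas_int_le; [exact/bmeas_norm/bmeasM| |].
    by apply: bmeasD; [exact: bmeas_cst|exact: bmeasZ].
  move=> y; rewrite normrM; apply: (@le_trans _ _ (`|h y| * M)).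
    by rewrite ler_wpM2l.
  have -> : M * del / 2 + M / (2 * del) * h y ^+ 2 =
      M * (del ^+ 2 + `|h y| ^+ 2) / (2 * del).
    by rewrite real_normK ?num_real//; field; rewrite gt_eqF.
  rewrite mulrC -mulrA ler_wpM2l// ler_pdivlMr ?mulr_gt0//.
  by have := sqr_ge0 (del - `|h y|); nra.
move=> /le_trans; apply; rewrite bmeas_intD; [|exact: bmeas_cst|exact: bmeasZ].
rewrite Rintegral_cst// bmeas_intZ// -/V.
have h1 : M * del / 2 * V <= eps / 2 by move: delE; nra.
have h2 : M / (2 * del) * \int[m]_y h y ^+ 2 <= eps / 2.
  apply: (@le_trans _ _ (M / (2 * del) * (del * eps / (1 + M)))).
    by rewrite ler_wpM2l// divr_ge0// mulr_ge0// ltW.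
  have -> : M / (2 * del) * (del * eps / (1 + M)) = eps / 2 * (M / (1 + M)).
    by field; rewrite !gt_eqF.
  rewrite ler_piMr ?divr_ge0 ?(ltW eps0)// ler_pdivrMr// mul1r.
  by rewrite lerDr.
by rewrite [eps]splitr lerD.
Qed.

Lemma kernel_integral_continuous t f : 0 < t -> bmeas f ->
  continuous (fun x => \int[p t x]_y f y).
Proof.
move=> t0 bf; apply: uniform_approx_continuous => eps eps0.
have [N hN] := uniform_expansion t0 bf eps0.
exists (fun x => \sum_(0 <= j < N) expR (- lam j * t) * coef f j * e j x).
  by apply: cont_sum => j; apply: contZ; exact: sd_cont.
by move=> x; exact: hN.
Qed.

Lemma semigroup_coef t f j : 0 < t -> bmeas f ->
  \int[m]_x ((\int[p t x]_y f y) * e j x) = expR (- lam j * t) * coef f j.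
Proof.
move=> t0 bf; apply/eqP; rewrite -subr_eq0 -normr_le0; apply/ler_gt0Pl => eps eps0.
have [_ [B eB]] := be j.
have B0 : 0 <= B by rewrite (le_trans _ (eB point)).
have V0 : 0 <= fine (m setT) by exact: fine_ge0.
have BV0 : 0 < 1 + B * fine (m setT) by rewrite ltr_wpDr// mulr_ge0.
have del0 : 0 < eps / (1 + B * fine (m setT)) by rewrite divr_gt0.
have [N hN] := uniform_expansion t0 bf del0.
pose n := maxn N j.+1.
pose S x := \sum_(0 <= k < n) expR (- lam k * t) * coef f k * e k x.
have bS : bmeas S by apply: bmeas_sum => k; exact: bmeasZ.
have bP : bmeas (fun x => \int[p t x]_y f y).
  by apply: continuous_bmeas => //; exact: kernel_integral_continuous.
have <- : \int[m]_x (S x * e j x) = expR (- lam j * t) * coef f j.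
  have -> : (fun x => S x * e j x) = fun x => \sum_(0 <= k < n)
      (expR (- lam k * t) * coef f k) * (e k x * e j x).
    by apply/funext => x; rewrite mulr_suml; apply: eq_bigr => k _; rewrite mulrA.
  rewrite bmeas_int_sum => [|k]; last by apply: bmeasZ; exact: bmeasM.
  have iE k : \int[m]_x (expR (- lam k * t) * coef f k * (e k x * e j x)) =
      expR (- lam k * t) * coef f k * (k == j)%:R.
    by rewrite bmeas_intZ ?(sd_ortho sd)//; exact: bmeasM.
  under eq_bigr do rewrite iE.
  have jn : (j < n)%N by rewrite leq_max ltnSn orbT.
  rewrite big_mkord (bigD1 (Ordinal jn))//= eqxx mulr1 big1 ?addr0// => k kj.
  rewrite (_ : (nat_of_ord k == j) = false) ?mulr0//.
  by apply: contraNF kj => /eqP kj; apply/eqP/val_inj.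
rewrite -bmeas_intB; [|exact: bmeasM|exact: bmeasM].
apply: (@le_trans _ _ (eps / (1 + B * fine (m setT)) * B * fine (m setT))).
  apply: bmeas_int_abs.
    by have [] := bmeasB (bmeasM bP (be j)) (bmeasM bS (be j)).
  move=> x; rewrite -mulrBl normrM ler_pM//.
  by apply: hN; rewrite leq_max leqnn.
by rewrite -mulrA mulrAC ler_pdivrMr// ler_wpM2l ?(ltW eps0)// lerDr.
Qed.

(** A function orthogonal to all eigenfunctions but one becomes a multiple of it
    under the semigroup, at every point and not only almost everywhere. *)
Lemma single_mode_expansion t f j z : 0 < t -> bmeas f ->
  (forall k, k != j -> coef f k = 0) ->
  \int[p t z]_y f y = expR (- lam j * t) * (coef f j * e j z).
Proof.
move=> t0 bf f0; apply/eqP; rewrite -subr_eq0 -normr_le0; apply/ler_gt0Pl => eps eps0.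
have [N hN] := uniform_expansion t0 bf eps0.
have := hN (maxn N j.+1) z (leq_maxl _ _).
have jn : (j < maxn N j.+1)%N by rewrite leq_max ltnSn orbT.
rewrite big_mkord (bigD1 (Ordinal jn))//= big1 => [|k kj].
  by rewrite addr0 mulrA.
by rewrite -/(coef f k) f0 ?mulr0 ?mul0r.
Qed.

(** Conservativity makes [1] an eigenfunction for the eigenvalue [0], which is
    thus the least one. *)
Lemma eigen_constant : lam 0%N = 0 /\ forall x y, e 0%N x = e 0%N y.
Proof.
have P1 x : \int[p 1 x]_y (1 : R) = 1.
  have mass : fine (p 1 x setT) = 1 by rewrite (sd_mass sd).
  by rewrite Rintegral_cst// mul1r; exact: mass.
have b1 : bmeas (fun _ : E => 1 : R) by exact: bmeas_cst.
pose c := coef (fun=> 1).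
have c_eq j : c j != 0 -> lam j = 0.
  move=> cj; have := semigroup_coef j ltr01 b1.
  under eq_Rintegral do rewrite P1.
  rewrite -/(coef (fun=> 1) j) -/(c j) mulr1 -{1}[c j]mul1r => /(mulIf cj).
  by rewrite -{1}(expR0 R) => /expR_inj/esym/eqP; rewrite oppr_eq0 => /eqP.
have [j cj] : exists j, c j != 0.
  apply/not_existsP => c0; have {}c0 j : c j = 0.
    by apply/eqP/negP => cj; apply: (c0 j); exact/negP.
  have := sd_complete sd b1.
  rewrite (_ : (fun n => _) = fun=> fine (m setT)) => [h|]; last first.
    apply/funext => n; rewrite -[RHS]mul1r -Rintegral_cst//.
    apply: eq_Rintegral => x _; rewrite big1 ?subr0 ?expr1n// => j _.
    by rewrite -/(coef (fun=> 1) j) -/(c j) c0 mul0r.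
  have m0 : fine (m setT) = 0.
    by apply: (cvg_unique _ _ h); [exact: norm_hausdorff|exact: cvg_cst].
  have [_ [M eM]] := be 0%N.
  have := sd_ortho sd 0%N 0%N; rewrite eqxx => h1.
  have : `|\int[m]_x (e 0%N x * e 0%N x)| <= M * M * fine (m setT).
    apply: bmeas_int_abs; first by have [] := bmeasM (be 0%N) (be 0%N).
    by move=> x; rewrite normrM ler_pM.
  by rewrite h1 m0 mulr0 normr1 ler10.
have lam0 : lam 0%N = 0.
  apply/eqP; rewrite eq_le (sd_ge0 sd) andbT -(c_eq j cj).
  by elim: (j) => // k IH; rewrite (le_trans IH)// (sd_mono sd).
split=> // x y.
have ck k : k != 0%N -> coef (fun=> 1) k = 0.
  move=> k0; apply/eqP; apply: contraNT k0 => /c_eq lk.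
  by apply/eqP/(sd_inj sd); rewrite lk lam0.
have e0E z : 1 = coef (fun=> 1) 0%N * e 0%N z.
  have := single_mode_expansion z ltr01 b1 ck.
  by rewrite P1 lam0 oppr0 mul0r expR0 mul1r.
have c00 : coef (fun=> 1) 0%N != 0.
  by apply/eqP => c0; have := e0E x; rewrite c0 mul0r => /eqP; rewrite oner_eq0.
by apply: (mulfI c00); rewrite -!e0E.
Qed.

Lemma spectral_strong_feller : strong_feller p.
Proof.
move=> t f t0 /bm_bmeas[rf jf]; apply: ccont_Cb => //; apply/ccont_ReIm.
by split; exact: kernel_integral_continuous.
Qed.

Lemma eigen_dense (f : E -> R) (eps : R) : continuous f -> 0 < eps ->
  exists (c : nat -> R) N, forall n x, (N <= n)%N ->
  `|f x - \sum_(0 <= j < n) c j * e j x| <= eps.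
Proof.
move=> cf eps0; have eps20 : 0 < eps / 2 by rewrite divr_gt0.
have [t t0 ft] := sd_feller sd cf eps20.
have [N hN] := uniform_expansion t0 (continuous_bmeas E_compact cf) eps20.
exists (fun j => expR (- lam j * t) * coef f j), N => n x Nn.
have -> (S : R) : f x - S = (f x - \int[p t x]_y f y) + (\int[p t x]_y f y - S).
  by ring.
by rewrite (le_trans (ler_normD _ _))// [eps]splitr lerD// hN.
Qed.

Lemma eigen_dense_complex (f : E -> R[i]) (eps : R) : continuous f -> 0 < eps ->
  exists (c : nat -> R[i]) N, forall n x, (N <= n)%N ->
  normc (f x - \sum_(0 <= j < n) c j * (e j x)%:C) <= eps.
Proof.
move=> /ccont_ReIm[cr ci] eps0; have eps20 : 0 < eps / 2 by rewrite divr_gt0.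
have [a [N hN]] := eigen_dense cr eps20; have [b [K hK]] := eigen_dense ci eps20.
exists (fun j => a j +i* b j), (maxn N K) => n x; rewrite geq_max => /andP[Nn Kn].
rewrite (le_trans (normc_le_ReIm _))// [eps]splitr lerD//.
- rewrite cReD cReN raddf_sum/= (eq_bigr (fun j => a j * e j x)); first exact: hN.
  by move=> j _; rewrite mulr0 subr0.
- rewrite cImD cImN raddf_sum/= (eq_bigr (fun j => b j * e j x)); first exact: hK.
  by move=> j _; rewrite mulr0 add0r.
Qed.

(** Continuous functions determine complex measures, and finite combinations of
    eigenfunctions are dense among them. *)
Lemma cmeasure_eigen_eq (mu nu : cmeasure E R) :
  (forall j, cmeasure_integral mu (fun x => (e j x)%:C) =
    cmeasure_integral nu (fun x => (e j x)%:C)) -> mu = nu.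
Proof.
move=> munu; apply: (cmeasure_eqP E_compact) => f cf.
have [bmu bnu] := (bfun_cmeasure mu, bfun_cmeasure nu).
have [C C0 hC] := bfun_bound bmu; have [D D0 hD] := bfun_bound bnu.
apply/eqP; rewrite -subr_eq0; apply/eqP/normc_eq0/eqP.
rewrite eq_le normc_ge0 andbT; apply/ler_addgt0Pl => eps eps0; rewrite addr0.
have CD : 0 < 1 + C + D by rewrite ltr_wpDr// ltr_wpDr.
have del0 : 0 < eps / (1 + C + D) by rewrite divr_gt0.
have [c [N hN]] := eigen_dense_complex (ccont_real cf) del0.
set g := fun x => \sum_(0 <= j < N) c j * (e j x)%:C.
have bej j : bounded_measurable (fun x => (e j x)%:C : R[i]).
  by apply: bm_cont => //; exact: sd_cont.
have bg : bounded_measurable g by apply: bm_sum => j; exact: bmZ.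
have bfC : bounded_measurable (fun x => (f x)%:C : R[i]) by exact: bm_cont.
have gE : cmeasure_integral mu g = cmeasure_integral nu g.
  rewrite (bfun_sum bmu) => [|j]; last exact: bmZ.
  rewrite (bfun_sum bnu) => [|j]; last exact: bmZ.
  by apply: eq_bigr => j _; rewrite (bfunZ bmu)// (bfunZ bnu)// munu.
have -> : cmeasure_integral mu (fun x => (f x)%:C) - cmeasure_integral nu (fun x => (f x)%:C)
  = cmeasure_integral mu (fun x => (f x)%:C - g x) -
    cmeasure_integral nu (fun x => (f x)%:C - g x).
  by rewrite (bfunB bmu)// (bfunB bnu)// gE; ring.
have bfg : bounded_measurable (fun x => (f x)%:C - g x) by exact: bmB.
rewrite (le_trans (normcD _ _))// normcN.
apply: (le_trans (lerD (hC _ _ bfg (hN N ^~ (leqnn N))) (hD _ _ bfg (hN N ^~ (leqnn N))))).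
rewrite -mulrDl mulrCA ler_piMr ?(ltW eps0)// ltW// ltr_pdivrMr// mul1r.
by rewrite -addrA ltrDr.
Qed.

End spectral_data.

(** * Construction of the convolution *)

Lemma tvnorm_of_le {d : measure_display} {T : measurableType d} {R : realType}
  (rho : {finite_measure set T -> \bar R}) :
  (tvnorm (cmeasure_of rho) <= (fine (rho setT))%:E)%E.
Proof.
apply: ge_ereal_sup => _ [n [F [mF tF FT ->]]]; rewrite lee_fin.
rewrite -(sum_measure_partition rho mF tF FT).
apply: ler_sum => i _.
have -> : cmeasure_of rho (F i) = (fine (rho (F i)))%:C by rewrite /= mem_set.
by rewrite normcR ger0_norm// fine_ge0.
Qed.

Lemma cmeasure_probability_of {d : measure_display} {T : measurableType d}
  {R : realType} (mu : cmeasure T R) : cmeasure_probability mu ->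
  exists rho : {finite_measure set T -> \bar R}, mu = cmeasure_of rho.
Proof.
move=> [mu0 _].
have pos A : (0 <= re_charge mu A)%E.
  have [mA|nmA] := pselect (measurable A); rewrite /re_charge lee_fin.
    by have := mu0 A mA; case: (mu A) => x y; rewrite lecE/= => /andP[].
  by rewrite cmeasure_nonmeasurable.
have fin : fin_num_fun (measure_of_charge _ pos) by [].
pose rho : {finite_measure set T -> \bar R} := HB.pack (measure_of_charge _ pos)
  (@Measure_isFinite.Build _ _ _ (measure_of_charge _ pos) fin).
exists rho; apply: cmeasureP => A mA; apply: eqc; rewrite /= mem_set//=.
by have := mu0 A mA; case: (mu A) => x y; rewrite lecE/= => /andP[/eqP ->].
Qed.

Lemma unit_ball_scale {d : measure_display} {R : realType} {E : borelMetricType d R}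
    (rho : cmeasure E R) (C D : R) (g : E -> R[i]) : compact [set: E] -> 0 < D ->
  (forall f, continuous f -> (forall x, normc (f x) <= 1) ->
    normc (cmeasure_integral rho f) <= C) ->
  continuous g -> (forall x, normc (g x) <= D) ->
  normc (cmeasure_integral rho g) <= D * C.
Proof.
move=> cE D0 rhoC cg gD.
have cg' := ccontZ (c := (D^-1)%:C) cg.
have Dn : normc (D^-1)%:C = D^-1 :> R by rewrite normcR gtr0_norm// invr_gt0.
have bg := ccont_bm cE cg.
have : normc (cmeasure_integral rho (fun x => (D^-1)%:C * g x)) <= C.
  apply: (rhoC _ cg') => x.
  by rewrite normcM Dn (ler_pdivrMl _ _ D0) mulr1; exact: gD.
by rewrite (bfunZ (bfun_cmeasure rho) _ bg) normcM Dn (ler_pdivrMl _ _ D0).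
Qed.

Section convolution.
Context {d : measure_display} {R : realType} {E : borelMetricType d R}.
Hypothesis E_compact : compact [set: E].
Variable m : {finite_measure set E -> \bar R}.
Variable p : R -> E -> {finite_measure set E -> \bar R}.
Variable q : R -> E -> E -> R.
Variables (lam : nat -> R) (e : nat -> E -> R).
Hypothesis sd : spectral_data m p q lam e.
Variable a : E.
Hypothesis ea0 : forall j, e j a != 0.
Hypothesis ea_max : forall j x, `|e j x| <= `|e j a|.

Let phi j x := e j x / e j a.

Hypothesis phi_positive : forall t x y xi, 0 < t -> exists2 s : R, 0 <= s &
  (fun n => \sum_(0 <= j < n) e j a ^+ 2 * expR (- lam j * t)
    * phi j x * phi j y * phi j xi) @ \oo --> s.

Let cphi j : continuous (phi j).
Proof.
have -> : phi j = fun x => (e j a)^-1 * e j x by apply/funext => x; rewrite mulrC.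
exact/contZ/(sd_cont sd).
Qed.

Let bphi j : bmeas (phi j). Proof. exact: continuous_bmeas. Qed.

Let bphiC j : bounded_measurable (fun x => (phi j x)%:C : R[i]).
Proof. exact: bm_real. Qed.

Let eE j x : e j x = e j a * phi j x.
Proof. by rewrite /phi mulrC divfK. Qed.

Let phi0 x : phi 0 x = 1.
Proof. by rewrite /phi ((eigen_constant E_compact sd).2 x a) divff. Qed.

Let phia j : phi j a = 1. Proof. by rewrite /phi divff. Qed.

Let phi_le1 j x : `|phi j x| <= 1.
Proof. by rewrite /phi normrM normfV ler_pdivrMr ?normr_gt0// mul1r. Qed.

Let phi_dense (f : E -> R) (eps : R) : continuous f -> 0 < eps ->
  exists (c : nat -> R) N, forall x, `|f x - \sum_(0 <= j < N) c j * phi j x| <= eps.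
Proof.
move=> cf eps0; have [c [N hN]] := eigen_dense E_compact sd cf eps0.
exists (fun j => c j * e j a), N => x; apply: le_trans (hN N x (leqnn N)).
by under eq_bigr do rewrite -mulrA -eE.
Qed.

Let phi_dense_complex (f : E -> R[i]) (eps : R) : continuous f -> 0 < eps ->
  exists (c : nat -> R[i]) N, forall x,
  normc (f x - \sum_(0 <= j < N) c j * (phi j x)%:C) <= eps.
Proof.
move=> cf eps0; have [c [N hN]] := eigen_dense_complex E_compact sd cf eps0.
exists (fun j => c j * (e j a)%:C), N => x; apply: le_trans (hN N x (leqnn N)).
by under eq_bigr do rewrite -mulrA -rmorphM/= -eE.
Qed.

(** This density is the sum of the series of the positivity condition. The measures
    it defines converge to the product of the Dirac measures at [x] and [y] as [t]
    tends to [0]. *)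
Let product_density x y t : 0 < t -> exists s : E -> R, [/\ bmeas s,
  forall xi, 0 <= s xi &
  forall k, \int[m]_xi (phi k xi * s xi) = expR (- lam k * t) * (phi k x * phi k y)].
Proof.
move=> t0.
have /choice[s sP] xi : exists s : R, 0 <= s /\
  (fun n => \sum_(0 <= j < n) e j a ^+ 2 * expR (- lam j * t)
    * phi j x * phi j y * phi j xi) @ \oo --> s.
  by have [s s0 ss] := phi_positive x y xi t0; exists s.
pose S n xi := \sum_(0 <= j < n) e j a ^+ 2 * expR (- lam j * t)
    * phi j x * phi j y * phi j xi.
have bS n : bmeas (S n) by apply: bmeas_sum => j; exact: bmeasZ.
have [B B0 hB] := eigen_sum_bounded E_compact sd t0.
have SB n xi : `|S n xi| <= B.
  rewrite (le_trans (ler_norm_sum _ _ _))//; apply: le_trans (hB a n).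
  apply: ler_sum => j _; set w := expR _ * _.
  have w0 : 0 <= w by rewrite mulr_ge0 ?expR_ge0 ?sqr_ge0.
  rewrite (_ : _ * _ = w * (phi j x * phi j y * phi j xi)); last by rewrite /w; ring.
  rewrite normrM ger0_norm // ler_piMr // (normrM (_ * phi j y)) (normrM (phi j x)).
  by rewrite mulr_ile1 ?mulr_ge0 ?phi_le1 ?mulr_ile1 ?phi_le1.
exists s; split.
- by have [] := @bounded_convergence _ _ _ m S s B (fun n => (bS n).1) SB (fun xi => (sP xi).2).
- by move=> xi; have [] := sP xi.
move=> k.
have bkS n : bmeas (fun xi => phi k xi * S n xi) by exact: bmeasM.
have [|||_] := @bounded_convergence _ _ _ m (fun n xi => phi k xi * S n xi)
    (fun xi => phi k xi * s xi) B.
- by move=> n; have [] := bkS n.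
- by move=> n xi; rewrite normrM -[B]mul1r ler_pM.
- by move=> xi; apply: cvgMr; have [] := sP xi.
have intS n : (k < n)%N ->
    \int[m]_xi (phi k xi * S n xi) = expR (- lam k * t) * (phi k x * phi k y).
  move=> kn.
  have -> : (fun xi => phi k xi * S n xi) = fun xi => \sum_(0 <= j < n)
      (e j a ^+ 2 * expR (- lam j * t) * phi j x * phi j y / (e k a * e j a)) *
      (e k xi * e j xi).
    apply/funext => xi; rewrite /S mulr_sumr; apply: eq_bigr => j _.
    by rewrite /phi; field; rewrite !ea0.
  rewrite bmeas_int_sum => [|j]; last first.
    by apply: bmeasZ; apply: bmeasM; apply: continuous_bmeas => //; exact: (sd_cont sd).
  have iE j : \int[m]_xi ((e j a ^+ 2 * expR (- lam j * t) * phi j x * phi j y /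
      (e k a * e j a)) * (e k xi * e j xi)) = (e j a ^+ 2 * expR (- lam j * t)
      * phi j x * phi j y / (e k a * e j a)) * (k == j)%:R.
    rewrite bmeas_intZ ?(sd_ortho sd)//.
    by apply: bmeasM; apply: continuous_bmeas => //; exact: (sd_cont sd).
  under eq_bigr do rewrite iE.
  rewrite big_mkord (bigD1 (Ordinal kn))//= eqxx mulr1 big1 ?addr0; last first.
    move=> j jk; rewrite (_ : (k == j) = false) ?mulr0//.
    by apply: contraNF jk => /eqP kj; apply/eqP/val_inj.
  by field; rewrite ea0.
move=> cS; apply: (cvg_unique _ cS); first exact: norm_hausdorff.
apply: cvg_near_cst; exists k.+1 => // n /= kn; exact: intS.
Qed.

(** On each [phi k] the integrals against the densities at time [1 / n] converge,
    hence on every continuous function by density; the limit is a positive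
    functional and the representation theorem yields the measure. *)
Let product_dirac x y : exists K : {finite_measure set E -> \bar R},
  fine (K setT) = 1 /\ forall j, \int[K]_xi phi j xi = phi j x * phi j y.
Proof.
have tn0 n : 0 < n.+1%:R^-1 :> R by rewrite invr_gt0.
have /choice[s sP] n := product_density x y (tn0 n).
pose L n (f : E -> R) := \int[m]_xi (f xi * s n xi).
have bs n : bmeas (s n) by have [] := sP n.
have LD n f g : bmeas f -> bmeas g -> L n (fun x => f x + g x) = L n f + L n g.
  move=> bf bg; rewrite /L -bmeas_intD; [|exact: bmeasM|exact: bmeasM].
  by apply: eq_Rintegral => xi _; rewrite mulrDl.
have LZ n (c : R) f : bmeas f -> L n (fun x => c * f x) = c * L n f.
  move=> bf; rewrite /L -bmeas_intZ; last exact: bmeasM.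
  by apply: eq_Rintegral => xi _; rewrite mulrA.
have L_ge0 n f : (forall xi, 0 <= f xi) -> 0 <= L n f.
  move=> f0; apply: Rintegral_ge0 => xi _; rewrite mulr_ge0//.
  by have [] := sP n.
have Lphi n k : L n (phi k) = expR (- lam k * n.+1%:R^-1) * (phi k x * phi k y).
  by have [_ _ h] := sP n; exact: h.
have L1 n : L n (fun=> 1) = 1.
  rewrite (_ : (fun=> 1) = phi 0); last by apply/funext => xi; rewrite phi0.
  by rewrite Lphi (eigen_constant E_compact sd).1 oppr0 mul0r expR0 !phi0 !mul1r.
have L_abs n f (M : R) : bmeas f -> (forall xi, `|f xi| <= M) -> `|L n f| <= M.
  move=> bf fM; have bM : bmeas (fun _ : E => M) by exact: bmeas_cst.
  have LM : L n (fun=> M) = M.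
    by rewrite -[RHS]mulr1 -(L1 n) -LZ; [congr (L n); apply/funext => xi; rewrite mulr1|exact: bmeas_cst].
  rewrite ler_norml; apply/andP; split.
    rewrite -subr_ge0 opprK addrC -[X in X + _]LM -LD//; apply: L_ge0 => xi.
    by rewrite addrC -lerBlDr sub0r; have := fM xi; rewrite ler_norml => /andP[].
  rewrite -subr_ge0 -[X in X - _]LM -[- _]mulN1r -LZ// -LD//; last exact: bmeasZ.
  apply: L_ge0 => xi; rewrite mulN1r subr_ge0.
  by have := fM xi; rewrite ler_norml => /andP[].
have Lphi_cvg k : (fun n => L n (phi k)) @ \oo --> phi k x * phi k y.
  under eq_fun do rewrite Lphi.
  have h : (fun n => - lam k * n.+1%:R^-1) @ \oo --> (0 : R).
    by rewrite -(mulr0 (- lam k)); apply: cvgMr; exact: cvg_harmonic.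
  have h' : (fun n => expR (- lam k * n.+1%:R^-1)) @ \oo --> (1 : R).
    by have := cvg_comp _ _ h (@continuous_expR R 0); rewrite expR0.
  have h2 : (fun n => expR (- lam k * n.+1%:R^-1) * (phi k x * phi k y)) @ \oo -->
      1 * (phi k x * phi k y) by apply: cvgM => //; exact: cvg_cst.
  by rewrite mul1r in h2.
have Lcvg f : continuous f -> cvgn (L ^~ f).
  move=> cf; apply: cauchy_seq_cvg => eps eps0.
  have eps40 : 0 < eps / 4 by rewrite divr_gt0.
  have [c [N hN]] := phi_dense cf eps40.
  pose g xi := \sum_(0 <= j < N) c j * phi j xi.
  have bg : bmeas g by apply: bmeas_sum => j; exact: bmeasZ.
  have bf := continuous_bmeas E_compact cf.
  have Lg : (fun n => L n g) @ \oo --> \sum_(0 <= j < N) c j * (phi j x * phi j y).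
    rewrite (_ : (fun n => L n g) = fun n => \sum_(0 <= j < N) c j * L n (phi j)).
      by apply: cvg_finite_sum => j; exact: cvgMr.
    apply/funext => n; rewrite /g; elim: (index_iota 0 N) => [|j r IH].
      rewrite big_nil (_ : (fun xi => _) = fun xi => 0 * 1).
        by rewrite (LZ n 0 (fun=> 1)) ?mul0r//; exact: bmeas_cst.
      by apply/funext => xi; rewrite big_nil mul0r.
    rewrite big_cons -IH -LZ// -LD; [|exact: bmeasZ|].
      by congr (L n); apply/funext => xi; rewrite big_cons.
    by apply: bmeas_sum => i; exact: bmeasZ.
  have /cvgrPdist_le/(_ _ eps40)[N' _ hN'] := Lg.
  have Lfg n : `|L n f - L n g| <= eps / 4.
    have -> : L n f - L n g = L n (fun xi => f xi + -1 * g xi).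
      by rewrite LD//; [rewrite LZ// mulN1r|exact: bmeasZ].
    apply: L_abs; first by apply: bmeasD => //; exact: bmeasZ.
    by move=> xi; rewrite mulN1r.
  exists N' => n k nN' kN'; have := hN' n nN'; have := hN' k kN'; rewrite /=.
  have := Lfg n; have := Lfg k; rewrite !ler_norml; lra.
have [f g cf cg|c f cf|f cf f0|K KP] :=
    @riesz_representation _ _ _ E_compact (fun f => limn (L ^~ f)).
- apply: cvg_lim => //.
  have -> : (fun n => L n (fun x => f x + g x)) = fun n => L n f + L n g.
    by apply/funext => n; rewrite LD//; exact: continuous_bmeas.
  exact: (cvgD (Lcvg f cf) (Lcvg g cg)).
- apply: cvg_lim => //.
  have -> : (fun n => L n (fun x => c * f x)) = fun n => c * L n f.
    by apply/funext => n; rewrite LZ//; exact: continuous_bmeas.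
  by have h := Lcvg f cf; apply: cvgM => //; exact: cvg_cst.
- have h := Lcvg f cf; apply: (cvgr_to_ge h).
  by apply: nearW => n; exact: L_ge0.
exists K; split.
  have <- : \int[K]_xi 1 = fine (K setT) by rewrite Rintegral_cst// mul1r.
  rewrite KP; last exact: cont_cst.
  by under eq_fun do rewrite L1; exact: lim_cst.
by move=> j; rewrite KP//; apply: cvg_lim.
Qed.

Let delta_exists : exists K : E -> E -> {finite_measure set E -> \bar R},
  forall x y, fine (K x y setT) = 1 /\
  forall j, \int[K x y]_xi phi j xi = phi j x * phi j y.
Proof.
have /choice[K KP] (xy : E * E) := product_dirac xy.1 xy.2.
by exists (fun x y => K (x, y)) => x y; exact: (KP (x, y)).
Qed.

(** Integrating the products of Dirac measures in both variables defines a positive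
    functional on continuous functions. *)
Let product_positive (mu nu : {finite_measure set E -> \bar R}) :
  exists kappa : {finite_measure set E -> \bar R},
  forall j, \int[kappa]_x phi j x = (\int[mu]_x phi j x) * (\int[nu]_x phi j x).
Proof.
have [K KP] := delta_exists.
pose G f y x := \int[K x y]_xi f xi.
have bsum (c : nat -> R) N : bmeas (fun x => \sum_(0 <= j < N) c j * phi j x).
  by apply: bmeas_sum => j; exact: bmeasZ.
have Gsum (c : nat -> R) N x y : \int[K x y]_xi \sum_(0 <= j < N) c j * phi j xi =
    \sum_(0 <= j < N) (c j * phi j y) * phi j x.
  rewrite bmeas_int_sum => [|j]; last exact: bmeasZ.
  apply: eq_bigr => j _; rewrite bmeas_intZ//.
  by have [_ ->] := KP x y; ring.
have Gclose f eps (c : nat -> R) N y x : continuous f ->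
    (forall x, `|f x - \sum_(0 <= j < N) c j * phi j x| <= eps) ->
    `|G f y x - \sum_(0 <= j < N) (c j * phi j y) * phi j x| <= eps.
  move=> cf fc; rewrite /G -Gsum -bmeas_intB//; last exact: continuous_bmeas.
  rewrite -[eps]mulr1; have [<- _] := KP x y; apply: bmeas_int_abs => //.
  by have [] := bmeasB (continuous_bmeas E_compact cf) (bsum c N).
have cG f y : continuous f -> continuous (G f y).
  move=> cf; apply: uniform_approx_continuous => eps eps0.
  have [c [N hN]] := phi_dense cf eps0.
  exists (fun x => \sum_(0 <= j < N) (c j * phi j y) * phi j x).
    by apply: cont_sum => j; exact: contZ.
  by move=> x; exact: Gclose.
have bG f y : continuous f -> bmeas (G f y).
  by move=> cf; apply: continuous_bmeas => //; exact: cG.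
pose H f y := \int[mu]_x G f y x.
have cH f : continuous f -> continuous (H f).
  move=> cf; apply: uniform_approx_continuous => eps eps0.
  have V0 : 0 <= fine (mu setT) by exact: fine_ge0.
  have V1 : 0 < 1 + fine (mu setT) by rewrite ltr_wpDr.
  have del0 : 0 < eps / (1 + fine (mu setT)) by rewrite divr_gt0.
  have [c [N hN]] := phi_dense cf del0.
  exists (fun y => \sum_(0 <= j < N) (c j * \int[mu]_x phi j x) * phi j y).
    by apply: cont_sum => j; exact: contZ.
  move=> y.
  have -> : \sum_(0 <= j < N) (c j * \int[mu]_x phi j x) * phi j y =
      \int[mu]_x \sum_(0 <= j < N) (c j * phi j y) * phi j x.
    rewrite bmeas_int_sum => [|j]; last exact: bmeasZ.
    by apply: eq_bigr => j _; rewrite bmeas_intZ//; ring.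
  have bs : bmeas (fun x => \sum_(0 <= j < N) (c j * phi j y) * phi j x).
    by apply: bmeas_sum => j; exact: bmeasZ.
  rewrite /H -bmeas_intB//; last exact: bG.
  apply: (@le_trans _ _ (eps / (1 + fine (mu setT)) * fine (mu setT))).
    apply: bmeas_int_abs; first by have [] := bmeasB (bG _ y cf) bs.
    by move=> x; exact: Gclose.
  by rewrite mulrAC ler_pdivrMr// ler_wpM2l ?(ltW eps0)// lerDr.
have bH f : continuous f -> bmeas (H f).
  by move=> cf; apply: continuous_bmeas => //; exact: cH.
have cb f := @continuous_bmeas _ _ _ E_compact f.
have [f g cf cg|c f cf|f cf f0|kappa kP] :=
    @riesz_representation _ _ _ E_compact (fun f => \int[nu]_y H f y).
- rewrite -bmeas_intD; [|exact: bH|exact: bH]; apply: eq_Rintegral => y _.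
  rewrite /H -bmeas_intD; [|exact: bG|exact: bG]; apply: eq_Rintegral => x _.
  by rewrite /G bmeas_intD//; exact: cb.
- rewrite -bmeas_intZ; last exact: bH; apply: eq_Rintegral => y _.
  rewrite /H -bmeas_intZ; last exact: bG; apply: eq_Rintegral => x _.
  by rewrite /G bmeas_intZ//; exact: cb.
- by do 3 (apply: Rintegral_ge0 => ? _).
exists kappa => j; rewrite kP//.
have -> : H (phi j) = fun y => (\int[mu]_x phi j x) * phi j y.
  apply/funext => y; rewrite /H mulrC -bmeas_intZ//; apply: eq_Rintegral => x _.
  by rewrite /G; have [_ ->] := KP x y; rewrite mulrC.
by rewrite bmeas_intZ.
Qed.

Local Notation I mu j := (cmeasure_integral mu (fun x => (phi j x)%:C)).

Let is_product (mu nu kappa : cmeasure E R) := forall j, I kappa j = I mu j * I nu j.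

Let is_productC mu nu kappa : is_product mu nu kappa -> is_product nu mu kappa.
Proof. by move=> h j; rewrite h mulrC. Qed.

Let is_product_of mu nu : exists kappa : {finite_measure set E -> \bar R},
  is_product (cmeasure_of mu) (cmeasure_of nu) (cmeasure_of kappa).
Proof.
have [kappa kP] := product_positive mu nu; exists kappa => j.
by rewrite !cmeasure_integral_of// !cintegral_real kP rmorphM.
Qed.

Let is_product_lincomb mu mu' nu (c : R[i]) : (exists kappa, is_product mu nu kappa) ->
  (exists kappa, is_product mu' nu kappa) ->
  exists kappa, is_product (c *: mu + mu') nu kappa.
Proof.
move=> [k kP] [k' k'P]; exists (c *: k + k') => j.
by rewrite !cmeasure_integralD// !cmeasure_integralZ// kP k'P; ring.
Qed.

(** By bilinearity, as complex measures are combinations of positive ones. *)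
Let is_product_exists mu nu : exists kappa, is_product mu nu kappa.
Proof.
have half rho nu' : exists kappa, is_product (cmeasure_of rho) nu' kappa.
  have [b1 [b2 [b3 [b4 ->]]]] := cmeasure_lincomb nu'.
  have P b : exists kappa, is_product (cmeasure_of b) (cmeasure_of rho) kappa.
    by have [k kP] := is_product_of b rho; exists (cmeasure_of k).
  suff [k kP] : exists kappa, is_product (cmeasure_of b1 - cmeasure_of b2 +
      'i *: (cmeasure_of b3 - cmeasure_of b4)) (cmeasure_of rho) kappa.
    by exists k; exact: is_productC.
  rewrite addrC; apply: is_product_lincomb; rewrite addrC -scaleN1r;
    exact: is_product_lincomb.
have [b1 [b2 [b3 [b4 ->]]]] := cmeasure_lincomb mu.
rewrite addrC; apply: is_product_lincomb; rewrite addrC -scaleN1r;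
  exact: is_product_lincomb.
Qed.

Let phi_eq (mu nu : cmeasure E R) : (forall j, I mu j = I nu j) -> mu = nu.
Proof.
move=> munu; apply: (cmeasure_eigen_eq E_compact sd) => j.
have -> : (fun x => (e j x)%:C) = fun x => (e j a)%:C * (phi j x)%:C :> R[i].
  by apply/funext => x; rewrite eE rmorphM.
by rewrite (bfunZ (bfun_cmeasure mu) _ (bphiC j)) (bfunZ (bfun_cmeasure nu) _ (bphiC j)) munu.
Qed.

(** The bound is inherited from the products of Dirac measures, which are
    probability measures. *)
Let product_bound mu nu kappa (A B : R) : is_product mu nu kappa -> 0 <= A -> 0 <= B ->
  (forall f, continuous f -> (forall x, normc (f x) <= 1) ->
    normc (cmeasure_integral mu f) <= A) ->
  (forall f, continuous f -> (forall x, normc (f x) <= 1) ->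
    normc (cmeasure_integral nu f) <= B) ->
  forall f (M : R), 0 < M -> continuous f -> (forall x, normc (f x) <= M) ->
    normc (cmeasure_integral kappa f) <= M * (A * B).
Proof.
move=> kP A0 B0 muA nuB f M M0 cf fM.
have [K KP] := delta_exists.
have [[bmu bnu] bk] := (bfun_cmeasure mu, bfun_cmeasure nu, bfun_cmeasure kappa).
have scale rho C D g := @unit_ball_scale _ _ _ rho C D g E_compact.
have [C C0 hC] := bfun_bound bk.
apply/ler_addgt0Pr => eps eps0.
have AB0 : 0 < 1 + (C + A * B) by rewrite ltr_wpDr// addr_ge0// mulr_ge0.
have [del del0 delE] : exists2 del, 0 < del & del * (C + A * B) <= eps.
  exists (eps / (1 + (C + A * B))); first by rewrite divr_gt0.
  by rewrite mulrAC ler_pdivrMr// ler_wpM2l ?(ltW eps0)// lerDr.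
have [c [N hN]] := phi_dense_complex cf del0.
pose g x := \sum_(0 <= j < N) c j * (phi j x)%:C.
have bcphi j : bounded_measurable (fun x => c j * (phi j x)%:C) by exact: bmZ.
have bg : bounded_measurable g by exact: bm_sum.
have bfC := ccont_bm E_compact cf.
have gM x : normc (g x) <= M + del.
  have -> : g x = f x - (f x - g x) by rewrite opprB addrC subrK.
  by rewrite (le_trans (normcD _ _))// normcN lerD.
have Md : 0 < M + del by rewrite addr_gt0.
pose G y x := \sum_(0 <= j < N) (c j * (phi j y)%:C) * (phi j x)%:C.
have CM (w : R[i]) (u v : R) : w * v%:C * u%:C = w * (u * v)%:C.
  by rewrite rmorphM -mulrA [v%:C * _]mulrC.
have GE y x : G y x = cmeasure_integral (cmeasure_of (K x y)) g.
  rewrite (bfun_sum (bfun_cmeasure _))//; apply: eq_bigr => j _.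
  rewrite (bfunZ (bfun_cmeasure _))// cmeasure_integral_of// cintegral_real.
  by have [_ ->] := KP x y; rewrite CM.
have GM y x : normc (G y x) <= M + del.
  rewrite GE -[leRHS]mulr1; apply: normc_integral_le => //.
  by have [<- _] := KP x y; exact: tvnorm_of_le.
have cG y : continuous (G y).
  apply: ccont_sum => j; apply: ccontZ; exact: ccont_real.
pose H y := \sum_(0 <= j < N) (c j * I mu j) * (phi j y)%:C.
have HE y : H y = cmeasure_integral mu (G y).
  rewrite (bfun_sum bmu) => [|j]; last exact: bmZ.
  by apply: eq_bigr => j _; rewrite (bfunZ bmu)//; ring.
have cH : continuous H.
  apply: ccont_sum => j; apply: ccontZ; exact: ccont_real.
have HM y : normc (H y) <= (M + del) * A.
  rewrite HE; exact: (scale mu A (M + del) (G y) Md muA (cG y) (GM y)).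
have kg : normc (cmeasure_integral kappa g) <= (M + del) * (A * B).
  have -> : cmeasure_integral kappa g = cmeasure_integral nu H.
    rewrite (bfun_sum bk)// (bfun_sum bnu) => [|j]; last exact: bmZ.
    by apply: eq_bigr => j _; rewrite (bfunZ bk)// (bfunZ bnu)// kP; ring.
  have [A00|An0] := eqVneq A 0.
    have -> : H = fun=> 0.
      apply/funext => y; apply/normc_eq0/eqP; rewrite eq_le normc_ge0 andbT HE.
      by have := HM y; rewrite HE A00 mulr0.
    rewrite (_ : (fun=> 0) = fun=> 0 * 0); last by apply/funext => x; rewrite mul0r.
    rewrite (bfunZ bnu _ (f := fun=> 0)); last exact: bm_cst.
    by rewrite mul0r normc0 mulr_ge0 ?(ltW Md)// mulr_ge0.
  have A1 : 0 < A by rewrite lt_neqAle eq_sym An0.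
  rewrite mulrA; exact: (scale nu B _ H (mulr_gt0 Md A1) nuB cH HM).
have -> : cmeasure_integral kappa f = cmeasure_integral kappa g +
    cmeasure_integral kappa (fun x => f x - g x).
  by rewrite (bfunB bk bfC bg); ring.
have bfg := bmB bfC bg.
have := normcD (cmeasure_integral kappa g) (cmeasure_integral kappa (fun x => f x - g x)).
have := hC _ _ bfg hN; move: kg delE; rewrite !mulrDl !mulrDr.
lra.
Qed.

Let tv_unit_ball (mu : cmeasure E R) (V : R) : tvnorm mu = V%:E ->
  forall f, continuous f -> (forall x, normc (f x) <= 1) ->
    normc (cmeasure_integral mu f) <= V.
Proof.
move=> muV f cf f1; rewrite -[V]mul1r; apply: normc_integral_le => //.
  exact: (ccont_bm E_compact cf).
by rewrite muV.
Qed.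

Let weak_unit_ball (u : nat -> cmeasure E R) (mu : cmeasure E R) : weak_cvg u mu ->
  exists2 A, 0 <= A & forall n f, continuous f -> (forall x, normc (f x) <= 1) ->
    normc (cmeasure_integral (u n) f) <= A.
Proof.
move=> /(weak_cvg_bounded E_compact)[C C0 hC]; exists (C + C); first exact: addr_ge0.
move=> n f /ccont_ReIm[cr ci] f1; have bu := bfun_cmeasure (u n).
have [br bi] := (bm_cont E_compact cr, bm_cont E_compact ci).
have -> : cmeasure_integral (u n) f =
    cmeasure_integral (u n) (fun x => (Re (f x))%:C) +
    'i * cmeasure_integral (u n) (fun x => (Im (f x))%:C).
  rewrite -(bfunZ bu)// -(bfunD bu)//; last exact: bmZ.
  by congr cmeasure_integral; apply/funext => x; exact: complexE.
rewrite (le_trans (normcD _ _))// lerD//.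
  by apply: (hC n _ cr) => x; apply: le_trans (f1 x); exact: ler_Re_normc.
rewrite normcM (_ : normc 'i = 1) ?mul1r; last first.
  by rewrite /= expr0n expr1n add0r sqrtr1.
by apply: (hC n _ ci) => x; apply: le_trans (f1 x); exact: ler_Im_normc.
Qed.

Let probability_of (rho : {finite_measure set E -> \bar R}) :
  fine (rho setT) = 1 -> cmeasure_probability (cmeasure_of rho).
Proof.
move=> rho1; split=> [A mA|]; rewrite /= mem_set// ?rho1//.
by rewrite lecR fine_ge0.
Qed.

Let Iprob mu : cmeasure_probability mu -> I mu 0%N = 1.
Proof.
move=> [_ mu1]; rewrite -mu1 -cmeasure_integral_indic//.
by congr cmeasure_integral; apply/funext => x; rewrite phi0 indicT.
Qed.

(** The product is characterised by its integrals of the [phi j]: all algebraic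
    identities are checked on them, and they form the trivializing family. The
    semigroup is recovered with [gamma t] the kernel issued from [a]. *)
Theorem convolution_exists : exists op, FLTC p op.
Proof.
have /choice[op opP] (mn : cmeasure E R * cmeasure E R) := is_product_exists mn.1 mn.2.
exists (fun mu nu => op (mu, nu)).
have {}opP mu nu j : I (op (mu, nu)) j = I mu j * I nu j by exact: (opP (mu, nu)).
have Idirac x j : I (cmeasure_dirac x) j = (phi j x)%:C.
  by rewrite cmeasure_integral_dirac.
have Ip t x j : 0 <= t ->
    I (cmeasure_of (p t x)) j = (expR (- lam j * t) * phi j x)%:C.
  move=> t0; rewrite cmeasure_integral_of// cintegral_real; congr (_%:C).
  rewrite (_ : phi j = fun x => (e j a)^-1 * e j x); last first.
    by apply/funext => y; rewrite mulrC.
  rewrite bmeas_intZ; last exact/continuous_bmeas/(sd_cont sd).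
  by rewrite (sd_eigen sd)//; ring.
have pP t x : 0 <= t -> cmeasure_probability (cmeasure_of (p t x)).
  by move=> t0; apply: probability_of; rewrite (sd_mass sd).
split.
- exact: (spectral_strong_feller E_compact sd).
- exists a; split.
  + move=> nu c mu mu'; apply: phi_eq => j.
    by rewrite cmeasure_integralD// cmeasure_integralZ// !opP
      cmeasure_integralD// cmeasure_integralZ//; ring.
  + move=> mu c nu nu'; apply: phi_eq => j.
    by rewrite cmeasure_integralD// cmeasure_integralZ// !opP
      cmeasure_integralD// cmeasure_integralZ//; ring.
  + by move=> mu nu rho; apply: phi_eq => j; rewrite !opP mulrA.
  + by move=> mu nu; apply: phi_eq => j; rewrite !opP mulrC.
  + by move=> mu; apply: phi_eq => j; rewrite opP Idirac phia mul1r.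
  + move=> mu nu; have [A A0 muA] := tvnorm_fin mu; have [B B0 nuB] := tvnorm_fin nu.
    rewrite muA nuB -EFinM; apply: (tvnorm_le_dual E_compact) => f cf f1.
    rewrite -[A * B]mul1r.
    exact: (product_bound (opP mu nu) A0 B0 (tv_unit_ball muA) (tv_unit_ball nuB)
      ltr01 cf f1).
  + exact: tvnorm_complete.
- move=> u v mu nu umu vnu f [cf _]; apply/cvg_normc => eps eps0.
  have [A A0 hA] := weak_unit_ball umu; have [B B0 hB] := weak_unit_ball vnu.
  have [C C0 hC] := bfun_bound (bfun_cmeasure (op (mu, nu))).
  have D0 : 0 < 3 * (1 + (A * B + C)) by rewrite mulr_gt0// ltr_wpDr// addr_ge0// mulr_ge0.
  have [del del0 delE] : exists2 del, 0 < del & del * (3 * (A * B + C)) < eps.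
    exists (eps / (3 * (1 + (A * B + C)))); first by rewrite divr_gt0.
    by rewrite mulrAC ltr_pdivrMr// ltr_pM2l// ltr_pM2l// ltrDr.
  have [c [N hN]] := phi_dense_complex cf del0.
  pose g x := \sum_(0 <= j < N) c j * (phi j x)%:C.
  have cg : continuous g.
    apply: ccont_sum => j; apply: ccontZ; exact: ccont_real.
  have bcphi j : bounded_measurable (fun x => c j * (phi j x)%:C) by exact: bmZ.
  have Ig (rho : cmeasure E R) : cmeasure_integral rho g = \sum_(0 <= j < N) c j * I rho j.
    rewrite (bfun_sum (bfun_cmeasure rho))//; apply: eq_bigr => j _.
    by rewrite (bfunZ (bfun_cmeasure rho)).
  have cphiC j : Cb (fun x => (phi j x)%:C : R[i]).
    exact: (ccont_Cb E_compact (ccont_real (@cphi j))).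
  have cvgg : (fun n => cmeasure_integral (op (u n, v n)) g) @ \oo -->
      cmeasure_integral (op (mu, nu)) g.
    rewrite Ig; under eq_fun do rewrite Ig.
    apply: cvg_finite_csum => j; apply: cvgMr; rewrite opP.
    under eq_fun do rewrite opP.
    by apply: cvgM; [exact: (umu _ (cphiC j))|exact: (vnu _ (cphiC j))].
  have eps30 : 0 < eps / 3 by rewrite divr_gt0.
  move/cvg_normc : cvgg => /(_ _ eps30); apply: filterS => n hn.
  have [bf bg] := (ccont_bm E_compact cf, ccont_bm E_compact cg).
  have cfg : continuous (fun x => f x - g x).
    by move=> x; apply: cvgB; [exact: cf|exact: cg].
  have bfg := ccont_bm E_compact cfg.
  pose k := op (mu, nu); pose kn := op (u n, v n).
  have h1 : normc (cmeasure_integral kn (fun x => f x - g x)) <= del * (A * B).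
    exact: (product_bound (opP (u n) (v n)) A0 B0 (hA n) (hB n) del0 cfg hN).
  have h2 : normc (cmeasure_integral k (fun x => f x - g x)) <= C * del.
    exact: (hC _ _ bfg hN).
  rewrite -/k -/kn in hn *.
  have -> : cmeasure_integral k f - cmeasure_integral kn f =
     cmeasure_integral k (fun x => f x - g x) +
    ((cmeasure_integral k g - cmeasure_integral kn g) -
     cmeasure_integral kn (fun x => f x - g x)).
    rewrite (bfunB (bfun_cmeasure k))// (bfunB (bfun_cmeasure kn))//; ring.
  rewrite (le_lt_trans (normcD _ _))//.
  have := normcD (cmeasure_integral k g - cmeasure_integral kn g)
    (- cmeasure_integral kn (fun x => f x - g x)).
  move: hn h1 h2 delE; rewrite normcN; nra.
- move=> mu nu pmu pnu.
  have [rm rmE] := cmeasure_probability_of pmu.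
  have [rn rnE] := cmeasure_probability_of pnu.
  have [k kP] := is_product_of rm rn.
  have kE : op (mu, nu) = cmeasure_of k.
    by apply: phi_eq => j; rewrite opP kP rmE rnE.
  rewrite kE; apply: probability_of.
  have : I (cmeasure_of k) 0%N = 1 by rewrite -kE opP !Iprob// mulr1.
  rewrite cmeasure_integral_of// cintegral_real => -[].
  by under eq_Rintegral do rewrite phi0; rewrite Rintegral_cst// mul1r.
- exists [set h | exists j, h = fun x => (phi j x)%:C].
    move=> _ [j ->]; split => // /(congr1 (fun h => h a)) /eqP.
    by rewrite phia oner_eq0.
  move=> mu mu1 mu2; split=> [-> _ [j ->]|h]; first exact: opP.
  by apply: phi_eq => j; rewrite opP; apply: h; exists j.
- exists (fun t => cmeasure_of (p t a)); split.
  + by move=> t t0; exact: pP.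
  + move=> t s t0 s0; apply: phi_eq => j; rewrite opP !Ip ?addr_ge0//.
    by rewrite !phia !mulr1 mulrDr expRD rmorphM.
  + move=> t x t0; apply: phi_eq => j; rewrite opP Idirac !Ip//.
    by rewrite phia mulr1 rmorphM.
Qed.

End convolution.

(** * Necessity of the positivity condition *)

Section density_measure.
Context {d : measure_display} {T : measurableType d} {R : realType}.
Variable (m : {finite_measure set T -> \bar R}) (g : T -> R).

Lemma cmeasure_with_density : bmeas g -> exists mu : cmeasure T R,
  forall f, bounded_measurable f ->
  cmeasure_integral mu f = cintegral m (fun x => f x * (g x)%:C).
Proof.
move=> bg; pose mu A : R[i] := if A \in measurable then (\int[m]_x (\1_A x * g x))%:C else 0.
have muE A : measurable A -> mu A = (\int[m]_x (\1_A x * g x))%:C.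
  by move=> mA; rewrite /mu mem_set.
have munm A : ~ measurable A -> mu A = 0 by move=> nA; rewrite /mu memNset.
have b1g A : measurable A -> bmeas (fun x => \1_A x * g x).
  by move=> mA; apply: bmeasM => //; exact: bmeas_indic.
have musa (F : (set T)^nat) : (forall n, measurable (F n)) -> trivIset setT F ->
    (fun n => \sum_(0 <= i < n) mu (F i)) @ \oo --> mu (\bigcup_n F n).
  move=> mF tF; have mU : measurable (\bigcup_n F n) by exact: bigcupT_measurable.
  have mUn n : measurable (\big[setU/set0]_(i < n) F i) by exact: bigsetU_measurable.
  have -> : (fun n => \sum_(0 <= i < n) mu (F i)) =
      fun n => (\int[m]_x (\1_(\big[setU/set0]_(i < n) F i) x * g x))%:C.
    apply/funext => n; under eq_bigr do rewrite muE//.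
    rewrite -raddf_sum/= -bmeas_int_sum => [|i]; last exact: b1g.
    congr (_%:C); apply: eq_Rintegral => x _.
    by rewrite -mulr_suml sum_indic_disjoint.
  rewrite muE//; apply: cvg_complex.
  have [_ [M gM]] := bg.
  have [||x|_ //] := @bounded_convergence _ _ _ m
    (fun n x => \1_(\big[setU/set0]_(i < n) F i) x * g x)
    (fun x => \1_(\bigcup_n F n) x * g x) M.
  - by move=> n; have [] := b1g _ (mUn n).
  - move=> n x; rewrite normrM -[M]mul1r ler_pM// indicE.
    by case: (_ \in _); rewrite ?normr1// normr0.
  apply: cvgM; last exact: cvg_cst.
  have [[k _ Fkx]|nFx] := pselect ((\bigcup_k F k) x).
    rewrite indicE mem_set; last by exists k.
    apply: cvg_near_cst; exists k.+1 => // j /= kj; rewrite indicE mem_set//.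
    by rewrite -bigcup_mkord; exists k.
  rewrite indicE memNset//; apply: cvg_near_cst; apply: nearW => j.
  rewrite indicE memNset// -bigcup_mkord => -[k _ Fkx]; apply: nFx.
  by exists k.
exists (CMeasure musa munm) => f bf.
have bgC : bounded_measurable (fun x => (g x)%:C : R[i]) by exact: bm_real.
have bI := bfun_cintegral m.
apply: (bfun_ext (I2 := fun f => cintegral m (fun x => f x * (g x)%:C))
  (bfun_cmeasure _)) => //.
  split.
  - move=> h k bh bk; rewrite -(bfunD bI); [|exact: bmM|exact: bmM].
    by congr cintegral; apply/funext => y; rewrite mulrDl.
  - move=> c h bh; rewrite -(bfunZ bI); last exact: bmM.
    by congr cintegral; apply/funext => y; rewrite mulrA.
  - have [C C0 hC] := bfun_bound bI; have [_ [M gM]] := bg.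
    have M0 : 0 <= M by rewrite (le_trans _ (gM point)).
    exists (C * M); first by rewrite mulr_ge0.
    move=> h N bh hN; rewrite -mulrA (hC _ (M * N))//; first exact: bmM.
    move=> y; rewrite normcM normcR mulrC ler_pM//; exact: normc_ge0.
move=> A mA; rewrite cmeasure_integral_indic//= muE//.
have -> : (fun x => (\1_A x)%:C * (g x)%:C) = fun x => (\1_A x * g x)%:C :> R[i].
  by apply/funext => x; rewrite rmorphM.
by rewrite cintegral_real.
Qed.

End density_measure.

Section necessity.
Context {d : measure_display} {R : realType} {E : borelMetricType d R}.
Hypothesis E_compact : compact [set: E].
Variable m : {finite_measure set E -> \bar R}.
Variable p : R -> E -> {finite_measure set E -> \bar R}.
Variable q : R -> E -> E -> R.
Variables (lam : nat -> R) (e : nat -> E -> R).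
Hypothesis sd : spectral_data m p q lam e.

Let ce j : continuous (e j). Proof. exact: (sd_cont sd). Qed.
Let be j : bmeas (e j). Proof. exact: continuous_bmeas. Qed.
Let coef (f : E -> R) j := \int[m]_y (f y * e j y).

(** The pointwise sum [h] of the expansion is obtained by composing the density at
    time [t / 2] with itself; it is nonnegative because that density is nonnegative
    almost everywhere. *)
Lemma heat_kernel_nonneg t xi : 0 < t -> exists h : E -> R,
  [/\ bmeas h, forall z, 0 <= h z & forall eps, 0 < eps ->
    exists N, forall n z, (N <= n)%N ->
    `|h z - \sum_(0 <= k < n) expR (- lam k * t) * e k z * e k xi| <= eps].
Proof.
move=> t0; have t20 : 0 < t / 2 by rewrite divr_gt0.
set s := t / 2 in t20; pose g := q s xi.
have bg : bmeas g by exact: (density_bmeas (sd_density sd)).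
have [_ [M qM] _ _] := sd_density sd t20.
pose neg y := Num.max (- g y) 0.
have bneg : bmeas neg by apply: bmeas_max; [exact: bmeasN|exact: bmeas_cst].
pose A := [set y | g y < 0].
have mA : measurable A.
  have -> : A = setT `&` g @^-1` [set` `]-oo, 0[].
    by apply/seteqP; split => y /=; rewrite in_itv/=; [|case].
  by have [mg _] := bg; exact: mg.
have neg0 : \int[m]_y neg y <= 0.
  have : 0 <= \int[p s xi]_y \1_A y.
    by apply: Rintegral_ge0 => y _; rewrite indicE; case: (_ \in _).
  rewrite (kernel_integral (sd_density sd))//; last exact: bmeas_indic.
  rewrite (_ : (fun y => _) = fun y => - neg y) ?bmeas_intN ?oppr_ge0//.
  apply/funext => y; rewrite -/g indicE /neg; have [Ay|nAy] := pselect (A y).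
    by rewrite mem_set// mul1r max_l ?opprK// oppr_ge0 ltW.
  rewrite memNset// mul0r max_r ?oppr0// oppr_le0 leNgt; exact/negP.
exists (fun z => \int[p s z]_y g y); split.
- by apply: continuous_bmeas => //; exact: (kernel_integral_continuous E_compact sd).
- move=> z; apply: (@le_trans _ _ (\int[p s z]_y - neg y)); last first.
    apply: bmeas_int_le => //; first exact: bmeasN.
    by move=> y; rewrite lerNl le_max lexx.
  rewrite bmeas_intN// oppr_ge0 (kernel_integral (sd_density sd))//.
  apply: (@le_trans _ _ (\int[m]_y (M * neg y))).
    apply: bmeas_int_le; [|exact: bmeasZ|].
      by apply: bmeasM => //; exact: (density_bmeas (sd_density sd)).
    move=> y; rewrite mulrC ler_wpM2r ?le_max ?lexx ?orbT//.
    exact: le_trans (ler_norm _) (qM z y).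
  rewrite bmeas_intZ// mulr_ge0_le0//.
  exact: le_trans (qM point point).
- move=> eps eps0; have [N hN] := uniform_expansion E_compact sd t20 bg eps0.
  exists N => n z Nn; rewrite (eq_bigr (fun k => expR (- lam k * s) * coef g k * e k z)).
    exact: hN.
  move=> k _; rewrite /coef (density_coef E_compact sd)//.
  rewrite (_ : - lam k * t = - lam k * s + - lam k * s); last by rewrite /s; field.
  by rewrite expRD; ring.
Qed.

(** Each trivializing function [h] satisfies that [p t x] integrates [h] to
    [h x] times the integral of [h] against [gamma t], so that it is an
    eigenfunction unless it is orthogonal to all of them. No index [j] is missed:
    otherwise the measure with density [e j] would be annihilated by the whole
    family, as the zero measure is. The normalisation at [a] comes from the
    identity element, the bound [|h| <= 1] from the square of a Dirac measure at
    a maximum of [|h|], and the positivity by integrating the heat kernel against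
    the product of two Dirac measures. *)
Theorem convolution_necessary : (exists op, FLTC p op) ->
  exists a : E, [/\ forall j, e j a != 0, forall j x, `|e j x| <= `|e j a| &
  forall t x y xi, 0 < t -> exists2 s : R, 0 <= s &
  (fun n => \sum_(0 <= j < n) e j a ^+ 2 * expR (- lam j * t)
    * (e j x / e j a) * (e j y / e j a) * (e j xi / e j a)) @ \oo --> s].
Proof.
move=> [op [_ [a cba] _ prob [Hs Hs_bm triv] [gamma [_ _ gammaE]]]].
have trivE mu nu h : Hs h -> cmeasure_integral (op mu nu) h =
    cmeasure_integral mu h * cmeasure_integral nu h.
  by move=> Th; have [/(_ erefl h Th)] := triv (op mu nu) mu nu.
have int0 f : bounded_measurable f -> cmeasure_integral (0 : cmeasure E R) f = 0.
  by move=> bf; rewrite -(scale0r 0) cmeasure_integralZ// mul0r.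
have dirac_prob x : cmeasure_probability (@cmeasure_dirac _ E R x).
  split=> [A mA|]; rewrite /= mem_set//; first by rewrite lecR.
  by rewrite indicT.
have [theta thetaP] : exists theta : nat -> E -> R[i], forall j,
    Hs (theta j) /\ cintegral m (fun x => theta j x * (e j x)%:C) != 0.
  suff /choice : forall j, exists h, Hs h /\ cintegral m (fun x => h x * (e j x)%:C) != 0
    by move=> [theta h]; exists theta => j; exact: h.
  move=> j; apply/not_existsP => nh.
  have [mu muE] := cmeasure_with_density m (be j).
  have mu0 : mu = 0.
    have -> : mu = op 0 0.
      apply/triv => h Th; have [bh _] := Hs_bm h Th; rewrite int0// mul0r muE//.
      by apply/eqP; apply/negP => nz; apply: (nh h); split => //; exact/negP.
    by apply/esym/triv => h Th; have [bh _] := Hs_bm h Th; rewrite int0// mul0r.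
  have := muE (fun x => (e j x)%:C) (bm_real (be j)).
  rewrite mu0 int0; last exact: bm_real.
  rewrite (_ : (fun x => _) = fun x => (e j x * e j x)%:C); last first.
    by apply/funext => x; rewrite rmorphM.
  rewrite cintegral_real (sd_ortho sd) eqxx => /esym/eqP.
  by rewrite (_ : true%:R%:C = 1 :> R[i])// oner_eq0.
have thetaE j x : theta j x = (e j x / e j a)%:C /\ e j a != 0.
  have [Tj c0] := thetaP j; have [bt t0] := Hs_bm _ Tj.
  set h := theta j in Tj c0 bt t0 *.
  have /bm_bmeas[br bi] := bt.
  pose G := cmeasure_integral (gamma 1) h.
  have hE z : cintegral (p 1 z) h = G * h z.
    rewrite -cmeasure_integral_of// gammaE// trivE//.
    by rewrite cmeasure_integral_dirac.
  pose c k : R[i] := (coef (Re \o h) k) +i* (coef (Im \o h) k).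
  have cE k : c k = cintegral m (fun x => h x * (e k x)%:C).
    apply: eqc => /=; apply: eq_Rintegral => z _.
      by rewrite cReM/= mulr0 subr0.
    by rewrite cImM/= mulr0 add0r.
  have cj0 : c j != 0 by rewrite cE.
  have bI := bfun_cintegral m.
  have Gc k : G * c k = (expR (- lam k))%:C * c k.
    have -> : G * c k = cintegral m (fun z => cintegral (p 1 z) h * (e k z)%:C).
      rewrite cE -(bfunZ bI); last by apply: bmM => //; exact: bm_real.
      by congr cintegral; apply/funext => z; rewrite hE mulrA.
    apply: eqc => /=.
      rewrite mul0r subr0 -[- lam k]mulr1 -(semigroup_coef E_compact sd)//.
      by apply: eq_Rintegral => z _; rewrite mulr0 subr0.
    rewrite mul0r addr0 -[- lam k]mulr1 -(semigroup_coef E_compact sd)//.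
    by apply: eq_Rintegral => z _; rewrite mulr0 add0r.
  have GE : G = (expR (- lam j))%:C by apply: (mulIf cj0).
  have ck0 k : k != j -> c k = 0.
    move=> kj; apply/eqP; apply: contraNT kj => ck0.
    have := mulIf ck0 (Gc k); rewrite GE => -[] /expR_inj /oppr_inj /(sd_inj sd) ->.
    by rewrite eqxx.
  have hcz z : h z = c j * (e j z)%:C.
    have G0 : G != 0 by rewrite GE -[0]/(0%:C) (inj_eq (@complexI _)) gt_eqF ?expR_gt0.
    apply: (mulfI G0); rewrite -hE GE; apply: eqc => /=.
      rewrite !mulr0 !mul0r !subr0 -[- lam j]mulr1.
      apply: (single_mode_expansion E_compact sd) => // k kj.
      by have := ck0 k kj => -[].
    rewrite !mulr0 !mul0r ?add0r ?addr0 -[- lam j]mulr1.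
    apply: (single_mode_expansion E_compact sd) => // k kj.
    by have := ck0 k kj => -[].
  have [z hz] : exists z, h z != 0.
    apply/not_existsP => nz; apply: t0; apply/funext => z; apply/eqP/negP => hz.
    by apply: (nz z); exact/negP.
  have ha : h a = 1.
    apply: (mulIf hz); rewrite mul1r.
    rewrite -[in RHS](cmeasure_integral_dirac z bt) -(cba_id cba (cmeasure_dirac z)).
    by rewrite trivE// !cmeasure_integral_dirac.
  have ea : e j a != 0.
    apply/eqP => ea; move: ha; rewrite hcz ea mulr0 => /esym/eqP.
    by rewrite oner_eq0.
  split=> //; rewrite hcz rmorphM/= mulrC; congr (_ * _).
  have eaC : (e j a)%:C != 0 :> R[i] by rewrite -[0]/(0%:C) (inj_eq (@complexI _)).
  by apply: (mulIf eaC); rewrite -hcz ha -rmorphM mulVf.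
have ea0 j : e j a != 0 by have [] := thetaE j a.
have Phi j : theta j = fun x => (e j x / e j a)%:C.
  by apply/funext => x; have [] := thetaE j x.
have product x y : exists rho : {finite_measure set E -> \bar R},
    fine (rho setT) = 1 /\ forall j,
    \int[rho]_z (e j z / e j a) = (e j x / e j a) * (e j y / e j a).
  have pxy := prob _ _ (dirac_prob x) (dirac_prob y).
  have [rho rhoE] := cmeasure_probability_of pxy.
  exists rho; split.
    by have [_] := pxy; rewrite rhoE/= mem_set// => -[].
  move=> j; have [Tj _] := thetaP j; have [bt _] := Hs_bm _ Tj.
  have := trivE (cmeasure_dirac x) (cmeasure_dirac y) _ Tj.
  rewrite rhoE cmeasure_integral_of// !cmeasure_integral_dirac// Phi.
  by rewrite cintegral_real -rmorphM => -[].
have bphi j : bmeas (fun x => e j x / e j a).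
  by under eq_fun do rewrite mulrC; exact: bmeasZ.
exists a; split => //.
- move=> j; have [x0 ex0] := continuous_max_attained E_compact (cont_norm (@ce j)).
  move=> x; apply: le_trans (ex0 x) _.
  have [rho [rho1 rhoP]] := product x0 x0.
  have ea_gt0 : 0 < `|e j a| by rewrite normr_gt0.
  set M := `|e j x0| / `|e j a|.
  have phiM z : `|e j z / e j a| <= M.
    by rewrite normrM normfV ler_wpM2r// invr_ge0 ltW.
  have M1 : 1 <= M by rewrite ler_pdivlMr// mul1r.
  have : M * M <= M * 1.
    rewrite -rho1; apply: le_trans (bmeas_int_abs rho (bphi j).1 phiM).
    by rewrite rhoP !normrM !normfV.
  rewrite ler_pM2l; last exact: lt_le_trans M1.
  by rewrite ler_pdivrMr// mul1r.
- move=> t x y xi t0.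
  have [rho [rho1 rhoP]] := product x y.
  have [h [bh h0 hh]] := heat_kernel_nonneg xi t0.
  exists (\int[rho]_z h z); first by apply: Rintegral_ge0 => z _.
  apply/cvgrPdist_le => eps eps0.
  have [N hN] := hh eps eps0; exists N => // n /= Nn.
  have bF : bmeas (fun z => \sum_(0 <= k < n) expR (- lam k * t) * e k z * e k xi).
    apply: bmeas_sum => k; under eq_fun do rewrite mulrAC.
    exact: bmeasZ.
  rewrite (_ : \sum_(0 <= j < n) _ =
    \int[rho]_z \sum_(0 <= k < n) expR (- lam k * t) * e k z * e k xi); last first.
    have -> : (fun z => \sum_(0 <= k < n) expR (- lam k * t) * e k z * e k xi) =
        fun z => \sum_(0 <= k < n) (expR (- lam k * t) * e k xi * e k a) * (e k z / e k a).
      apply/funext => z; apply: eq_bigr => k _; field; exact: ea0.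
    rewrite bmeas_int_sum => [|k]; last exact: bmeasZ.
    apply: eq_bigr => k _; rewrite bmeas_intZ// rhoP; field; exact: ea0.
  rewrite -bmeas_intB// -[eps]mulr1 -rho1; apply: bmeas_int_abs.
    by have [] := bmeasB bh bF.
  by move=> z; exact: hN.
Qed.

End necessity.

(** * Reduction to real eigenfunctions *)

Lemma conjcM {R : realType} (z w : R[i]) : (z * w)^*%R = z^*%R * w^*%R.
Proof. exact: rmorphM. Qed.

Lemma conjcR {R : realType} (x : R) : Num.conj (x%:C : R[i]) = x%:C.
Proof. by apply: eqc => //=; rewrite oppr0. Qed.

Lemma conjcV {R : realType} (z : R[i]) : (z^-1)^*%R = (z^*%R)^-1.
Proof. exact: fmorphV. Qed.

Section reduction.
Context {R : realType} {d : measure_display} {E : borelMetricType d R}.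
Variables (T : R -> (E -> R[i]) -> E -> R[i])
  (p : R -> E -> {finite_measure set E -> \bar R})
  (m : {finite_measure set E -> \bar R})
  (q : R -> E -> E -> R)
  (T2 : R -> (E -> R[i]) -> E -> R[i])
  (lambda : nat -> R) (omega : nat -> E -> R[i]).
Hypothesis E_compact : compact [set: E].
Hypothesis T_feller : feller_semigroup T.
Hypothesis T_conservative : conservative T.
Hypothesis p_kernel : transition_kernel T p.
Hypothesis q_density : kernel_density m p q.
Hypothesis T2_extends : forall t f, 0 <= t -> C0 f -> ae_eqc m (T2 t f) (T t f).
Hypothesis lambda_ge0 : forall j, 0 <= lambda j.
Hypothesis lambda_nondecreasing : forall j, lambda j <= lambda j.+1.
Hypothesis omega_basis : L2_orthonormal_basis m omega.
Hypothesis omega_eigen : forall t j, 0 <= t ->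
  ae_eqc m (T2 t (omega j)) (fun x => (expR (- lambda j * t))%:C * omega j x).
Hypothesis omega_continuous : forall j, continuous (omega j).
Hypothesis T2_simple : forall j, multiplicity_one m (T2 1) (expR (- lambda j))%:C.

Let contC0 (f : E -> R[i]) : continuous f -> C0 f.
Proof. by move=> cf; split => // eps eps0; exists setT => // x; case. Qed.

Let feller_real (f : E -> R) (eps : R) : continuous f -> 0 < eps ->
  exists2 t : R, 0 < t & forall x, `|f x - \int[p t x]_y f y| <= eps.
Proof.
move=> cf eps0; pose F x : R[i] := (f x)%:C.
have cF : continuous F by exact: ccont_real.
have CF := contC0 cF.
have /cvgrPdist_lt/(_ _ eps0) lim := feller_continuous T_feller CF.
have [t [t0 ht]] : exists t : R, 0 < t /\ `|0 - supnorm (fun x => T t F x - F x)| < eps.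
  have := @filter_ex _ _ (at_right_proper_filter (0 : R)) _
    (filterI (nbhs_right_gt 0) lim).
  by move=> [t [t0 ht]]; exists t.
exists t => // x.
have [cT _] := feller_stable T_feller (ltW t0) CF.
have cTF : continuous (fun x => T t F x - F x).
  by move=> z; apply: cvgB; [exact: cT|exact: cF].
have [_ [M TM]] := ccont_bm E_compact cTF.
move: ht; rewrite sub0r normrN => /(le_lt_trans (ler_norm _))/ltW; apply: le_trans.
have -> : `|f x - \int[p t x]_y f y| = normc (T t F x - F x).
  rewrite (p_kernel x (ltW t0) CF) cintegral_real -rmorphB normcR distrC//.
apply: ub_le_sup; last by exists x.
exists M => _ [z _ <-]; exact: TM.
Qed.

Let mass t x : 0 <= t -> p t x setT = 1%E.
Proof.
move=> t0.
have c1 : continuous (fun _ : E => 1 : R[i]) by move=> z; exact: cvg_cst.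
have := congr1 (fun f => f x) (T_conservative t0).
rewrite (p_kernel x t0 (contC0 c1)).
rewrite (_ : (fun=> 1) = fun=> 1%:C)// cintegral_real => -[].
rewrite Rintegral_cst// mul1r => p1.
by rewrite -[LHS]fineK ?fin_num_measure// p1.
Qed.

(** Integrating a continuous function that vanishes almost everywhere against
    [p t x] gives zero, and these measures concentrate at [x]. *)
Let ae_continuous_eq (f g : E -> R[i]) : continuous f -> continuous g ->
  ae_eqc m f g -> f = g.
Proof.
move=> cf cg fg; pose h x := normc (f x - g x).
have cfg : continuous (fun x => f x - g x).
  by move=> z; apply: cvgB; [exact: cf|exact: cg].
have ch : continuous h := cont_normc cfg.
have bh := continuous_bmeas E_compact ch.
have Ph t x : 0 < t -> \int[p t x]_y h y = 0.
  move=> t0; rewrite (kernel_integral q_density)//.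
  have bq := density_bmeas q_density x t0.
  have bhq := bmeasM bh bq.
  have -> : 0 = \int[m]_y 0 by rewrite Rintegral_cst// mul0r.
  rewrite /Rintegral; congr fine; apply: ae_eq_integral => //.
  - by apply/measurable_EFinP; have [] := bhq.
  - by apply: filterS fg => y fgy _; rewrite /h fgy subrr normc0 mul0r.
apply/funext => x; apply/eqP; rewrite -subr_eq0; apply/eqP/normc_eq0/eqP.
rewrite -/(h x) -normr_le0; apply/ler_gt0Pl => eps eps0.
have [t t0 ht] := feller_real ch eps0.
by have := ht x; rewrite Ph// subr0.
Qed.

Let T_omega t j : 0 <= t ->
  T t (omega j) = fun x => (expR (- lambda j * t))%:C * omega j x.
Proof.
move=> t0; have Cj := contC0 (@omega_continuous j).
apply: ae_continuous_eq.
- by have [] := feller_stable T_feller t0 Cj.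
- exact: (ccontZ (@omega_continuous j)).
- have h1 := T2_extends t0 Cj; have h2 := omega_eigen j t0.
  by apply: filterS2 h1 h2 => x <-.
Qed.

Let cintegral_eigen t j x : 0 <= t ->
  cintegral (p t x) (omega j) = (expR (- lambda j * t))%:C * omega j x.
Proof.
move=> t0; have Cj := contC0 (@omega_continuous j).
by rewrite -(p_kernel x t0 Cj) T_omega.
Qed.

Let bomega j : bounded_measurable (omega j).
Proof. exact: (ccont_bm E_compact (@omega_continuous j)). Qed.

Let L2dot_self j : L2dot m (omega j) (omega j) = 1.
Proof. by have [_ o _] := omega_basis; rewrite o eqxx. Qed.

Let L2dot_ae0 (f g : E -> R[i]) : bounded_measurable f -> bounded_measurable g ->
  ae_eqc m f (fun=> 0) -> L2dot m f g = 0.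
Proof.
move=> bf bg f0.
have bcg : bounded_measurable (fun x => (g x)^*%R).
  have /bm_bmeas[rg jg] := bg; apply/bm_bmeas; split.
    by rewrite (_ : _ \o _ = Re \o g)//; apply/funext => x /=; case: (g x).
  rewrite (_ : _ \o _ = fun x => - (Im (g x))); first exact: bmeasN.
  by apply/funext => x /=; case: (g x).
have /bm_bmeas[br bi] := bmM bf bcg.
have zero (k : E -> R) : bmeas k -> {ae m, forall x, k x = 0} -> \int[m]_x k x = 0.
  move=> bk k0; have -> : 0 = \int[m]_y 0 by rewrite Rintegral_cst// mul0r.
  rewrite /Rintegral; congr fine; apply: ae_eq_integral => //.
  - by apply/measurable_EFinP; have [] := bk.
  - by apply: filterS k0 => y -> _.
apply: eqc; rewrite /L2dot /cintegral; cbn [complex.Re complex.Im].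
  by apply: zero => //; apply: filterS f0 => x ->; rewrite mul0r.
by apply: zero => //; apply: filterS f0 => x ->; rewrite mul0r.
Qed.

Let omega_nonzero j : ~ ae_eqc m (omega j) (fun=> 0).
Proof.
move=> /(L2dot_ae0 (bomega j) (bomega j)).
by rewrite L2dot_self => /eqP; rewrite oner_eq0.
Qed.

Let L2_cont (f : E -> R[i]) : continuous f -> L2 m f.
Proof.
move=> cf; have bf := ccont_bm E_compact cf; split; first by have [] := bf.
have bn : bmeas (fun x => normc (f x) ^+ 2) by apply: bmeasM; exact: bm_normc.
have /integrableP[_] := bmeas_integrable m bn.
apply: le_lt_trans; rewrite le_eqVlt; apply/orP; left; apply/eqP.
by apply: eq_integral => x _; rewrite /= ger0_norm// sqr_ge0.
Qed.

Let eigen_line j (g : E -> R[i]) : continuous g ->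
  (forall x, cintegral (p 1 x) g = (expR (- lambda j))%:C * g x) ->
  exists c : R[i], g = fun x => c * omega j x.
Proof.
move=> cg gE.
have eig (h : E -> R[i]) : continuous h ->
    (forall x, cintegral (p 1 x) h = (expR (- lambda j))%:C * h x) ->
    L2_eigenvector m (T2 1) (expR (- lambda j))%:C h.
  move=> ch hE; split; first exact: L2_cont.
  have := T2_extends ler01 (contC0 ch); apply: filterS => x ->.
  by rewrite (p_kernel x ler01 (contC0 ch)) hE.
have [f [_ _ fP]] := T2_simple j.
have [c gc] := fP _ (eig g cg gE).
have [|c0 oc] := fP (omega j).
  by apply: (eig _ (@omega_continuous j)) => x; rewrite cintegral_eigen// mulr1.
have c00 : c0 != 0.
  apply/eqP => c00; apply: (@omega_nonzero j).
  by apply: filterS oc => x ->; rewrite c00 mul0r.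
exists (c / c0); apply: (ae_continuous_eq cg (ccontZ (@omega_continuous j))).
apply: filterS2 gc oc => x -> ->.
by rewrite mulrA divfK.
Qed.

(** The spectrum being simple, the conjugate of [omega j] is a multiple of
    [omega j], which forces [omega j] to have constant phase. *)
Let real_eigenfunction j : exists (u : R[i]) (e : E -> R), normc u = 1 /\
  forall x, omega j x = u * (e x)%:C.
Proof.
pose g x := (omega j x)^*%R.
have Reg : Re \o g = Re \o omega j by apply/funext => x /=; rewrite /g; case: (omega j x).
have Img : Im \o g = fun x => - Im (omega j x).
  by apply/funext => x /=; rewrite /g; case: (omega j x).
have /ccont_ReIm[cr ci] := @omega_continuous j.
have cg : continuous g.
  by apply/ccont_ReIm; rewrite Reg Img; split; [exact: cr|exact: (contN ci)].
have [c gc] : exists c : R[i], g = fun x => c * omega j x.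
  apply: (eigen_line cg) => x.
  have := cintegral_eigen j x ler01; rewrite mulr1 => h.
  have -> : cintegral (p 1 x) g = (cintegral (p 1 x) (omega j))^*%R.
    apply: eqc; rewrite /cintegral /=.
      by apply: eq_Rintegral => y _; rewrite /g; case: (omega j y).
    rewrite -bmeas_intN; last exact: (continuous_bmeas E_compact ci).
    by apply: eq_Rintegral => y _; rewrite /g; case: (omega j y).
  by rewrite h conjcM conjcR.
have [x0 wx0] : exists x0, omega j x0 != 0.
  apply/not_existsP => w0; apply: (@omega_nonzero j); apply: aeW => x.
  by apply/eqP/negP => wx; apply: (w0 x); exact/negP.
set v := omega j x0 in wx0.
have cv : v^*%R = c * v by have := congr1 (fun f => f x0) gc.
have vc0 : v^*%R != 0 by rewrite conjC_eq0.
have c0 : c != 0 by apply: contra vc0 => /eqP c0; rewrite cv c0 mul0r.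
have real x : (omega j x / v)^*%R = omega j x / v.
  have gx : (omega j x)^*%R = c * omega j x by have := congr1 (fun f => f x) gc.
  rewrite conjcM conjcV gx cv; field.
  by rewrite c0 wx0.
have ImR (z : R[i]) : z^*%R = z -> z = (Re z)%:C.
  case: z => a b [/eqP]; rewrite -subr_eq0 -opprD oppr_eq0 -mulr2n mulrn_eq0/=.
  by move=> /eqP ->.
have nv0 : normc v != 0 by apply: contra wx0 => /eqP/normc_eq0 ->.
exists (v / (normc v)%:C), (fun x => normc v * Re (omega j x / v)); split.
  by rewrite normcM normcV normcR ger0_norm ?normc_ge0// divff.
move=> x.
have -> : (normc v * Re (omega j x / v))%:C = (normc v)%:C * (omega j x / v).
  by rewrite [in RHS](ImR _ (real x)) rmorphM.
have nvC : (normc v)%:C != 0 :> R[i] by rewrite -[0]/(0%:C) (inj_eq (@complexI _)).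
by field; rewrite nvC wx0.
Qed.

Lemma real_eigenbasis : exists (u : nat -> R[i]) (e : nat -> E -> R),
  [/\ forall j, normc (u j) = 1, forall j x, omega j x = u j * (e j x)%:C &
      spectral_data m p q lambda e].
Proof.
have /choice[ue ueP] j : exists ue : R[i] * (E -> R), normc ue.1 = 1 /\
    forall x, omega j x = ue.1 * (ue.2 x)%:C.
  by have [u [e ueP]] := real_eigenfunction j; exists (u, e).
pose u j := (ue j).1; pose e j := (ue j).2.
have u1 j : normc (u j) = 1 by have [] := ueP j.
have oE j x : omega j x = u j * (e j x)%:C by have [_] := ueP j; exact.
have uu j : u j * (u j)^*%R = 1.
  by rewrite -normCK normr_normc u1 expr1n.
have u0 j : u j != 0.
  by apply/eqP => uj; have := u1 j; rewrite uj normc0 => /eqP; rewrite eq_sym oner_eq0.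
have eE j x : (e j x)%:C = (u j)^*%R * omega j x.
  by rewrite oE mulrA [_^*%R * _]mulrC uu mul1r.
have ce j : continuous (e j).
  have /ccont_ReIm[cr _] : continuous (fun x => (u j)^*%R * omega j x).
    exact: (ccontZ (@omega_continuous j)).
  by rewrite (_ : e j = Re \o (fun x => (u j)^*%R * omega j x))//;
    apply/funext => x /=; rewrite -eE.
have be j : bmeas (e j) := continuous_bmeas E_compact (@ce j).
have [omega_L2 omega_on omega_complete] := omega_basis.
have dotE i j : L2dot m (omega i) (omega j) =
    u i * (u j)^*%R * (\int[m]_x (e i x * e j x))%:C.
  rewrite /L2dot -cintegral_real -(bfunZ (bfun_cintegral m)); last first.
    by apply: bm_real; exact: bmeasM.
  congr cintegral; apply/funext => x.
  by rewrite !oE conjcM conjcR rmorphM; ring.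
have ortho i j : \int[m]_x (e i x * e j x) = (i == j)%:R.
  have := omega_on i j; rewrite dotE; have [->|ij] := eqVneq i j.
    by rewrite uu mul1r => -[].
  move=> /eqP; rewrite mulf_eq0 mulf_eq0 conjC_eq0 (negbTE (u0 i)) (negbTE (u0 j))/=.
  by rewrite -[0]/(0%:C) (inj_eq (@complexI _)) => /eqP.
exists u, e; split => //; split => //.
- move=> f bf.
  have bfC : bounded_measurable (fun x => (f x)%:C : R[i]) by exact: bm_real.
  have L2f : L2 m (fun x => (f x)%:C).
    split; first by have [] := bfC.
    have bn : bmeas (fun x => normc ((f x)%:C : R[i]) ^+ 2).
      by apply: bmeasM; exact: bm_normc.
    have /integrableP[_] := bmeas_integrable m bn.
    apply: le_lt_trans; rewrite le_eqVlt; apply/orP; left; apply/eqP.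
    by apply: eq_integral => x _; rewrite /comp abse_EFin ger0_norm// sqr_ge0.
  have := omega_complete _ L2f.
  have dotf j : L2dot m (fun x => (f x)%:C) (omega j) =
      (u j)^*%R * (\int[m]_x (f x * e j x))%:C.
    rewrite /L2dot -cintegral_real -(bfunZ (bfun_cintegral m)); last first.
      by apply: bm_real; exact: bmeasM.
    congr cintegral; apply/funext => x.
    by rewrite !oE conjcM conjcR rmorphM; ring.
  have normE n : L2norm m (fun x => (f x)%:C -
      \sum_(0 <= j < n) L2dot m (fun x => (f x)%:C) (omega j) * omega j x) =
    Num.sqrt (\int[m]_x (f x - \sum_(0 <= j < n) \int[m]_y (f y * e j y) * e j x) ^+ 2).
    rewrite /L2norm; congr Num.sqrt; apply: eq_Rintegral => x _.
    rewrite (_ : _ - _ = (f x - \sum_(0 <= j < n) \int[m]_y (f y * e j y) * e j x)%:C).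
      by rewrite normcR real_normK ?num_real.
    rewrite rmorphB; congr (_ - _); rewrite raddf_sum; apply: eq_bigr => j _.
    rewrite dotf oE (_ : _ * _ = (u j * (u j)^*%R) * ((\int[m]_y (f y * e j y))%:C * (e j x)%:C)).
      by rewrite uu mul1r -rmorphM.
    by ring.
  under eq_fun do rewrite normE.
  pose I n := \int[m]_x (f x - \sum_(0 <= j < n) \int[m]_y (f y * e j y) * e j x) ^+ 2.
  have I0 n : 0 <= I n by apply: Rintegral_ge0 => x _; exact: sqr_ge0.
  move=> h; have h2 : (fun n => Num.sqrt (I n) * Num.sqrt (I n)) @ \oo --> (0 * 0 : R).
    exact: (cvgM h h).
  rewrite (_ : (fun n => _) = fun n => Num.sqrt (I n) * Num.sqrt (I n)); last first.
    by apply/funext => n; rewrite -expr2 sqr_sqrtr.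
  by rewrite mul0r in h2.
- move=> t j x t0; apply: (complexI (R := R)).
  apply: (mulfI (u0 j)); rewrite rmorphM.
  have -> : u j * ((expR (- lambda j * t))%:C * (e j x)%:C) =
    (expR (- lambda j * t))%:C * omega j x by rewrite oE; ring.
  rewrite -cintegral_eigen// -cintegral_real.
  rewrite -(bfunZ (bfun_cintegral (p t x))); last exact: bm_real.
  by congr cintegral; apply/funext => y; rewrite oE.
- move=> i j lij; apply/eqP; apply: contraT => ij.
  have [|c oc] := @eigen_line j (omega i) (@omega_continuous i).
    by move=> x; rewrite -lij cintegral_eigen// mulr1.
  have bjj : bounded_measurable (fun x => omega j x * (omega j x)^*%R).
    have := bm_bmeas (fun x => omega j x * (omega j x)^*%R).
    have -> : (fun x => omega j x * (omega j x)^*%R) = fun x => (e j x * e j x)%:C.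
      apply/funext => x; rewrite oE conjcM conjcR.
      rewrite (_ : _ * _ = (u j * (u j)^*%R) * ((e j x)%:C * (e j x)%:C)); last by ring.
      by rewrite uu mul1r -rmorphM.
    by move=> _; apply: bm_real; exact: bmeasM.
  have : L2dot m (omega i) (omega j) = c * L2dot m (omega j) (omega j).
    rewrite oc /L2dot -(bfunZ (bfun_cintegral m))//.
    by congr cintegral; apply/funext => x; rewrite mulrA.
  rewrite L2dot_self omega_on (negbTE ij) mulr1 => c0.
  have /eqP := L2dot_self i; rewrite oc /L2dot -c0.
  have -> : (fun x => false%:R * omega j x * (false%:R * omega j x)^*%R) = fun=> 0%:C :> R[i].
    by apply/funext => x; rewrite mul0r mul0r.
  by rewrite cintegral_real Rintegral_cst// mul0r eq_sym oner_eq0.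
Qed.

End reduction.

(** * The characterisation *)

(** [no], [phiE], [normE] and [seriesE] translate between [omega] and the real
    eigenfunctions: the phases cancel in the quotients [omega j x / omega j a]. *)
Theorem corollary3p4 (R : realType) (d : measure_display)
  (E : borelMetricType d R)
  (T : R -> (E -> R[i]) -> E -> R[i])
  (p : R -> E -> {finite_measure set E -> \bar R})
  (m : {finite_measure set E -> \bar R})
  (q : R -> E -> E -> R)
  (T2 : R -> (E -> R[i]) -> E -> R[i])
  (lambda : nat -> R) (omega : nat -> E -> R[i])
  (E_compact : compact [set: E])
  (T_feller : feller_semigroup T)
  (T_conservative : conservative T)
  (p_kernel : transition_kernel T p)
  (L2_infinite : L2_infinite_dimensional m)
  (q_density : kernel_density m p q)
  (T2_semigroup : L2_semigroup m T2)
  (T2_extends : forall t f, 0 <= t -> C0 f -> ae_eqc m (T2 t f) (T t f))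
  (lambda_ge0 : forall j, 0 <= lambda j)
  (lambda_nondecreasing : forall j, lambda j <= lambda j.+1)
  (omega_basis : L2_orthonormal_basis m omega)
  (omega_eigen : forall t j, 0 <= t ->
    ae_eqc m (T2 t (omega j)) (fun x => (expR (- lambda j * t))%:C * omega j x))
  (omega_continuous : forall j, continuous (omega j))
  (T2_simple : forall j, multiplicity_one m (T2 1) (expR (- lambda j))%:C) :
  (exists op : cmeasure E R -> cmeasure E R -> cmeasure E R, FLTC p op)
  <->
  (exists a : E, (forall j, normc (omega j a) = supnorm (omega j)) /\
    let phi j x := omega j x / omega j a in
    forall (t : R) (x y xi : E), 0 < t ->
      exists2 s : R[i],
        series (fun j => ((L2norm m (phi j) ^+ 2)^-1
                          * expR (- lambda j * t))%:C
                         * phi j x * phi j y * phi j xi) @ \oo --> s &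
        0 <= s).
Proof.
have [u [e [u1 oE sd]]] := real_eigenbasis E_compact T_feller T_conservative
  p_kernel q_density T2_extends lambda_ge0 lambda_nondecreasing omega_basis
  omega_eigen omega_continuous T2_simple.
have ce j : continuous (e j) := sd_cont sd (j := j).
have no j x : normc (omega j x) = `|e j x| by rewrite oE normcM u1 mul1r normcR.
have supE j : supnorm (omega j) = sup (range (fun x => `|e j x|)).
  by congr sup; apply/seteqP; split => _ [x _ <-]; exists x => //=; rewrite -no.
have supP j : has_sup (range (fun x => `|e j x|)).
  split; first by exists `|e j point|, point.
  by have [M _ eM] := continuous_bounded E_compact (ce j); exists M => _ [x _ <-].
have le_sup j x : `|e j x| <= supnorm (omega j).
  by rewrite supE; apply: ub_le_sup; [case: (supP j)|exists x].
have u0 j : u j != 0.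
  by apply/eqP => uj; have := u1 j; rewrite uj normc0 => /eqP; rewrite eq_sym oner_eq0.
have phiE a j : e j a != 0 ->
    (fun x => omega j x / omega j a) = fun x => (e j x / e j a)%:C.
  move=> ea; have eaC : (e j a)%:C != 0 :> R[i] by rewrite -[0]/(0%:C) (inj_eq (@complexI _)).
  apply/funext => x; rewrite !oE.
  have -> : (e j x / e j a)%:C = (e j x)%:C / (e j a)%:C :> R[i].
    by rewrite rmorphM fmorphV.
  by field; rewrite eaC u0.
have normE a j : e j a != 0 ->
    (L2norm m (fun x => omega j x / omega j a) ^+ 2)^-1 = e j a ^+ 2.
  move=> ea; rewrite phiE// /L2norm sqr_sqrtr; last first.
    by apply: Rintegral_ge0 => x _; exact: sqr_ge0.
  rewrite (_ : (fun x => _) = fun x => (e j a ^+ 2)^-1 * (e j x * e j x)); last first.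
    by apply/funext => x; rewrite normcR real_normK ?num_real//; field.
  have bee : bmeas (fun x => e j x * e j x).
    by apply: bmeasM; exact: (continuous_bmeas E_compact (ce j)).
  by rewrite bmeas_intZ// (sd_ortho sd) eqxx mulr1 invrK.
have seriesE a t x y xi n : (forall j, e j a != 0) ->
    series (fun j => ((L2norm m (fun x => omega j x / omega j a) ^+ 2)^-1
      * expR (- lambda j * t))%:C * (omega j x / omega j a) * (omega j y / omega j a)
      * (omega j xi / omega j a)) n =
    (\sum_(0 <= j < n) e j a ^+ 2 * expR (- lambda j * t)
      * (e j x / e j a) * (e j y / e j a) * (e j xi / e j a))%:C.
  move=> ea; rewrite /series/= raddf_sum; apply: eq_bigr => j _.
  have pE z : omega j z / omega j a = (e j z / e j a)%:C.
    by have := congr1 (fun f => f z) (phiE a j (ea j)).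
  by rewrite normE// !pE -!rmorphM.
split.
- move=> /(convolution_necessary E_compact sd)[a [ea ea_max pos]].
  exists a; split.
    move=> j; apply/eqP; rewrite eq_le no le_sup/= supE.
    by apply: ge_sup; [case: (supP j)|move=> _ [x _ <-]].
  move=> phi t x y xi t0; have [s s0 ss] := pos t x y xi t0.
  exists s%:C; last by rewrite lecR.
  rewrite (_ : series _ = fun n => (\sum_(0 <= j < n) e j a ^+ 2 * expR (- lambda j * t)
      * (e j x / e j a) * (e j y / e j a) * (e j xi / e j a))%:C).
    exact: cvg_complex ss.
  by apply/funext => n; exact: seriesE.
- move=> [a [a_sup pos]].
  have ea_max j x : `|e j x| <= `|e j a| by rewrite -(no j a) a_sup.
  have ea j : e j a != 0.
    apply/eqP => ea; have := sd_ortho sd j j; rewrite eqxx.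
    rewrite (_ : (fun x => _) = fun=> 0) ?Rintegral_cst ?mul0r//.
      by move/eqP; rewrite eq_sym oner_eq0.
    apply/funext => x; have := ea_max j x; rewrite ea normr0 normr_le0 => /eqP ->.
    by rewrite mul0r.
  apply: (convolution_exists E_compact sd ea ea_max) => t x y xi t0.
  have [s ss s0] := pos t x y xi t0.
  exists (complex.Re s); first by move: s0; case: (s) => b c; rewrite lecE/= => /andP[].
  have := cvg_Re ss.
  rewrite (_ : _ \o _ = fun n => \sum_(0 <= j < n) e j a ^+ 2 * expR (- lambda j * t)
      * (e j x / e j a) * (e j y / e j a) * (e j xi / e j a))//.
  by apply/funext => n /=; rewrite seriesE.
Qed.
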